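(* A program $P$ is robust against Power if and only if there is no Power computation of $P$ in normal form of degree $|P|+3$ whose trace has a cyclic happens-before relation $hb=po\cup co\cup src\cup cf$.
   Context: Programs. Fix a finite set $D$ of values, which also serve as addresses, with $0\in D$, and a finite set $\mathit{Reg}$ of registers taking values in $D$. Expressions are built from constants in $D$, registers, and functions over $D\cup\{\bot\}$ that return $\bot$ iff some argument is $\bot$. Commands are: loads $r\leftarrow \mathrm{mem}[e]$, stores $\mathrm{mem}[e]\leftarrow e'$, local assignments $r\leftarrow e$, and conditionals $\mathrm{assume}(e)$. A thread is a finite automaton whose transitions (called instructions) are labeled by commands; all control states are final. A program $P=T_1\cdots T_n$ is a finite sequence of threads; thread $T_t$ has id $t\in\{1,\dots,|P|\}$ ($|P|$ = number of threads). Power semantics. A state consists of, for each thread $t$, a runtime state $(F,C,L)$, where $F$ is the sequence of fetched instructions, $C\subseteq\{1..|F|\}$ the set of committed indices, and $L$ maps each index to $\bot$ or to the store the load there has read (an initial store $\mathrm{init}_a$ of value $0$ to address $a$, or a pair $(t',i')$ denoting the $i'$-th fetched instruction of thread $t'$); and a storage state $(co,prop)$, where $co$ assigns rational coherence keys to committed stores (initial stores have key $0$) and $prop(t,a)$ is the last store to address $a$ propagated to thread $t$ (initially $\mathrm{init}_a$). For the $i$-th fetched instruction of thread $t$, the value of a register $r$ is determined by the latest earlier fetched assignment or load to $r$ ($0$ if none; for a load: $\bot$ if it has read nothing yet, $0$ if it read an initial store, otherwise the value written by the store it read); expressions are evaluated accordingly; $\mathrm{addr}(t,i)$ and $\mathrm{val}(t,i)$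 are the evaluated address and value arguments ($\top$ if none). Address/data dependencies of an instruction are the earlier instructions its address/value expression depends on via registers; control dependencies are all earlier fetched assume instructions. Transitions (labeled by events) are: (fetch) append to $F$ an instruction of $T_t$ whose source state is the target of the last fetched instruction (or the initial state), event $(\mathrm{fetch},t,\text{instr})$; (load from memory) for a fetched load $i$ with $L[i]=\bot$ and address $a\neq\bot$, set $L[i]:=prop(t,a)$, event $(\mathrm{load},t,i,a)$; (early read) for such a load, if the greatest $i'<i$ such that instruction $i'$ is a store with address in $\{a,\bot\}$ has address $a$, known value, and is not committed, set $L[i]:=(t,i')$, same event; (commit of a non-store) for uncommitted $i$ whose address, data and control dependencies are committed, with address and value $\neq\bot$, all earlier instructions with address $a$ or $\bot$ committed if the instruction has address $a$, $L[i]\neq\bot$ for loads, and value $\neq0$ for assumes: add $i$ to $C$, event $(\mathrm{commit},t,i)$; (commit of a store) same preconditions, choose a key $k$ not used by any other store, set $co(t,i):=k$, event $(\mathrm{commit},t,i,k,a)$, immediately followed by propagation of this store to thread $t$; (propagate) for a committed store $(t',i')$ to address $a$ with $co(prop(t,a))<co(t',i')$, set $prop(t,a):=(t',i')$, event $(\mathrm{prop},t,t',i',a)$. Final states: all fetched instructions committed; for loads $i'<i$ of the same thread and address, $co(L[i'])\le co(L[i])$; for a store $i'$ and later load $i$ of the same thread and address, $co(t,i')\le co(L[i])$. Power computations $C_{\mathrm{Power}}(P)$ are the event sequences from the initial state to a final state; SC computations $C_{\mathrm{SC}}(P)\subseteq C_{\mathrm{Power}}(P)$ are those in which each instruction is executed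 atomically and stores are immediately propagated to all threads. Traces and robustness. The trace of a computation is the graph whose nodes are the fetched instructions (with thread id and index) plus initial stores, with relations: program order $po$ (consecutive fetched instructions of a thread), coherence order $co$ (stores to the same address ordered by key; $\mathrm{init}_a$ before all stores to $a$), source order $src$ (store $\to$ load that read it), conflict order $cf=\{(x,y)\mid \exists z: z\,src\,x,\ z\,co\,y\}$. $P$ is robust iff every trace of a Power computation of $P$ is the trace of some SC computation of $P$. Normal form. An event is related to instruction $(t,i)$ if it is the fetch of the $i$-th instruction of thread $t$, or a load/commit event of $(t,i)$, or a propagate event $(\mathrm{prop},t'',t,i,a)$ of store $(t,i)$. A computation $\tau$ is in normal form of degree $n$ if $\tau=\tau_1\cdots\tau_n$ such that (A) all fetch events lie in $\tau_1$, and (B) whenever $e_j,e_j'$ are events related to instruction $(t_j,i_j)$ for $j=1,2$, with $e_1,e_2\in\tau_s$ and $e_1',e_2'\in\tau_{s'}$, then $e_1$ precedes $e_2$ in $\tau_s$ iff $e_1'$ precedes $e_2'$ in $\tau_{s'}$.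
   Formalization: Condition (B) of the normal form is required only for two distinct instructions; read literally for equal ones it would forbid a store's commit and its own-thread propagation in the same part, making the claim false for programs with many stores. *)

(* Defs.v *)
From mathcomp Require Import all_boot all_order all_algebra.
From Stdlib Require Import Relations.Relation_Operators.
From Stdlib Require List.
Set Implicit Arguments.
Unset Strict Implicit.
Unset Printing Implicit Defensive.
Import Order.TTheory GRing.Theory Num.Theory.

(* Expressions: constants of D, registers, and (strict) functions.
   A function over D ∪ {⊥} that returns ⊥ iff some argument is ⊥ is
   exactly determined by its restriction [seq D -> D] to defined
   arguments; evaluation below is strict. *)
Inductive expr (D Reg : Type) : Type :=
| EConst of D
| EReg of Reg
| EApp of (seq D -> D) & seq (expr D Reg).

Inductive cmd (D Reg : Type) : Type :=
| CLoad of Reg & expr D Reg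
| CStore of expr D Reg & expr D Reg    (* mem[e] <- e'     *)
| CAssign of Reg & expr D Reg
| CAssume of expr D Reg.

Record instr (D Reg : Type) := Instr
  { i_src : nat; i_cmd : cmd D Reg; i_tgt : nat }.

(* A thread: finite automaton with initial state and finite set of
   transitions; all control states are final. *)
Record thread (D Reg : Type) := Thread
  { th_init : nat; th_trans : seq (instr D Reg) }.

Definition program (D Reg : Type) := seq (thread D Reg).

(* What a load has read: an initial store init_a, or the i-th fetched
   instruction of thread t. *)
Inductive lsrc (D : Type) : Type :=
| SInit of D
| SStore of nat & nat.

Record rstate (D Reg : Type) := RState
  { rF : seq (instr D Reg);          (* fetched instructions        *)
    rC : nat -> bool;                (* committed indices           *)
    rL : nat -> option (lsrc D) }.

Record gstate (D Reg : Type) := GState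
  { rt : nat -> rstate D Reg;
    gco : nat -> nat -> option rat;      (* coherence keys of committed stores *)
    gprop : nat -> D -> lsrc D }.

Definition init_state (D Reg : Type) : gstate D Reg :=
  {| rt := fun _ => {| rF := [::]; rC := fun _ => false; rL := fun _ => None |};
     gco := fun _ _ => None;
     gprop := fun _ a => SInit a |}.

Definition ins_at (D Reg : Type) (s : gstate D Reg) (t i : nat) : option (instr D Reg) :=
  nth None (map Some (rF (rt s t))) i.

Definition cmd_at (D Reg : Type) (s : gstate D Reg) (t i : nat) : option (cmd D Reg) :=
  omap (@i_cmd D Reg) (ins_at s t i).

Definition writes (D : Type) (Reg : eqType) (r : Reg) (c : cmd D Reg) : bool :=
  match c with
  | CLoad r' _ => r' == r
  | CAssign r' _ => r' == r
  | _ => false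
  end.

Definition writes_at (D : Type) (Reg : eqType) (s : gstate D Reg) (t j : nat) (r : Reg) : bool :=
  match cmd_at s t j with Some c => writes r c | None => false end.

Definition last_writer (D : Type) (Reg : eqType) (s : gstate D Reg) (t i : nat) (r : Reg) (j : nat) : Prop :=
  j < i /\ writes_at s t j r /\ (forall k, j < k -> k < i -> ~~ writes_at s t k r).

Definition is_store (D Reg : Type) (c : cmd D Reg) : bool :=
  if c is CStore _ _ then true else false.
Definition is_load (D Reg : Type) (c : cmd D Reg) : bool :=
  if c is CLoad _ _ then true else false.

Definition store_at (D Reg : Type) (s : gstate D Reg) (t i : nat) : bool :=
  if cmd_at s t i is Some c then is_store c else false.
Definition load_at (D Reg : Type) (s : gstate D Reg) (t i : nat) : bool :=
  if cmd_at s t i is Some c then is_load c else false.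

(* Values of registers and expressions (⊥ = no derivation).           *)
(* regval d0 s t i r v : in state s, the value of register r for the  *)
(* i-th fetched instruction of thread t is v (d0 plays the role of 0).*)

Inductive regval (D Reg : finType) (d0 : D) (s : gstate D Reg) :
  nat -> nat -> Reg -> D -> Prop :=
| RV_none t i r :
    (forall j, j < i -> ~~ writes_at s t j r) -> regval d0 s t i r d0
| RV_assign t i r j e v :
    last_writer s t i r j -> cmd_at s t j = Some (CAssign r e) ->
    evalx d0 s t j e v -> regval d0 s t i r v
| RV_load_init t i r j e a :
    last_writer s t i r j -> cmd_at s t j = Some (CLoad r e) ->
    rL (rt s t) j = Some (SInit a) -> regval d0 s t i r d0
| RV_load_store t i r j e t' i' ea ev v :
    last_writer s t i r j -> cmd_at s t j = Some (CLoad r e) ->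
    rL (rt s t) j = Some (SStore D t' i') ->
    cmd_at s t' i' = Some (CStore ea ev) ->
    evalx d0 s t' i' ev v -> regval d0 s t i r v
with evalx (D Reg : finType) (d0 : D) (s : gstate D Reg) :
  nat -> nat -> expr D Reg -> D -> Prop :=
| EV_const t i d : evalx d0 s t i (EConst Reg d) d
| EV_reg t i r v : regval d0 s t i r v -> evalx d0 s t i (EReg D r) v
| EV_app t i f es vs : evalxs d0 s t i es vs -> evalx d0 s t i (EApp f es) (f vs)
with evalxs (D Reg : finType) (d0 : D) (s : gstate D Reg) :
  nat -> nat -> seq (expr D Reg) -> seq D -> Prop :=
| EVs_nil t i : evalxs d0 s t i [::] [::]
| EVs_cons t i e es v vs :
    evalx d0 s t i e v -> evalxs d0 s t i es vs -> evalxs d0 s t i (e :: es) (v :: vs).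

Definition addr_arg (D Reg : Type) (c : cmd D Reg) : option (expr D Reg) :=
  match c with
  | CLoad _ e => Some e
  | CStore e _ => Some e
  | _ => None
  end.

Definition val_arg (D Reg : Type) (c : cmd D Reg) : option (expr D Reg) :=
  match c with
  | CLoad _ _ => None
  | CStore _ e => Some e
  | CAssign _ e => Some e
  | CAssume e => Some e
  end.

Definition addr_val (D Reg : finType) (d0 : D) (s : gstate D Reg) (t i : nat) (a : D) : Prop :=
  exists c e, cmd_at s t i = Some c /\ addr_arg c = Some e /\ evalx d0 s t i e a.
Definition addr_bot (D Reg : finType) (d0 : D) (s : gstate D Reg) (t i : nat) : Prop :=
  exists c e, cmd_at s t i = Some c /\ addr_arg c = Some e /\ forall a, ~ evalx d0 s t i e a.
Definition val_val (D Reg : finType) (d0 : D) (s : gstate D Reg) (t i : nat) (v : D) : Prop :=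
  exists c e, cmd_at s t i = Some c /\ val_arg c = Some e /\ evalx d0 s t i e v.
Definition val_bot (D Reg : finType) (d0 : D) (s : gstate D Reg) (t i : nat) : Prop :=
  exists c e, cmd_at s t i = Some c /\ val_arg c = Some e /\ forall v, ~ evalx d0 s t i e v.

Fixpoint regs (D Reg : Type) (e : expr D Reg) : seq Reg :=
  match e with
  | EConst _ => [::]
  | EReg r => [:: r]
  | EApp _ es =>
      (fix regss (es : seq (expr D Reg)) : seq Reg :=
         match es with [::] => [::] | e' :: es' => regs e' ++ regss es' end) es
  end.

Definition depends_on (D Reg : finType) (s : gstate D Reg) (t i : nat) (e : expr D Reg) (j : nat) : Prop :=
  exists r, r \in regs e /\ last_writer s t i r j.

Definition addr_dep (D Reg : finType) (s : gstate D Reg) (t i j : nat) : Prop :=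
  exists c e, cmd_at s t i = Some c /\ addr_arg c = Some e /\ depends_on s t i e j.
Definition data_dep (D Reg : finType) (s : gstate D Reg) (t i j : nat) : Prop :=
  exists c e, cmd_at s t i = Some c /\ val_arg c = Some e /\ depends_on s t i e j.
Definition ctrl_dep (D Reg : finType) (s : gstate D Reg) (t i j : nat) : Prop :=
  j < i /\ exists e, cmd_at s t j = Some (CAssume e).

Inductive event (D Reg : Type) : Type :=
| EvFetch of nat & instr D Reg
| EvLoad of nat & nat & D
| EvCommit of nat & nat
| EvCommitSt of nat & nat & rat & D
| EvProp of nat & nat & nat & D.

Definition upd_rt (D Reg : finType) (s : gstate D Reg) (t : nat) (r : rstate D Reg) : gstate D Reg :=
  {| rt := fun t' => if t' == t then r else rt s t'; gco := gco s; gprop := gprop s |}.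

Definition setL (D Reg : Type) (r : rstate D Reg) (i : nat) (v : option (lsrc D)) : rstate D Reg :=
  {| rF := rF r; rC := rC r; rL := fun j => if j == i then v else rL r j |}.

Definition setC (D Reg : Type) (r : rstate D Reg) (i : nat) : rstate D Reg :=
  {| rF := rF r; rC := fun j => (j == i) || rC r j; rL := rL r |}.

Definition cur_ctrl (D Reg : Type) (th : thread D Reg) (F : seq (instr D Reg)) : nat :=
  match F with [::] => th_init th | x :: F' => i_tgt (last x F') end.

Definition keyof (D Reg : Type) (s : gstate D Reg) (l : lsrc D) : option rat :=
  match l with SInit _ => Some 0%R | SStore t i => gco s t i end.

Definition commit_ok (D Reg : finType) (d0 : D) (s : gstate D Reg) (t i : nat) : Prop :=
  i < size (rF (rt s t)) /\ ~~ rC (rt s t) i /\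
  (forall j, addr_dep s t i j -> rC (rt s t) j) /\
  (forall j, data_dep s t i j -> rC (rt s t) j) /\
  (forall j, ctrl_dep s t i j -> rC (rt s t) j) /\
  ~ addr_bot d0 s t i /\ ~ val_bot d0 s t i /\
  (forall a, addr_val d0 s t i a ->
     forall j, j < i -> (addr_val d0 s t j a \/ addr_bot d0 s t j) -> rC (rt s t) j) /\
  (forall r e, cmd_at s t i = Some (CLoad r e) -> rL (rt s t) i <> None) /\
  (forall e, cmd_at s t i = Some (CAssume e) -> exists v, evalx d0 s t i e v /\ v <> d0).

Inductive step (D Reg : finType) (d0 : D) (P : program D Reg) :
  gstate D Reg -> event D Reg -> gstate D Reg -> Prop :=
| st_fetch s t ins :
    t < size P ->
    List.In ins (th_trans (nth (Thread 0 [::]) P t)) ->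
    i_src ins = cur_ctrl (nth (Thread 0 [::]) P t) (rF (rt s t)) ->
    step d0 P s (EvFetch t ins)
      (upd_rt s t {| rF := rcons (rF (rt s t)) ins; rC := rC (rt s t); rL := rL (rt s t) |})
| st_load_mem s t i r e a :
    t < size P ->
    cmd_at s t i = Some (CLoad r e) -> rL (rt s t) i = None ->
    addr_val d0 s t i a ->
    step d0 P s (EvLoad Reg t i a) (upd_rt s t (setL (rt s t) i (Some (gprop s t a))))
| st_early_read s t i r e a i' :
    t < size P ->
    cmd_at s t i = Some (CLoad r e) -> rL (rt s t) i = None ->
    addr_val d0 s t i a ->
    i' < i -> store_at s t i' -> addr_val d0 s t i' a ->
    (exists v, val_val d0 s t i' v) -> ~~ rC (rt s t) i' ->
    (forall j, i' < j -> j < i -> store_at s t j ->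
       ~ addr_val d0 s t j a /\ ~ addr_bot d0 s t j) ->
    step d0 P s (EvLoad Reg t i a) (upd_rt s t (setL (rt s t) i (Some (SStore D t i'))))
| st_commit s t i :
    t < size P -> commit_ok d0 s t i -> ~~ store_at s t i ->
    step d0 P s (EvCommit D Reg t i) (upd_rt s t (setC (rt s t) i))
| st_commit_store s t i k a :
    t < size P -> commit_ok d0 s t i -> store_at s t i -> addr_val d0 s t i a ->
    k <> 0%R -> (forall t' i', gco s t' i' <> Some k) ->
    step d0 P s (EvCommitSt Reg t i k a)
      {| rt := fun t' => if t' == t then setC (rt s t) i else rt s t';
         gco := fun t' i' => if (t' == t) && (i' == i) then Some k else gco s t' i';
         gprop := gprop s |}
| st_prop s t t' i' a k k0 :
    t < size P -> t' < size P ->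
    store_at s t' i' -> rC (rt s t') i' -> gco s t' i' = Some k ->
    addr_val d0 s t' i' a ->
    keyof s (gprop s t a) = Some k0 -> (k0 < k)%R ->
    step d0 P s (EvProp Reg t t' i' a)
      {| rt := rt s; gco := gco s;
         gprop := fun t'' a' => if (t'' == t) && (a' == a) then SStore D t' i' else gprop s t'' a' |}.

Inductive run (D Reg : finType) (d0 : D) (P : program D Reg) :
  gstate D Reg -> seq (event D Reg) -> gstate D Reg -> Prop :=
| run_nil s : run d0 P s [::] s
| run_cons s e s1 evs s2 : step d0 P s e s1 -> run d0 P s1 evs s2 -> run d0 P s (e :: evs) s2.

Definition ev_at (D Reg : Type) (evs : seq (event D Reg)) (n : nat) : option (event D Reg) :=
  nth None (map Some evs) n.

Definition commit_store_then_prop (D Reg : Type) (evs : seq (event D Reg)) : Prop :=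
  forall n t i k a, ev_at evs n = Some (EvCommitSt Reg t i k a) ->
    ev_at evs n.+1 = Some (EvProp Reg t t i a).

Definition final (D Reg : finType) (d0 : D) (P : program D Reg) (s : gstate D Reg) : Prop :=
  [/\ (forall t i, t < size P -> i < size (rF (rt s t)) -> rC (rt s t) i),
      (forall t i' i a, t < size P -> i' < i -> load_at s t i' -> load_at s t i ->
          addr_val d0 s t i' a -> addr_val d0 s t i a ->
          exists l' l k1 k2, [/\ rL (rt s t) i' = Some l', rL (rt s t) i = Some l,
                               keyof s l' = Some k1, keyof s l = Some k2 & (k1 <= k2)%R]) &
      (forall t i' i a, t < size P -> i' < i -> store_at s t i' -> load_at s t i ->
          addr_val d0 s t i' a -> addr_val d0 s t i a ->
          exists l k1 k2, [/\ gco s t i' = Some k1, rL (rt s t) i = Some l,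
                             keyof s l = Some k2 & (k1 <= k2)%R])].

(* A Power computation [evs] of P, reaching final state s.  (Since an
   early read and a load from memory carry the same event, the final
   state, and hence the trace, is attached to the run.) *)
Definition power_run (D Reg : finType) (d0 : D) (P : program D Reg)
  (evs : seq (event D Reg)) (s : gstate D Reg) : Prop :=
  [/\ run d0 P (init_state D Reg) evs s, final d0 P s & commit_store_then_prop evs].

Definition is_fetch_of (D Reg : Type) (t : nat) (e : event D Reg) : bool :=
  if e is EvFetch t' _ then t' == t else false.

Definition is_fetch (D Reg : Type) (e : event D Reg) : bool :=
  if e is EvFetch _ _ then true else false.

Definition sc_block (D Reg : Type) (P : program D Reg) (t i : nat) (blk : seq (event D Reg)) : Prop :=
  exists ins : instr D Reg,
    match i_cmd ins with
    | CAssign _ _ | CAssume _ => blk = [:: EvFetch t ins; EvCommit D Reg t i]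
    | CLoad _ _ => exists a, blk = [:: EvFetch t ins; EvLoad Reg t i a; EvCommit D Reg t i]
    | CStore _ _ => exists k a ts,
        [/\ perm_eq ts (iota 0 (size P)), head 0 ts = t &
            blk = EvFetch t ins :: EvCommitSt Reg t i k a :: map (fun t'' => EvProp Reg t'' t i a) ts]
    end.

Definition sc_shaped (D Reg : Type) (P : program D Reg) (evs : seq (event D Reg)) : Prop :=
  exists bs : seq (seq (event D Reg)),
    flatten bs = evs /\
    forall n, n < size bs -> exists t,
      sc_block P t (count (is_fetch_of t) (flatten (take n bs))) (nth [::] bs n).

Definition sc_run (D Reg : finType) (d0 : D) (P : program D Reg)
  (evs : seq (event D Reg)) (s : gstate D Reg) : Prop :=
  power_run d0 P evs s /\ sc_shaped P evs.

Inductive node (D : Type) : Type :=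
| NInit of D          (* initial store init_a                    *)
| NIns of nat & nat.  (* i-th fetched instruction of thread t      *)

Record trace (D Reg : Type) := Trace
  { tr_F : seq (seq (instr D Reg));
    tr_co : node D -> node D -> Prop;
    tr_src : node D -> node D -> Prop }.

Definition node_of (D : Type) (l : lsrc D) : node D :=
  match l with SInit a => NInit a | SStore t i => NIns D t i end.

Definition committed_store (D Reg : finType) (d0 : D) (P : program D Reg) (s : gstate D Reg)
  (t i : nat) (a : D) (k : rat) : Prop :=
  [/\ t < size P, i < size (rF (rt s t)), store_at s t i, addr_val d0 s t i a & gco s t i = Some k].

Definition trace_of (D Reg : finType) (d0 : D) (P : program D Reg) (s : gstate D Reg) : trace D Reg :=
  {| tr_F := map (fun t => rF (rt s t)) (iota 0 (size P));
     tr_co := fun x y =>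
       (exists a t i k, x = NInit a /\ y = NIns D t i /\ committed_store d0 P s t i a k) \/
       (exists a t i k t' i' k', x = NIns D t i /\ y = NIns D t' i' /\
          committed_store d0 P s t i a k /\ committed_store d0 P s t' i' a k' /\ (k < k')%R);
     tr_src := fun z x =>
       exists t i l, x = NIns D t i /\ t < size P /\ i < size (rF (rt s t)) /\
                        load_at s t i /\ rL (rt s t) i = Some l /\ z = node_of l |}.

Definition trace_eq (D Reg : Type) (T1 T2 : trace D Reg) : Prop :=
  [/\ tr_F T1 = tr_F T2,
      (forall x y, tr_co T1 x y <-> tr_co T2 x y) &
      (forall x y, tr_src T1 x y <-> tr_src T2 x y)].

Definition tr_po (D Reg : Type) (T : trace D Reg) (x y : node D) : Prop :=
  exists t i, x = NIns D t i /\ y = NIns D t i.+1 /\ i.+1 < size (nth [::] (tr_F T) t).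

Definition tr_cf (D Reg : Type) (T : trace D Reg) (x y : node D) : Prop :=
  exists z, tr_src T z x /\ tr_co T z y.

Definition tr_hb (D Reg : Type) (T : trace D Reg) (x y : node D) : Prop :=
  tr_po T x y \/ tr_co T x y \/ tr_src T x y \/ tr_cf T x y.

Definition hb_cyclic (D Reg : Type) (T : trace D Reg) : Prop :=
  exists x, clos_trans (node D) (@tr_hb D Reg T) x x.

Definition robust (D Reg : finType) (d0 : D) (P : program D Reg) : Prop :=
  forall evs s, power_run d0 P evs s ->
    exists evs' s', sc_run d0 P evs' s' /\ trace_eq (trace_of d0 P s) (trace_of d0 P s').

Definition related (D Reg : Type) (evs : seq (event D Reg)) (p t i : nat) : Prop :=
  match ev_at evs p with
  | Some (EvFetch t' _) => t' = t /\ i = count (is_fetch_of t) (take p evs)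
  | Some (EvLoad t' i' _) => t' = t /\ i' = i
  | Some (EvCommit t' i') => t' = t /\ i' = i
  | Some (EvCommitSt t' i' _ _) => t' = t /\ i' = i
  | Some (EvProp _ t' i' _) => t' = t /\ i' = i
  | None => False
  end.

(* evs = tau_1 ... tau_n (pieces possibly empty; tau_1 is [nth 0]) *)
Definition normal_form (D Reg : Type) (n : nat) (evs : seq (event D Reg)) : Prop :=
  exists taus : seq (seq (event D Reg)),
    let off s := sumn (map size (take s taus)) in
    [/\ size taus = n, flatten taus = evs,
        (forall s j e, 0 < s -> ev_at (nth [::] taus s) j = Some e -> ~~ is_fetch e) &
        (forall s s' j1 j2 j1' j2' t1 i1 t2 i2,
            (t1, i1) <> (t2, i2) ->
            j1 < size (nth [::] taus s) -> j2 < size (nth [::] taus s) ->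
            j1' < size (nth [::] taus s') -> j2' < size (nth [::] taus s') ->
            related evs (off s + j1) t1 i1 -> related evs (off s + j2) t2 i2 ->
            related evs (off s' + j1') t1 i1 -> related evs (off s' + j2') t2 i2 ->
            (j1 < j2 <-> j1' < j2'))].

(* Main.v *)
(* A computation with acyclic happens-before has the trace of the SC computation
   which executes its instructions atomically along a linear extension of
   happens-before, and SC computations are acyclic; so it remains to bring some
   cyclic computation into normal form, by induction on the number of
   instructions.

   If the last instruction x of some thread is read by no load, delete it. When the
   rest is still cyclic the induction hypothesis applies; otherwise the rest can be
   sorted by a linear extension of its happens-before between the at most |P|+1
   events of x, and this, after the fetches, is the normal form.

   Otherwise every thread ends in a store which is read by some load. Once all these
   stores are committed, all assumes are committed and all addresses are known, so
   the computation can be completed at any point, each thread running alone against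
   the memory it sees. Just after the commit of the last of these stores the
   completion leaves that store unread, which is the previous case; at the end the
   completion is the whole, cyclic, computation. At the first event from which on
   the completion is cyclic, the part before it can be sorted along the acyclic
   completion that precedes, and fetches, sorted prefix, event, completion is a
   normal form. *)
Require Import Defs.
From mathcomp Require Import all_boot all_order all_algebra.
From mathcomp.classical Require Import boolp.
From Stdlib Require Import Relations.Relation_Operators.
From Stdlib Require List.
From HB Require Import structures.
Set Implicit Arguments.
Unset Strict Implicit.
Unset Printing Implicit Defensive.
Import Order.TTheory GRing.Theory Num.Theory.

(* All sorting rests on one exchange principle: an event may overtake another unless the instruction
   of the overtaken one lies below that of the overtaking one in a preorder containing
   happens-before. A propagation that overtakes a load, a commit or a propagation cannot disturb it,
   because a larger key would be a [cf] or [co] edge in the forbidden direction. Edges at a deleted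
   instruction x are exempt, so no event may pass an event of x: its at most |P|+1 events separate
   |P|+2 pieces, and the fetches make |P|+3. The completion case needs only four pieces.

   A completion exists because committing the last store of a thread required all earlier assumes to
   be committed and all earlier addresses to be known. Its stores take the coherence keys they have
   at the end of the given computation and are propagated to no other thread, so the threads do not
   interact and the completion can be scheduled along any order compatible with program order, in
   particular along the one in which the prefix was sorted. *)
Scheme regval_mind := Minimality for regval Sort Prop
  with evalx_mind := Minimality for evalx Sort Prop
  with evalxs_mind := Minimality for evalxs Sort Prop.
Combined Scheme eval_mind from regval_mind, evalx_mind, evalxs_mind.

(** * Evaluation of expressions and its transfer between states *)

Section Evaluation.
Variables (D Reg : finType) (d0 : D).
Implicit Types (S : gstate D Reg) (t i j : nat).

Lemma gstate_ext S S' :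
  (forall t, rF (rt S t) = rF (rt S' t)) ->
  (forall t i, rC (rt S t) i = rC (rt S' t) i) ->
  (forall t i, rL (rt S t) i = rL (rt S' t) i) ->
  (forall t i, gco S t i = gco S' t i) ->
  (forall t a, gprop S t a = gprop S' t a) -> S = S'.
Proof.
case: S S' => [r c p] [r' c' p'] /= hF hC hL hc hp.
congr GState.
- apply: funext => t; move: (hF t) (hC t) (hL t).
  case: (r t) => F C L; case: (r' t) => F' C' L' /= -> h1 h2.
  by congr RState; apply: funext.
- by apply: funext => t; apply: funext.
by apply: funext => t; apply: funext.
Qed.

Lemma cmd_at_lt S t i c : cmd_at S t i = Some c -> i < size (rF (rt S t)).
Proof.
rewrite /cmd_at /ins_at; case: ltnP => // le.
by rewrite nth_default // size_map.
Qed.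

Lemma cmd_at_ex S t i : i < size (rF (rt S t)) -> exists c, cmd_at S t i = Some c.
Proof.
rewrite /cmd_at /ins_at; elim: (rF (rt S t)) i => // x F IH [|i] /=; first by exists (i_cmd x).
exact: IH.
Qed.

Lemma cmd_at_eqF S S' t i : rF (rt S t) = rF (rt S' t) -> cmd_at S t i = cmd_at S' t i.
Proof. by rewrite /cmd_at /ins_at => ->. Qed.

Lemma last_writer_uniq S t i (r : Reg) j j' :
  last_writer S t i r j -> last_writer S t i r j' -> j = j'.
Proof.
move=> [lt [w h]] [lt' [w' h']]; case: (ltngtP j j') => // lt2.
  by move: (h _ lt2 lt'); rewrite w'.
by move: (h' _ lt2 lt); rewrite w.
Qed.

Lemma last_writer_ex S t i (r : Reg) :
  (forall j, j < i -> ~~ writes_at S t j r) \/ exists j, last_writer S t i r j.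
Proof.
elim: i => [|i [IH|[j [lt [w h]]]]]; first by left.
  case: (boolP (writes_at S t i r)) => hw.
    by right; exists i; split=> //; split=> // k lk; rewrite ltnS leqNgt lk.
  by left=> j; rewrite ltnS leq_eqVlt => /orP[/eqP->|/IH].
right; case: (boolP (writes_at S t i r)) => hw.
  by exists i; split=> //; split=> // k lk; rewrite ltnS leqNgt lk.
exists j; split; first exact: leqW.
by split=> // k lk; rewrite ltnS leq_eqVlt => /orP[/eqP->|/h->].
Qed.

(** Induction on derivations, since a register loaded from a store leads to an instruction of a
    possibly different thread and no index decreases. *)
Lemma eval_det S :
  [/\ forall t i (r : Reg) v, regval d0 S t i r v -> forall v', regval d0 S t i r v' -> v = v',
      forall t i e v, evalx d0 S t i e v -> forall v', evalx d0 S t i e v' -> v = v' &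
      forall t i es vs, evalxs d0 S t i es vs -> forall vs', evalxs d0 S t i es vs' -> vs = vs'].
Proof.
have nolw t i (r : Reg) j : (forall j, j < i -> ~~ writes_at S t j r) -> last_writer S t i r j -> False.
  by move=> h [/h/negP n [w _]].
suff [h1 [h2 h3]] : (forall t i (r : Reg) v, regval d0 S t i r v -> forall v', regval d0 S t i r v' -> v = v') /\
      (forall t i e v, evalx d0 S t i e v -> forall v', evalx d0 S t i e v' -> v = v') /\
      (forall t i es vs, evalxs d0 S t i es vs -> forall vs', evalxs d0 S t i es vs' -> vs = vs') by [].
apply: (@eval_mind D Reg d0 S
  (fun t i r v => forall v', regval d0 S t i r v' -> v = v')
  (fun t i e v => forall v', evalx d0 S t i e v' -> v = v')
  (fun t i es vs => forall vs', evalxs d0 S t i es vs' -> vs = vs')).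
- by move=> t i r h v' H; inversion H; subst => //; case: (nolw _ _ _ _ h H0).
- move=> t i r j e v lw cm ev IH v' H; inversion H; subst.
  + by case: (nolw _ _ _ _ H0 lw).
  + have ej := last_writer_uniq lw H0; subst j0.
    by move: H1; rewrite cm => -[?]; subst; apply: IH.
  + have ej := last_writer_uniq lw H0; subst j0; by move: H1; rewrite cm.
  + have ej := last_writer_uniq lw H0; subst j0; by move: H1; rewrite cm.
- move=> t i r j e a lw cm ld v' H; inversion H; subst => //.
  + have ej := last_writer_uniq lw H0; subst j0; by move: H1; rewrite cm.
  + have ej := last_writer_uniq lw H0; subst j0; by move: H2; rewrite ld.
- move=> t i r j e t' i' ea ev v lw cm ld cm' _ IH v' H; inversion H; subst.
  + by case: (nolw _ _ _ _ H0 lw).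
  + have ej := last_writer_uniq lw H0; subst j0; by move: H1; rewrite cm.
  + have ej := last_writer_uniq lw H0; subst j0; by move: H2; rewrite ld.
  + have ej := last_writer_uniq lw H0; subst j0.
    move: H2; rewrite ld => -[? ?]; subst; move: H3; rewrite cm' => -[? ?]; subst.
    exact: IH.
- by move=> t i d v' H; inversion H.
- by move=> t i r v _ IH v' H; inversion H; subst; apply: IH.
- by move=> t i f es vs _ IH v' H; inversion H; subst; congr (f _); apply: IH.
- by move=> t i v' H; inversion H.
- move=> t i e es v vs _ IH1 _ IH2 v' H; inversion H; subst.
  by congr (_ :: _); [apply: IH1|apply: IH2].
Qed.

Lemma evalx_det S t i e v v' : evalx d0 S t i e v -> evalx d0 S t i e v' -> v = v'.
Proof. by case: (eval_det S) => _ h _ /h; apply. Qed.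

Lemma addr_det S t i a a' : addr_val d0 S t i a -> addr_val d0 S t i a' -> a = a'.
Proof.
move=> [c [e [h1 [h2 h3]]]] [c' [e' [h1' [h2' h3']]]].
move: h1'; rewrite h1 => -[?]; subst; move: h2'; rewrite h2 => -[?]; subst.
exact: evalx_det h3 h3'.
Qed.

(* [dom] will be the set of instructions on which the second state knows at least
   as much as the first one. *)
Record xe S S' (dom : nat -> nat -> Prop) : Prop := Xe {
  x_po : forall t i j, dom t i -> j < i -> dom t j;
  x_cmd : forall t i, dom t i -> cmd_at S' t i = cmd_at S t i;
  x_L : forall t i l, dom t i -> rL (rt S t) i = Some l -> rL (rt S' t) i = Some l;
  x_src : forall t i t' i', dom t i -> rL (rt S t) i = Some (SStore D t' i') -> dom t' i' }.

(** Commits are kept apart from [xe] because evaluation never looks at them: values also transfer to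
    states with fewer commits. *)
Record xf S S' (dom : nat -> nat -> Prop) : Prop := Xf {
  x_xe :> xe S S' dom;
  x_C : forall t i, dom t i -> rC (rt S t) i -> rC (rt S' t) i }.

Lemma xfI S S' (dom : nat -> nat -> Prop) :
  (forall t i j, dom t i -> j < i -> dom t j) ->
  (forall t i, dom t i -> cmd_at S' t i = cmd_at S t i) ->
  (forall t i l, dom t i -> rL (rt S t) i = Some l -> rL (rt S' t) i = Some l) ->
  (forall t i, dom t i -> rC (rt S t) i -> rC (rt S' t) i) ->
  (forall t i t' i', dom t i -> rL (rt S t) i = Some (SStore D t' i') -> dom t' i') ->
  xf S S' dom.
Proof. by []. Qed.

Section Transfer.
Variables (S S' : gstate D Reg) (dom : nat -> nat -> Prop).
Hypothesis X : xe S S' dom.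

Lemma xf_writes t j r : dom t j -> writes_at S' t j r = writes_at S t j r.
Proof. by move=> h; rewrite /writes_at (x_cmd X h). Qed.

Lemma xf_lw t i r j : (forall j, j < i -> dom t j) ->
  last_writer S t i r j <-> last_writer S' t i r j.
Proof.
move=> h; split=> -[lt [w hk]]; split=> //; split.
- by rewrite xf_writes //; apply: h.
- by move=> k k1 k2; rewrite xf_writes ?hk //; apply: h.
- by rewrite -xf_writes //; apply: h.
- by move=> k k1 k2; rewrite -xf_writes ?hk //; apply: h.
Qed.

(** A derivation for instruction [i] visits only earlier instructions of its thread and, through
    loads, stores that were read; [dom] is closed under both. *)
Lemma xf_eval t i e v : (forall j, j < i -> dom t j) -> evalx d0 S t i e v -> evalx d0 S' t i e v.
Proof.
suff [_ [h2 _]] : (forall t i (r : Reg) v, regval d0 S t i r v -> (forall j, j < i -> dom t j) -> regval d0 S' t i r v) /\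
      (forall t i e v, evalx d0 S t i e v -> (forall j, j < i -> dom t j) -> evalx d0 S' t i e v) /\
      (forall t i es vs, evalxs d0 S t i es vs -> (forall j, j < i -> dom t j) -> evalxs d0 S' t i es vs)
  by move=> hd /h2; apply.
apply: (@eval_mind D Reg d0 S
  (fun t i r v => (forall j, j < i -> dom t j) -> regval d0 S' t i r v)
  (fun t i e v => (forall j, j < i -> dom t j) -> evalx d0 S' t i e v)
  (fun t i es vs => (forall j, j < i -> dom t j) -> evalxs d0 S' t i es vs)) => {t i e v}.
- move=> t i r h hd; apply: RV_none => j lt; rewrite xf_writes ?h //; exact: hd.
- move=> t i r j e v lw cm _ IH hd; have ltj := lw.1.
  apply: (@RV_assign _ _ _ _ _ _ _ j e); first by apply/(xf_lw _ _ hd).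
    by rewrite (x_cmd X) //; apply: hd.
  by apply: IH => k lk; apply: hd; apply: ltn_trans ltj.
- move=> t i r j e a lw cm ld hd; have ltj := lw.1.
  apply: (@RV_load_init _ _ _ _ _ _ _ j e a); first by apply/(xf_lw _ _ hd).
    by rewrite (x_cmd X) //; apply: hd.
  by apply: (x_L X) => //; apply: hd.
- move=> t i r j e t' i' ea ev v lw cm ld cm' _ IH hd; have ltj := lw.1.
  have hd' : dom t' i' by apply: (x_src X _ ld); apply: hd.
  apply: (@RV_load_store _ _ _ _ _ _ _ j e t' i' ea ev); first by apply/(xf_lw _ _ hd).
  + by rewrite (x_cmd X) //; apply: hd.
  + by apply: (x_L X) => //; apply: hd.
  + by rewrite (x_cmd X).
  by apply: IH => k lk; apply: (x_po X) lk.
- by move=> *; apply: EV_const.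
- by move=> t i r v _ IH hd; apply/EV_reg/IH.
- by move=> t i f es vs _ IH hd; apply/EV_app/IH.
- by move=> *; apply: EVs_nil.
- by move=> t i e es v vs _ IH1 _ IH2 hd; apply: EVs_cons; [apply: IH1|apply: IH2].
Qed.

Lemma xf_addr t i a : dom t i -> addr_val d0 S t i a -> addr_val d0 S' t i a.
Proof.
move=> hd [c [e [h1 [h2 h3]]]]; exists c, e; split; first by rewrite (x_cmd X).
by split=> //; apply: xf_eval h3 => j; apply: (x_po X).
Qed.

Lemma xf_val t i v : dom t i -> val_val d0 S t i v -> val_val d0 S' t i v.
Proof.
move=> hd [c [e [h1 [h2 h3]]]]; exists c, e; split; first by rewrite (x_cmd X).
by split=> //; apply: xf_eval h3 => j; apply: (x_po X).
Qed.

Lemma xf_store t i : dom t i -> store_at S' t i = store_at S t i.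
Proof. by move=> h; rewrite /store_at (x_cmd X). Qed.
Lemma xf_load t i : dom t i -> load_at S' t i = load_at S t i.
Proof. by move=> h; rewrite /load_at (x_cmd X). Qed.

End Transfer.

Definition has_addr S t i := exists c e, cmd_at S t i = Some c /\ addr_arg c = Some e.

Lemma addr_val_has S t i a : addr_val d0 S t i a -> has_addr S t i.
Proof. by move=> [c [e [h1 [h2 h3]]]]; exists c, e. Qed.

Lemma has_addr_known S t i : has_addr S t i -> ~ addr_bot d0 S t i -> exists a, addr_val d0 S t i a.
Proof.
move=> [c [e [h1 h2]]] nb; apply: contrapT => na; apply: nb; exists c, e; split=> //; split=> // a ev.
by apply: na; exists a; exists c; exists e.
Qed.

Lemma addr_val_bot S t i a : addr_val d0 S t i a -> ~ addr_bot d0 S t i.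
Proof.
move=> [c [e [h1 [h2 h3]]]] [c' [e' [h1' [h2' h3']]]].
move: h1'; rewrite h1 => -[?]; subst; move: h2'; rewrite h2 => -[?]; subst.
exact: h3' h3.
Qed.

(** The part of [commit_ok] that persists. The condition on earlier accesses is put positively, as
    committed or at a known different address, so that every clause survives when more becomes
    known; a committed instruction therefore satisfies it forever. *)
Definition cok S t i : Prop :=
  i < size (rF (rt S t)) /\
  (forall j, addr_dep S t i j -> rC (rt S t) j) /\
  (forall j, data_dep S t i j -> rC (rt S t) j) /\
  (forall j, ctrl_dep S t i j -> rC (rt S t) j) /\
  ~ addr_bot d0 S t i /\ ~ val_bot d0 S t i /\
  (forall a, addr_val d0 S t i a ->
     forall j, j < i -> has_addr S t j ->
       rC (rt S t) j \/ exists2 a', addr_val d0 S t j a' & a' <> a) /\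
  (forall r e, cmd_at S t i = Some (CLoad r e) -> rL (rt S t) i <> None) /\
  (forall e, cmd_at S t i = Some (CAssume e) -> exists v, evalx d0 S t i e v /\ v <> d0).

Lemma commit_okE S t i : commit_ok d0 S t i <-> ~~ rC (rt S t) i /\ cok S t i.
Proof.
split.
  move=> [h1 [h2 [h3 [h4 [h5 [h6 [h7 [h8 [h9 h10]]]]]]]]].
  do 7![split=> //]; split; last by split.
  move=> a av j lt ha.
  case: (boolP (rC (rt S t) j)) => hC; [by left|right].
  have [] := @has_addr_known S t j ha.
    by move=> hb; move: (h8 a av j lt (or_intror hb)); rewrite (negPf hC).
  move=> a' av'; exists a' => // ea; subst a'.
  by move: (h8 a av j lt (or_introl av')); rewrite (negPf hC).
move=> [h0 [h1 [h2 [h3 [h4 [h5 [h6 [h7 [h8 h9]]]]]]]]].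
do 7![split=> //]; split; last by split.
move=> a av j lt ha.
have haj : has_addr S t j.
  by case: ha => [/addr_val_has//|[c [e [h1' [h2' h3']]]]]; exists c, e.
case: (h7 a av j lt haj) => // -[a' av' na]; case: ha => hb.
  by case: na; apply: addr_det av' hb.
by case: (addr_val_bot av' hb).
Qed.

Lemma cok_addr S t i : cok S t i -> has_addr S t i -> exists a, addr_val d0 S t i a.
Proof. by move=> [_ [_ [_ [_ [h _]]]]] ha; apply: has_addr_known. Qed.

Lemma cok_val S t i c e : cok S t i -> cmd_at S t i = Some c -> val_arg c = Some e ->
  exists v, evalx d0 S t i e v.
Proof.
move=> [_ [_ [_ [_ [_ [h _]]]]]] h1 h2; apply: contrapT => n; apply: h.
by exists c, e; split=> //; split=> // v ev; apply: n; exists v.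
Qed.

Lemma cok_ctrl S t i j : cok S t i -> ctrl_dep S t i j -> rC (rt S t) j.
Proof. by move=> [_ [_ [_ [h _]]]] /h. Qed.

Lemma cok_same S t i j a : cok S t i -> addr_val d0 S t i a -> j < i -> has_addr S t j ->
  rC (rt S t) j \/ exists2 a', addr_val d0 S t j a' & a' <> a.
Proof. by move=> [_ [_ [_ [_ [_ [_ [h _]]]]]]] /h; apply. Qed.

Lemma cok_load S t i : cok S t i -> load_at S t i -> rL (rt S t) i <> None.
Proof.
move=> [_ [_ [_ [_ [_ [_ [_ [h _]]]]]]]]; rewrite /load_at.
by case E: (cmd_at S t i) => [[r e|? ?|? ?|?]|] // _; apply: h E.
Qed.

Lemma xe_cok S S' dom t i : xe S S' dom -> (forall j, j < i -> rC (rt S t) j -> rC (rt S' t) j) ->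
  dom t i -> cok S t i -> cok S' t i.
Proof.
move=> X hC hd H; have H0 := H.
move: H0 => [h1 [h2 [h3 [h4 [h5 [h6 [h7 [h8 h9]]]]]]]].
have hdj j : j < i -> dom t j by apply: (x_po X).
have ds e j : depends_on S' t i e j -> depends_on S t i e j.
  by move=> [r [hr lw]]; exists r; split=> //; apply/(xf_lw X).
have hlt e j : depends_on S t i e j -> j < i by move=> [r [_ [lt _]]].
have ecm := x_cmd X hd.
split.
  by have [c hc] := cmd_at_ex h1; apply: (@cmd_at_lt _ _ _ c); rewrite ecm.
split.
  move=> j [c [e [e1 [e2 /ds e3]]]]; apply: hC; first exact: hlt e3.
  by apply: h2; exists c, e; rewrite -ecm.
split.
  move=> j [c [e [e1 [e2 /ds e3]]]]; apply: hC; first exact: hlt e3.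
  by apply: h3; exists c, e; rewrite -ecm.
split.
  move=> j [lt [e e1]]; have dj := hdj _ lt; apply: hC => //.
  by apply: h4; split=> //; exists e; rewrite -(x_cmd X dj).
split.
  move=> [c [e [e1 [e2 e3]]]].
  have [|a av] := cok_addr H; first by exists c, e; rewrite -ecm.
  exact: (addr_val_bot (xf_addr X hd av)) (ex_intro _ c (ex_intro _ e (conj e1 (conj e2 e3)))).
split.
  move=> [c [e [e1 [e2 e3]]]]; move: e1; rewrite ecm => e1.
  by have [v ev] := cok_val H e1 e2; apply: (e3 v); apply: (xf_eval X hdj ev).
split.
  move=> a av j lt [c [e [e1 e2]]]; have dj := hdj _ lt.
  have [|a0 av0] := cok_addr H.
    by have [c' [e' [f1 f2]]] := addr_val_has av; exists c', e'; rewrite -ecm.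
  have ea := addr_det (xf_addr X hd av0) av; subst a0.
  have haj : has_addr S t j by exists c, e; rewrite -(x_cmd X dj).
  case: (h7 a av0 j lt haj) => [hCj|[a' av' na]]; first by left; apply: hC.
  by right; exists a' => //; apply: (xf_addr X).
split.
  move=> r e; rewrite ecm => /h8; case E: (rL _ _) => [l|//] _.
  by rewrite (x_L X hd E).
move=> e; rewrite ecm => /h9 [v [ev nv]]; exists v; split=> //.
exact: (xf_eval X hdj ev).
Qed.

Lemma xf_cok S S' dom t i : xf S S' dom -> dom t i -> cok S t i -> cok S' t i.
Proof.
move=> X hd; apply: (xe_cok X) => // j lt; apply: (x_C X); exact: (x_po X) hd lt.
Qed.

(** The latest writer of a register is an assignment or a load, and the two hypotheses supply a
    value in either case. *)
Lemma eval_total S t i :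
  (forall j r e, j < i -> cmd_at S t j = Some (CAssign r e) -> exists v, evalx d0 S t j e v) ->
  (forall j r e, j < i -> cmd_at S t j = Some (CLoad r e) -> exists2 l, rL (rt S t) j = Some l &
     forall t' i', l = SStore D t' i' -> store_at S t' i' /\ exists v, val_val d0 S t' i' v) ->
  forall e, exists v, evalx d0 S t i e v.
Proof.
move=> hA hL.
have hr r : exists v, regval d0 S t i r v.
  case: (last_writer_ex S t i r) => [h|[j lw]]; first by exists d0; apply: RV_none.
  have [lt [w h]] := lw; move: (w); rewrite /writes_at.
  case E: (cmd_at S t j) => [[r' e|e e'|r' e|e]|] //= /eqP ?; subst r'.
    have [l El hl] := hL _ _ _ lt E.
    case: l El hl => [a|t' i'] El hl; first by exists d0; exact: (@RV_load_init _ _ _ _ _ _ _ _ _ _ lw E El).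
    have [st [v [c [e' [e1 [e2 e3]]]]]] := hl _ _ erefl.
    move: st; rewrite /store_at e1; case: c e1 e2 => // ea ev e1 [ee] _; subst ev.
    by exists v; exact: (@RV_load_store _ _ _ _ _ _ _ _ _ _ _ _ _ _ lw E El e1 e3).
  by have [v ev] := hA _ _ _ lt E; exists v; exact: (@RV_assign _ _ _ _ _ _ _ _ _ _ lw E ev).
fix IH 1; case=> [d|r|f es].
- by exists d; apply: EV_const.
- by have [v hv] := hr r; exists v; apply: EV_reg.
suff [vs hvs] : exists vs, evalxs d0 S t i es vs by exists (f vs); apply: EV_app.
elim: es => [|e es [vs IHs]]; first by exists [::]; apply: EVs_nil.
by have [v ev] := IH e; exists (v :: vs); apply: EVs_cons.
Qed.

End Evaluation.

(** * Runs without fetches and their invariants *)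

(* Non-fetch events; [MCommitSt] also performs the propagation to the own thread. *)
Inductive mev (D : Type) : Type :=
| MLoad of nat & nat & D
| MCommit of nat & nat
| MCommitSt of nat & nat & rat & D
| MProp of nat & nat & nat & D.

Section MevEq.
Variable D : eqType.
Definition mev_code (e : mev D) :
  (nat * nat * D) + (nat * nat) + (nat * nat * rat * D) + (nat * nat * nat * D) :=
  match e with
  | MLoad t i a => inl (inl (inl (t, i, a)))
  | MCommit t i => inl (inl (inr (t, i)))
  | MCommitSt t i k a => inl (inr (t, i, k, a))
  | MProp t t' i a => inr (t, t', i, a)
  end.
Definition mev_decode c : mev D :=
  match c with
  | inl (inl (inl (t, i, a))) => MLoad t i a
  | inl (inl (inr (t, i))) => MCommit D t i
  | inl (inr (t, i, k, a)) => MCommitSt t i k a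
  | inr (t, t', i, a) => MProp t t' i a
  end.
Lemma mev_codeK : cancel mev_code mev_decode. Proof. by case. Qed.
HB.instance Definition _ := Equality.copy (mev D) (can_type mev_codeK).
End MevEq.

Section Macro.
Variables (D Reg : finType) (d0 : D) (P : program D Reg).
Implicit Types (S : gstate D Reg) (t i j : nat) (e : mev D).

Definition expand e : seq (event D Reg) :=
  match e with
  | MLoad t i a => [:: EvLoad Reg t i a]
  | MCommit t i => [:: EvCommit D Reg t i]
  | MCommitSt t i k a => [:: EvCommitSt Reg t i k a; EvProp Reg t t i a]
  | MProp t t' i a => [:: EvProp Reg t t' i a]
  end.

Definition inst e : nat * nat :=
  match e with
  | MLoad t i _ => (t, i)
  | MCommit t i => (t, i)
  | MCommitSt t i _ _ => (t, i)
  | MProp _ t i _ => (t, i)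
  end.

Definition isld e t i : bool := if e is MLoad t1 i1 _ then (t1 == t) && (i1 == i) else false.
Definition iscom e t i : bool :=
  match e with
  | MCommit t1 i1 => (t1 == t) && (i1 == i)
  | MCommitSt t1 i1 _ _ => (t1 == t) && (i1 == i)
  | _ => false
  end.
Definition cokey e t i : option rat :=
  if e is MCommitSt t1 i1 k _ then if (t1 == t) && (i1 == i) then Some k else None else None.
Definition propto e t (a : D) : bool :=
  match e with
  | MCommitSt t1 _ _ a1 => (t1 == t) && (a1 == a)
  | MProp t1 _ _ a1 => (t1 == t) && (a1 == a)
  | _ => false
  end.

(** A load event does not tell whether the read is early or from memory, hence the extra argument
    [l]; the other events ignore it. *)
Definition upd S e (l : lsrc D) : gstate D Reg :=
  {| rt := fun t => {| rF := rF (rt S t); rC := fun i => rC (rt S t) i || iscom e t i;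
                       rL := fun i => if isld e t i then Some l else rL (rt S t) i |};
     gco := fun t i => if cokey e t i is Some k then Some k else gco S t i;
     gprop := fun t a => if propto e t a then SStore D (inst e).1 (inst e).2 else gprop S t a |}.

Definition early S t i a i' : Prop :=
  [/\ i' < i, store_at S t i' /\ addr_val d0 S t i' a, exists v, val_val d0 S t i' v,
      ~~ rC (rt S t) i' &
      forall j, i' < j -> j < i -> store_at S t j -> exists2 a', addr_val d0 S t j a' & a' <> a].

(** The key condition in the [MCommitSt] case is that of the propagation to the own thread which the
    event includes. Other propagations go to foreign threads only: the own thread already sees a key
    at least as large. *)
Definition enabled S e (l : lsrc D) : Prop :=
  match e with
  | MLoad t i a => [/\ t < size P, load_at S t i, rL (rt S t) i = None, addr_val d0 S t i a &
      l = gprop S t a \/ exists2 i', l = SStore D t i' & early S t i a i']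
  | MCommit t i => [/\ t < size P, ~~ rC (rt S t) i, cok d0 S t i & ~~ store_at S t i]
  | MCommitSt t i k a => [/\ t < size P, ~~ rC (rt S t) i, cok d0 S t i,
      store_at S t i /\ addr_val d0 S t i a &
      (k <> 0%R /\ forall t' i', gco S t' i' <> Some k) /\
      exists2 k0, keyof S (gprop S t a) = Some k0 & (k0 < k)%R]
  | MProp t t' i a => [/\ t <> t' /\ t < size P, t' < size P, store_at S t' i /\ rC (rt S t') i,
      addr_val d0 S t' i a &
      exists k k0, [/\ gco S t' i = Some k, keyof S (gprop S t a) = Some k0 & (k0 < k)%R]]
  end.

Inductive mrun : gstate D Reg -> seq (mev D) -> gstate D Reg -> Prop :=
| mrun_nil S : mrun S [::] S
| mrun_cons S e l ms S' : enabled S e l -> mrun (upd S e l) ms S' -> mrun S (e :: ms) S'.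

Lemma mrun_cat S p q S' : mrun S (p ++ q) S' <-> exists2 T, mrun S p T & mrun T q S'.
Proof.
elim: p S => [|e p IH] S /=; split.
- by exists S => //; apply: mrun_nil.
- by move=> [T h]; inversion h.
- move=> h; inversion h; subst; have [T h1 h2] := (IH _).1 H4.
  by exists T => //; apply: mrun_cons h1.
- move=> [T h h2]; inversion h; subst; apply: (mrun_cons H2); apply/IH.
  by exists T.
Qed.

Lemma mrun1 S e l : enabled S e l -> mrun S [:: e] (upd S e l).
Proof. by move=> h; apply: (mrun_cons h); apply: mrun_nil. Qed.

Lemma mrun_rcons S p e S' :
  mrun S (rcons p e) S' <-> exists T l, [/\ mrun S p T, enabled T e l & S' = upd T e l].
Proof.
rewrite -cats1; split.
  move=> /mrun_cat[T h h']; inversion h'; subst; inversion H4; subst.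
  by exists T, l.
by move=> [T [l [h h' ->]]]; apply/mrun_cat; exists T => //; apply: mrun1.
Qed.

(** [i_ord] holds because a store commits only after all earlier accesses to its address, and its
    key must exceed the one its thread sees, which by [i_own] bounds the keys of the earlier stores
    of that thread. In [i_rL] the first alternative is there for early reads, whose store may still
    be without a key. *)
Record invar S : Prop := Inv {
  i_co : forall t i k, gco S t i = Some k ->
    [/\ t < size P, rC (rt S t) i, store_at S t i, (0 < k)%R & exists a, addr_val d0 S t i a];
  i_Cco : forall t i, rC (rt S t) i -> store_at S t i -> exists k, gco S t i = Some k;
  i_inj : forall t i t' i' k, gco S t i = Some k -> gco S t' i' = Some k -> (t, i) = (t', i');
  i_gp : forall t a b, gprop S t a = SInit b -> b = a;
  i_gp2 : forall t a t' i', gprop S t a = SStore D t' i' ->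
    (exists k, gco S t' i' = Some k) /\ addr_val d0 S t' i' a;
  i_own : forall t i k a, gco S t i = Some k -> addr_val d0 S t i a ->
    exists2 k0, keyof S (gprop S t a) = Some k0 & (k <= k0)%R;
  i_rL : forall t i l, rL (rt S t) i = Some l ->
    [/\ t < size P, load_at S t i & exists a, [/\ addr_val d0 S t i a,
      match l with SInit b => b = a | SStore t' i' =>
        [/\ store_at S t' i', addr_val d0 S t' i' a & exists v, val_val d0 S t' i' v] end &
      (exists2 i', l = SStore D t i' & i' < i) \/
      exists k k0, [/\ keyof S l = Some k, keyof S (gprop S t a) = Some k0 & (k <= k0)%R]]];
  i_C : forall t i, rC (rt S t) i -> t < size P /\ cok d0 S t i;
  i_ord : forall t i j k k' a, gco S t i = Some k -> gco S t j = Some k' -> i < j ->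
    addr_val d0 S t i a -> addr_val d0 S t j a -> (k < k')%R }.

Definition full (F : nat -> seq (instr D Reg)) : gstate D Reg :=
  {| rt := fun t => {| rF := F t; rC := fun _ => false; rL := fun _ => None |};
     gco := fun _ _ => None; gprop := fun _ a => SInit a |}.

Lemma inv_full F : invar (full F).
Proof. by split=> //= t a b [->]. Qed.

Record ext S S' : Prop := Ext {
  x_xf : xf S S' (fun _ _ => True);
  x_F : forall t, rF (rt S' t) = rF (rt S t);
  x_co : forall t i k, gco S t i = Some k -> gco S' t i = Some k;
  x_gp : forall t a k, keyof S (gprop S t a) = Some k ->
    exists2 k', keyof S' (gprop S' t a) = Some k' & (k <= k')%R }.

Lemma ext_refl S : ext S S.
Proof. by split=> // t a k h; exists k. Qed.

Lemma ext_key S S' l k : ext S S' -> keyof S l = Some k -> keyof S' l = Some k.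
Proof. by move=> X; case: l => //= t i; apply: (x_co X). Qed.

Lemma ext_trans S1 S2 S3 : ext S1 S2 -> ext S2 S3 -> ext S1 S3.
Proof.
move=> X Y; have [X1 X2 X3 X4] := X; have [Y1 Y2 Y3 Y4] := Y; split.
- apply: xfI => //.
  + by move=> t i _; rewrite (x_cmd Y1) // (x_cmd X1).
  + by move=> t i l _ h; apply: (x_L Y1) => //; apply: (x_L X1).
  + by move=> t i _ h; apply: (x_C Y1) => //; apply: (x_C X1).
- by move=> t; rewrite Y2.
- by move=> t i k /X3 /Y3.
- move=> t a k /X4[k1 /Y4[k2 h l2] l1]; exists k2 => //; exact: le_trans l1 l2.
Qed.

Lemma ext_addr S S' t i a : ext S S' -> addr_val d0 S t i a -> addr_val d0 S' t i a.
Proof. by move=> /x_xf X; apply: (xf_addr X). Qed.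

Lemma ext_addr_inv S S' t i a b : ext S S' -> addr_val d0 S t i b -> addr_val d0 S' t i a ->
  addr_val d0 S t i a.
Proof. by move=> X h h'; rewrite (addr_det h' (ext_addr X h)). Qed.

Lemma ext_val S S' t i a : ext S S' -> val_val d0 S t i a -> val_val d0 S' t i a.
Proof. by move=> /x_xf X; apply: (xf_val X). Qed.

Lemma ext_L S S' t i l : ext S S' -> rL (rt S t) i = Some l -> rL (rt S' t) i = Some l.
Proof. by move=> /x_xf X; apply: (x_L X). Qed.

Lemma ext_store S S' t i : ext S S' -> store_at S' t i = store_at S t i.
Proof. by move=> /x_xf X; apply: (xf_store X). Qed.

Lemma ext_load S S' t i : ext S S' -> load_at S' t i = load_at S t i.
Proof. by move=> /x_xf X; apply: (xf_load X). Qed.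

Lemma gp_key S t a : invar S -> exists2 k, keyof S (gprop S t a) = Some k & (0 <= k)%R.
Proof.
move=> I; case E: (gprop S t a) => [b|t' i'] /=; first by exists 0%R.
by have [[k ek] _] := i_gp2 I E; exists k => //; have [_ _ _ /ltW] := i_co I ek.
Qed.

Lemma en_propto S e l t a : invar S -> enabled S e l -> propto e t a ->
  exists k k0, [/\ keyof (upd S e l) (SStore D (inst e).1 (inst e).2) = Some k,
    keyof S (gprop S t a) = Some k0, (k0 < k)%R & addr_val d0 S (inst e).1 (inst e).2 a].
Proof.
move=> I; case: e => //= [t1 i1 k a1|t1 t' i1 a1].
  move=> [lt nC ck [st av] [[kn0 un] [k0 e0 lt0]]] /andP[/eqP e1 /eqP e2]; subst.
  by exists k, k0; rewrite !eqxx.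
move=> [[ne lt] lt' [st hC] av [k [k0 [ek e0 lk]]]] /andP[/eqP e1 /eqP e2]; subst.
by exists k, k0.
Qed.

Lemma en_ext S e l : invar S -> enabled S e l -> ext S (upd S e l).
Proof.
move=> I h.
have hco t i k : gco S t i = Some k -> gco (upd S e l) t i = Some k.
  move=> ek /=; case: e h => //= t1 i1 k1 a [_ nC _ _ _].
  case: eqP => //= ?; case: eqP => //= ?; subst.
  by have [_ hC _ _ _] := i_co I ek; rewrite hC in nC.
have hk l' k : keyof S l' = Some k -> keyof (upd S e l) l' = Some k.
  by case: l' => //= t i; apply: hco.
split=> //.
- apply: xfI => //.
  + move=> t i l' _ /= El; case: e h hco hk => //= t1 i1 a [_ _ nL _ _] _ _.
    by case: eqP => //= ?; case: eqP => //= ?; subst; rewrite nL in El.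
  + by move=> t i _ /= ->.
- move=> t a k ek; case E: (propto e t a); last by exists k => //=; rewrite E; apply: hk.
  have [k1 [k0 [e1 e0 lk _]]] := en_propto I h E.
  exists k1; first by rewrite /= E.
  by move: e0; rewrite ek => -[->]; apply: ltW.
Qed.

Lemma inv_en S e l : invar S -> enabled S e l -> invar (upd S e l).
Proof.
move=> I h; have X := en_ext I h; set S' := upd S e l in X *.
have Cco t i k : gco S' t i = Some k ->
    gco S t i = Some k \/ (exists a, e = MCommitSt t i k a).
  rewrite /S' /=; case: e {h X S'} => //=; try by left.
  move=> t1 i1 k1 a; case: eqP => //= [->|]; last by left.
  by case: eqP => [->|]; [move=> [->]; right; exists a|left].
have Cgp t a l' : gprop S' t a = l' ->
    gprop S t a = l' \/ (propto e t a /\ l' = SStore D (inst e).1 (inst e).2).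
  by rewrite /S' /=; case: ifP => E <-; [right|left].
have CL t i l' : rL (rt S' t) i = Some l' ->
    rL (rt S t) i = Some l' \/ (exists a, e = MLoad t i a) /\ l' = l.
  rewrite /S' /=; case: e {h X S' Cco Cgp} => //=; try by left.
  move=> t1 i1 a; case: eqP => //= [->|]; last by left.
  by case: eqP => [->|]; [move=> [->]; right; split=> //; exists a|left].
have CC t i : rC (rt S' t) i -> rC (rt S t) i \/ iscom e t i.
  by rewrite /S' /=; case/orP; [left|right].
have kk l' k : keyof S l' = Some k -> keyof S' l' = Some k := ext_key X.
have aa t i a : addr_val d0 S t i a -> addr_val d0 S' t i a := ext_addr X.
have aco t i k a : gco S t i = Some k -> addr_val d0 S' t i a -> addr_val d0 S t i a.
  by move=> /(i_co I)[_ _ _ _ [b hb]] h'; apply: ext_addr_inv X hb h'.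
have com_cok t i : iscom e t i -> t < size P /\ cok d0 S t i.
  case: e h {X S' Cco Cgp CL CC kk aa aco} => //= [t1 i1|t1 i1 k1 a1].
    by move=> [? _ ? _] /andP[/eqP<- /eqP<-].
  by move=> [? _ ? _ _] /andP[/eqP<- /eqP<-].
have cst t i k a : e = MCommitSt t i k a -> addr_val d0 S t i a /\ ~~ rC (rt S t) i.
  by move=> E; move: h; rewrite E => -[_ ? _ [_ ?] _].
split.
- move=> t i k /Cco[/(i_co I)[h1 h2 h3 h4 [a ha]]|[a E]].
    by split=> //; [apply: (x_C (x_xf X))|exists a; apply: aa].
  have [av _] := cst _ _ _ _ E.
  move: h; rewrite E => -[h1 h2 h3 [h4 _] [h5 [k0 h6 h7]]]; split=> //.
  + by rewrite /S' /= E /= !eqxx orbT.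
  + by have [k1 e1 l1] := gp_key t a I; move: e1; rewrite h6 => -[?]; subst; apply: le_lt_trans h7.
  + by exists a; apply: aa.
- move=> t i /CC[hC|hC] st.
    by rewrite (ext_store _ _ X) in st; have [k ek] := i_Cco I hC st; exists k; apply: (x_co X).
  rewrite (ext_store _ _ X) in st; rewrite /S'.
  case: (e) h hC => //= [t1 i1|t1 i1 k a].
    by move=> [_ _ _ /negP n] /andP[/eqP ? /eqP ?]; subst; case: n.
  by move=> _ ->; exists k.
- move=> t i t' i' k /Cco[e1|[a1 e1]] /Cco[e2|[a2 e2]].
  + exact: i_inj I _ _ _ _ _ e1 e2.
  + by move: h; rewrite e2 => -[_ _ _ _ [[_ un] _]]; case: (un _ _ e1).
  + by move: h; rewrite e1 => -[_ _ _ _ [[_ un] _]]; case: (un _ _ e2).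
  + by move: e2; rewrite e1 => -[-> ->].
- by move=> t a b /Cgp[/(i_gp I)|[]].
- move=> t a t' i' /Cgp[/(i_gp2 I)[[k ek] av]|[pr [? ?]]]; subst.
    by split; [exists k; apply: (x_co X)|apply: aa].
  have [k [k0 [e1 e2 lk av]]] := en_propto I h pr.
  by split; [exists k|apply: aa].
- move=> t i k a /Cco[ek av|[b E] av].
    have [k0 e0 l0] := i_own I ek (aco _ _ _ _ ek av).
    have [k1 e1 l1] := x_gp X e0; exists k1 => //; exact: le_trans l1.
  have [av' _] := cst _ _ _ _ E; have ? := addr_det av (aa _ _ _ av'); subst b.
  by exists k => //; rewrite /S' E /= !eqxx /= !eqxx.
- move=> t i l' /CL[El|[[a E] ->]].
    have [h1 h2 [a [ha hm hk]]] := i_rL I El; split=> //.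
    exists a; split; first exact: aa.
      case: (l') hm => // t' i' [m1 m2 [v m3]]; split=> //; first exact: aa.
      by exists v; apply: (ext_val X).
    case: hk => [hk|[k [k0 [e1 e0 lk]]]]; [by left|right].
    have [k1 e2 l1] := x_gp X e0; exists k, k1; split=> //; first exact: kk.
    exact: le_trans l1.
  move: h; rewrite E => -[h1 h2 h3 h4 h5]; split=> //.
  exists a; split; first exact: aa.
    case: h5 => [El|[i' El [m1 [m2 m2'] [v m3] m4 m5]]]; rewrite El.
      case E2: (gprop S t a) => [b|t' i']; first exact: (i_gp I E2).
      have [[k ek] av] := i_gp2 I E2; have [l1 l2 l3 l4 l5] := i_co I ek.
      split=> //; first exact: aa.
      move: (l3); rewrite /store_at; case E3: (cmd_at S t' i') => [[? ?|e1 e2|? ?|?]|] // _.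
      have [v hv] := cok_val (i_C I l2).2 E3 erefl.
      by exists v; apply: (ext_val X); exists (CStore e1 e2), e2.
    split=> //; first exact: aa.
    by exists v; apply: (ext_val X).
  case: h5 => [El|[i' El [m1 _ _ _ _]]]; last by left; exists i'.
  right; have [k ek _] := gp_key t a I; exists k, k; split=> //; first by rewrite El; apply: kk.
  by rewrite /S' E /= in kk *; apply: kk.
- move=> t i /CC[hC|hC]; last by have [h1 h2] := com_cok _ _ hC; split=> //; apply: (xf_cok (x_xf X)).
  by have [h1 h2] := i_C I hC; split=> //; apply: (xf_cok (x_xf X)).
- move=> t i j k k' a /Cco[ei|[bi Ei]] /Cco[ej|[bj Ej]] lt avi avj.
  + exact: i_ord I _ _ _ _ _ _ ei ej lt (aco _ _ _ _ ei avi) (aco _ _ _ _ ej avj).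
  + have [k0 e0 l0] := i_own I ei (aco _ _ _ _ ei avi).
    move: (cst _ _ _ _ Ej) => [av' _]; have ? := addr_det avj (aa _ _ _ av'); subst bj.
    move: h; rewrite Ej => -[_ _ _ _ [_ [k1 e1 l1]]].
    by move: e1; rewrite e0 => -[?]; subst; apply: le_lt_trans l1.
  (* The later store cannot have been committed first, since its commit required the earlier access
     to the same address to be committed. *)
  + have [av' nC] := cst _ _ _ _ Ei; have [_ hC _ _ _] := i_co I ej.
    have ? := addr_det avi (aa _ _ _ av'); subst bi.
    case: (cok_same (i_C I hC).2 (aco _ _ _ _ ej avj) lt (addr_val_has av')); first by rewrite (negPf nC).
    by move=> [b' hb]; case; apply: addr_det hb av'.
  + by move: Ej; rewrite Ei => -[?]; subst; rewrite ltnn in lt.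
Qed.

Lemma mrun_inv S ms S' : mrun S ms S' -> invar S -> invar S'.
Proof. by elim=> // {}S e l {}ms {}S' h _ IH I; apply: IH; apply: inv_en. Qed.

Lemma mrun_ext S ms S' : mrun S ms S' -> invar S -> ext S S'.
Proof.
elim=> [{}S _|{}S e l {}ms {}S' h _ IH I]; first exact: ext_refl.
exact: ext_trans (en_ext I h) (IH (inv_en I h)).
Qed.

End Macro.

(** * Moving all fetches to the front *)

Section FetchFirst.
Variables (D Reg : finType) (d0 : D) (P : program D Reg).
Implicit Types (S : gstate D Reg) (t i j : nat).

Lemma run_cat S p q S' : run d0 P S (p ++ q) S' <-> exists2 T, run d0 P S p T & run d0 P T q S'.
Proof.
elim: p S => [|e p IH] S /=; split.
- by exists S => //; apply: run_nil.
- by move=> [T h]; inversion h.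
- move=> h; inversion h; subst; have [T h1 h2] := (IH _).1 H4.
  by exists T => //; apply: run_cons h1; eassumption.
- move=> [T h h2]; inversion h; subst; apply: run_cons; first by eassumption.
  by apply/IH; exists T.
Qed.

Lemma run_consE S (e : event D Reg) evs s :
  run d0 P S (e :: evs) s -> exists2 S1, step d0 P S e S1 & run d0 P S1 evs s.
Proof. by move=> h; inversion h; subst; exists s1. Qed.

Lemma step_propE S t t' i' a S1 : step d0 P S (EvProp Reg t t' i' a) S1 ->
  exists k k0, [/\ gco S t' i' = Some k, keyof S (gprop S t a) = Some k0, (k0 < k)%R &
    S1 = {| rt := rt S; gco := gco S;
            gprop := fun t'' a' => if (t'' == t) && (a' == a) then SStore D t' i' else gprop S t'' a' |}].
Proof. by move=> h; inversion h; subst; exists k, k0. Qed.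

Lemma run1 S (e : event D Reg) S' : step d0 P S e S' -> run d0 P S [:: e] S'.
Proof. by move=> h; apply: run_cons h _; apply: run_nil. Qed.

Lemma cmd_at_prefix S S' t j q : rF (rt S' t) = rF (rt S t) ++ q -> j < size (rF (rt S t)) ->
  cmd_at S' t j = cmd_at S t j.
Proof. by move=> h lt; rewrite /cmd_at /ins_at h map_cat nth_cat size_map lt. Qed.

Lemma load_atE S t i : load_at S t i -> exists r e, cmd_at S t i = Some (CLoad r e).
Proof. by rewrite /load_at; case: cmd_at => // -[r e| | |] // _; exists r, e. Qed.

Lemma store_atE S t i : store_at S t i -> exists e1 e2, cmd_at S t i = Some (CStore e1 e2).
Proof. by rewrite /store_at; case: cmd_at => // -[|e1 e2| |] // _; exists e1, e2. Qed.

Lemma load_atP S t i r e : cmd_at S t i = Some (CLoad r e) -> load_at S t i.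
Proof. by rewrite /load_at => ->. Qed.

Lemma store_has_addr S t i : store_at S t i -> has_addr S t i.
Proof. by move=> /store_atE[e1 [e2 h]]; exists (CStore e1 e2), e1. Qed.

Lemma load_has_addr S t i : load_at S t i -> has_addr S t i.
Proof. by move=> /load_atE[r [e h]]; exists (CLoad r e), e. Qed.

Lemma upd_load S t i a l : upd_rt S t (setL (rt S t) i (Some l)) = upd S (MLoad t i a) l.
Proof.
apply: gstate_ext => //= [t1|t1 j|t1 j]; rewrite ?orbF; try by case: eqP => [->|].
by rewrite (eq_sym t) (eq_sym i); case: eqP => [->|//] /=.
Qed.

Lemma upd_commit S t i l : upd_rt S t (Defs.setC (rt S t) i) = upd S (MCommit D t i) l.
Proof.
apply: gstate_ext => //= [t1|t1 j|t1 j]; try by case: eqP => [->|].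
by rewrite (eq_sym t) (eq_sym i); case: eqP => [->|//] /=; rewrite ?orbF // orbC.
Qed.

Definition store_committed S t i k : gstate D Reg :=
  {| rt := fun t' => if t' == t then Defs.setC (rt S t) i else rt S t';
     gco := fun t' i' => if (t' == t) && (i' == i) then Some k else gco S t' i';
     gprop := gprop S |}.

Definition propagated S t t' i a : gstate D Reg :=
  {| rt := rt S; gco := gco S;
     gprop := fun t'' a' => if (t'' == t) && (a' == a) then SStore D t' i else gprop S t'' a' |}.

Lemma upd_commit_store S t i k a l :
  propagated (store_committed S t i k) t t i a = upd S (MCommitSt t i k a) l.
Proof.
apply: gstate_ext => //= [t1|t1 j|t1 j|t1 j|t1 b]; try by case: eqP => [->|].
- by rewrite (eq_sym t) (eq_sym i); case: eqP => [->|//] /=; rewrite ?orbF // orbC.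
- by rewrite (eq_sym t) (eq_sym i); case: ifP.
- by rewrite (eq_sym t) (eq_sym a).
Qed.

Lemma upd_prop S t t' i a l : propagated S t t' i a = upd S (MProp t t' i a) l.
Proof.
apply: gstate_ext => //= [t1 j|t1 b]; first by rewrite orbF.
by rewrite (eq_sym t) (eq_sym a).
Qed.

Lemma xp_run S (e : mev D) l : invar d0 P S -> enabled d0 P S e l -> run d0 P S (expand Reg e) (upd S e l).
Proof.
move=> I; case: e => [t i a|t i|t i k a|t t' i a].
- move=> [lt ld nL av hl]; have [r [ex cm]] := load_atE ld; apply: run1.
  rewrite -upd_load; case: hl => [->|[i' -> [m1 [m2 m2'] m3 m4 m5]]].
    by apply: st_load_mem cm nL av.
  apply: st_early_read cm nL av m1 m2 m2' m3 m4 _ => // j l1 l2 st.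
  have [b hb nb] := m5 _ l1 l2 st; split; last exact: addr_val_bot hb.
  by move=> ha; apply: nb; apply: addr_det hb ha.
- move=> [lt nC ck nst]; apply: run1; rewrite -upd_commit.
  by apply: st_commit => //; apply/commit_okE.
- move=> [lt nC ck [st av] [[kn0 un] [k0 e0 lk]]].
  set T := store_committed S t i k.
  have ET t1 : rF (rt T t1) = rF (rt S t1) by rewrite /=; case: eqP => [->|].
  have X : xe S T (fun _ _ => True).
    split=> //; first by move=> t1 j _; apply: cmd_at_eqF; rewrite ET.
    by move=> t1 j l1 _ /=; case: eqP => [->|].
  apply: (@run_cons _ _ _ _ _ _ T).
    by apply: st_commit_store => //; apply/commit_okE.
  apply: run1; rewrite -upd_commit_store; apply: (@st_prop _ _ _ _ T t t i a k k0) => //=.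
  + by rewrite (xf_store X).
  + by rewrite eqxx /= eqxx.
  + by rewrite !eqxx.
  + exact: (xf_addr X).
  + case: (gprop S t a) e0 => //= t1 i1 e1; case: eqP => //= ?; case: eqP => //= ?; subst.
    by have [_ hC _ _ _] := i_co I e1; rewrite hC in nC.
- move=> [[ne lt] lt' [st hC] av [k [k0 [e1 e0 lk]]]]; apply: run1.
  by rewrite -upd_prop; apply: st_prop e1 _ e0 lk.
Qed.

Lemma mrun_run S ms S' : mrun d0 P S ms S' -> invar d0 P S ->
  run d0 P S (flatten (map (expand Reg) ms)) S'.
Proof.
elim=> [{}S _|{}S e l {}ms {}S' h _ IH I] /=; first exact: run_nil.
apply/run_cat; exists (upd S e l); first exact: xp_run.
by apply: IH; apply: inv_en h.
Qed.

Lemma run_F S evs s : run d0 P S evs s -> forall t, exists q, rF (rt s t) = rF (rt S t) ++ q.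
Proof.
elim=> [{}S t|{}S e S1 {}evs s2 st _ IH t]; first by exists [::]; rewrite cats0.
have [q ->] := IH t; inversion st; subst => /=; try by exists q; case: eqP => [->|].
- case: eqP => [->|] /=; last by exists q.
  by exists (ins :: q); rewrite cat_rcons.
- by exists q.
Qed.

(** [S'] is [S] with the missing instructions fetched in advance. The last two fields keep the
    instructions fetched in [S] closed under reading, as a domain of [xf] must be. *)
Record sim (F : nat -> seq (instr D Reg)) S S' : Prop := Sim {
  s_F : forall t, rF (rt S' t) = F t;
  s_pre : forall t, exists q, F t = rF (rt S t) ++ q;
  s_C : forall t i, rC (rt S' t) i = rC (rt S t) i;
  s_L : forall t i, rL (rt S' t) i = rL (rt S t) i;
  s_co : forall t i, gco S' t i = gco S t i;
  s_gp : forall t a, gprop S' t a = gprop S t a;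
  s_dL : forall t i t' i', rL (rt S t) i = Some (SStore D t' i') -> i' < size (rF (rt S t'));
  s_dgp : forall t a t' i', gprop S t a = SStore D t' i' -> i' < size (rF (rt S t')) }.

Lemma sim_xf F S S' : sim F S S' -> xf S S' (fun t i => i < size (rF (rt S t))).
Proof.
move=> M; apply: xfI.
- by move=> t i j h lt; apply: ltn_trans h.
- move=> t i lt; have [q hq] := s_pre M t; apply: (cmd_at_prefix (q := q)) => //.
  by rewrite (s_F M).
- by move=> t i l _; rewrite (s_L M).
- by move=> t i _; rewrite (s_C M).
- by move=> t i t' i' _; apply: (s_dL M).
Qed.

Lemma sim_key F S S' l : sim F S S' -> keyof S' l = keyof S l.
Proof. by move=> M; case: l => //= t i; rewrite (s_co M). Qed.

Lemma sim_upd F S S' e l : sim F S S' ->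
  (forall t' i', l = SStore D t' i' -> i' < size (rF (rt S t'))) ->
  (inst e).2 < size (rF (rt S (inst e).1)) -> sim F (upd S e l) (upd S' e l).
Proof.
move=> M hl he; split=> /=.
- exact: s_F M.
- exact: s_pre M.
- by move=> t i; rewrite (s_C M).
- by move=> t i; rewrite (s_L M).
- by move=> t i; rewrite (s_co M).
- by move=> t a; rewrite (s_gp M).
- by move=> t i t' i'; case: ifP => _; [move=> [/hl]|exact: (s_dL M)].
- by move=> t a t' i'; case: ifP => _; [move=> [<- <-]|exact: (s_dgp M)].
Qed.

Lemma csp_cons (e : event D Reg) evs : commit_store_then_prop (e :: evs) -> commit_store_then_prop evs.
Proof. by move=> h n t i k a hn; exact: (h n.+1 t i k a hn). Qed.

(** A propagation to the own thread disappears, being the second half of an [MCommitSt]. *)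
Definition macro (e : event D Reg) : option (mev D) :=
  match e with
  | EvFetch _ _ => None
  | EvLoad t i a => Some (MLoad t i a)
  | EvCommit t i => Some (MCommit D t i)
  | EvCommitSt t i k a => Some (MCommitSt t i k a)
  | EvProp t t' i a => if t == t' then None else Some (MProp t t' i a)
  end.

(** An event depends only on its own instruction and earlier ones of the thread, and on stores that
    were read or propagated. All of these are fetched in [S], so the additional later instructions
    of [S'] do not interfere. *)
Lemma run_sim F evs S s S' : run d0 P S evs s -> commit_store_then_prop evs ->
  (forall t, rF (rt s t) = F t) -> invar d0 P S' -> sim F S S' ->
  mrun d0 P S' (pmap macro evs) s.
Proof.
(* Induction on the length, because a store commit consumes two events at once. *)
have [n] := ubnP (size evs); elim: n evs S S' => // n IH evs S S' ltn hr csp EF I M.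
have X := sim_xf M.
have step_sim e l evs' : enabled d0 P S' e l ->
    (forall t' i', l = SStore D t' i' -> i' < size (rF (rt S t'))) ->
    (inst e).2 < size (rF (rt S (inst e).1)) ->
    size evs' < n -> run d0 P (upd S e l) evs' s -> commit_store_then_prop evs' ->
    mrun d0 P S' (e :: pmap macro evs') s.
  move=> h hl he lt hr' csp'; apply: (mrun_cons h).
  exact: IH lt hr' csp' EF (inv_en I h) (sim_upd M hl he).
inversion hr; subst.
  have -> : S' = s.
    apply: gstate_ext; [|exact: s_C M|exact: s_L M|exact: s_co M|exact: s_gp M].
    by move=> t; rewrite (s_F M) EF.
  exact: mrun_nil.
rename evs0 into evs, H into hs, H0 into hr1.
have csp1 := csp_cons csp; have ltn1 : size evs < n by move: ltn.
have incmd t i c : cmd_at S t i = Some c -> i < size (rF (rt S t)) := @cmd_at_lt _ _ _ _ _ _.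
have inst t i : store_at S t i -> i < size (rF (rt S t)).
  by move=> /store_atE[e1 [e2 /incmd]].
inversion hs; subst.
- apply: (IH _ _ S' ltn1 hr1) => //; split; try by move=> *; rewrite ?(s_F M) ?(s_co M) ?(s_gp M).
  + move=> t1; have [q hq] := run_F hr1 t1; exists q; by rewrite -EF.
  + by move=> t1 i1; rewrite (s_C M) /=; case: eqP => [->|].
  + by move=> t1 i1; rewrite (s_L M) /=; case: eqP => [->|].
  + move=> t1 i1 t' i' /= h; have {}h : rL (rt S t1) i1 = Some (SStore D t' i').
      by move: h; case: eqP => [->|].
    have := s_dL M h; case: eqP => //= -> lt; by rewrite size_rcons ltnS ltnW.
  + move=> t1 a t' i' /= /(s_dgp M); case: eqP => //= -> lt; by rewrite size_rcons ltnS ltnW.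
- have lti := incmd _ _ _ H0.
  have h : enabled d0 P S' (MLoad t i a) (gprop S' t a).
    split=> //; [|by rewrite (s_L M)|exact: (xf_addr X)|by left].
    by apply: (@load_atP _ _ _ r e0); rewrite (x_cmd X lti).
  rewrite (upd_load _ _ _ a) -(s_gp M) in hr1.
  apply: (step_sim _ _ _ h _ lti ltn1 hr1 csp1) => t' i1; rewrite (s_gp M); exact: s_dgp M _ _ _ _.
- have lti := incmd _ _ _ H0.
  have h : enabled d0 P S' (MLoad t i a) (SStore D t i').
    split=> //; [|by rewrite (s_L M)|exact: (xf_addr X)|right; exists i' => //].
      by apply: (@load_atP _ _ _ r e0); rewrite (x_cmd X lti).
    split=> //.
    + by rewrite (xf_store X) //; [split=> //; apply: (xf_addr X) => //|]; apply: inst.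
    + by have [v hv] := H6; exists v; apply: (xf_val X) => //; apply: inst.
    + by rewrite (s_C M).
    + move=> j l1 l2; have ltj : j < size (rF (rt S t)) by apply: ltn_trans lti.
      rewrite (xf_store X) // => st; have [na nb] := H8 _ l1 l2 st.
      have [b hb] := has_addr_known (store_has_addr st) nb.
      by exists b; [apply: (xf_addr X)|move=> ?; subst b; apply: na].
  rewrite (upd_load _ _ _ a) in hr1.
  apply: (step_sim _ _ _ h _ lti ltn1 hr1 csp1) => t' i1 [<- <-]; exact: inst.
- have [nC ck] := (commit_okE d0 S t i).1 H0; have lti := ck.1.
  have h : enabled d0 P S' (MCommit D t i) (SInit d0).
    by split=> //; [rewrite (s_C M)|apply: (xf_cok X)|rewrite (xf_store X)].
  rewrite (upd_commit _ _ _ (SInit d0)) in hr1.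
  exact: (step_sim _ _ _ h _ lti ltn1 hr1 csp1).
- have ep := csp 0 t i k a erefl; case: evs ep hr hr1 csp csp1 ltn ltn1 => // e' evs [->] _ hr1 _ csp1 _ ltn1.
  have [T2 /step_propE[k1 [k0 [+ hk0 lk0 ?]]] hr2] := run_consE hr1; subst T2.
  have [nC ck] := (commit_okE d0 S t i).1 H0; have lti := ck.1.
  rewrite /= !eqxx /= => -[?]; subst k1.
  have h : enabled d0 P S' (MCommitSt t i k a) (SInit d0).
    split=> //; [by rewrite (s_C M)|exact: (xf_cok X)|..].
      by rewrite (xf_store X) //; split=> //; apply: (xf_addr X).
    split; first by split=> // t1 i1; rewrite (s_co M).
    (* [hk0] speaks of the state after the commit; the visible store is not the one just committed,
       so its key is the same before. *)
    exists k0 => //; rewrite (s_gp M) (sim_key _ M); move: hk0 => /=.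
    case E: (gprop S t a) => [//|t1 i1] /=; case: eqP => //= ?; case: eqP => //= ?; subst.
    rewrite -(s_gp M) in E; have [[k2 ek2] _] := i_gp2 I E.
    by have [_ hC _ _ _] := i_co I ek2; move: nC; rewrite -(s_C M) hC.
  have ltn2 : size evs < n by apply: ltnW.
  rewrite -/(store_committed S t i k) -/(propagated (store_committed S t i k) t t i a) in hr2.
  rewrite (upd_commit_store _ _ _ _ _ (SInit d0)) in hr2.
  exact: (step_sim _ _ _ h _ lti ltn2 hr2 (csp_cons csp1)).
- have lti := inst _ _ H1; have av' := xf_addr X lti H4.
  rewrite -(s_gp M) -(sim_key _ M) in H5; rewrite -(s_co M) in H3.
  have h : enabled d0 P S' (MProp t t' i' a) (SInit d0).
    split=> //.
    (* A propagation to the own thread that does not follow the commit is impossible: by [i_own]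
       that thread already sees at least this key. *)
    + split=> // ?; subst t'.
      have [k1 ek1 lk1] := i_own I H3 av'; move: ek1; rewrite H5 => -[?]; subst k1.
      by move: (lt_le_trans H6 lk1); rewrite ltxx.
    + by rewrite (xf_store X) // (s_C M).
    + by exists k, k0.
  rewrite -/(propagated S t t' i' a) (upd_prop _ _ _ _ _ (SInit d0)) in hr1.
  have [[/eqP/negPf ne _] _ _ _ _] := h; rewrite /= ne.
  exact: (step_sim _ _ _ h _ lti ltn1 hr1 csp1).
Qed.

(** Says that [F t] is a path of the automaton from its initial state; the form by splittings passes
    to prefixes at once. *)
Definition wfF (F : nat -> seq (instr D Reg)) : Prop :=
  forall t p ins q, F t = p ++ ins :: q ->
  [/\ t < size P, List.In ins (th_trans (nth (Thread 0 [::]) P t)) &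
      i_src ins = cur_ctrl (nth (Thread 0 [::]) P t) p].

Lemma run_wf S evs s : run d0 P S evs s -> wfF (fun t => rF (rt S t)) -> wfF (fun t => rF (rt s t)).
Proof.
elim=> // {}S e S1 {}evs s2 st _ IH w; apply: IH; inversion st; subst => //; move=> t1 p ins1 q /=;
  try by case: eqP => [->|_]; exact: w.
case: eqP => [->|_] /=; last exact: w.
case/lastP: q => [|q y]; first by rewrite cats1 => /rcons_inj[<- <-].
by rewrite -rcons_cons -rcons_cat => /rcons_inj[/w].
Qed.

Definition computation s nf := [/\ wfF (fun t => rF (rt s t)), mrun d0 P (full (fun t => rF (rt s t))) nf s & final d0 P s].

Lemma power_comp evs s : power_run d0 P evs s -> computation s (pmap macro evs).
Proof.
move=> [hr hf csp]; split=> //.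
  by apply: (run_wf hr) => t p ins q /=; case: p.
have M : sim (fun t => rF (rt s t)) (init_state D Reg) (full (fun t => rF (rt s t))).
  by split=> //= t; exists (rF (rt s t)).
exact: run_sim hr csp (fun _ => erefl) (inv_full d0 P _) M.
Qed.

End FetchFirst.

(** * From sorted pieces to a normal form *)

Section NormalForm.
Variables (D Reg : finType) (d0 : D) (P : program D Reg).
Implicit Types (S : gstate D Reg) (t i j : nat) (o : seq (nat * nat)).
Implicit Types (F : nat -> seq (instr D Reg)).

Definition cnt o t := count (fun y => y.1 == t) o.

Record enumr F o : Prop := Enumr {
  en_uniq : uniq o;
  en_mem : forall t i, ((t, i) \in o) = (i < size (F t));
  en_po : forall t i j, i < j -> j < size (F t) -> index (t, i) o < index (t, j) o }.

Lemma cnt_cat o1 o2 t : cnt (o1 ++ o2) t = cnt o1 t + cnt o2 t.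
Proof. exact: count_cat. Qed.

(** A prefix of an enumeration respecting program order contains an initial segment of each thread,
    so counting decides membership. *)
Lemma cntP F o1 o2 t j : enumr F (o1 ++ o2) -> ((t, j) \in o1) = (j < cnt o1 t).
Proof.
elim/last_ind: o1 o2 t j => [|o1 [t0 i0] IH] o2 t j E //.
rewrite cat_rcons in E; have {}IH := IH _ _ _ E.
have u := en_uniq E; rewrite cat_uniq /= in u.
have ni : (t0, i0) \notin o1.
  by apply/negP => h; case/and3P: u => _ /norP[/negP[]].
have E0 : cnt o1 t0 = i0.
  apply/eqP; rewrite eqn_leq leqNgt -IH ni /= leqNgt; apply/negP => lt.
  have h0 : (t0, i0) \in o1 ++ (t0, i0) :: o2 by rewrite mem_cat inE eqxx orbT.
  rewrite (en_mem E) in h0; have := en_po E lt h0.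
  have ni' : (t0, cnt o1 t0) \notin o1 by rewrite IH ltnn.
  by rewrite !index_cat (negPf ni) (negPf ni') /= eqxx addn0 ltnNge leq_addr.
rewrite -cats1 mem_cat IH cnt_cat /cnt /= addn0 -/(cnt o1 t) inE.
rewrite xpair_eqE (eq_sym t0); case: eqP => [->|_] /=; last by rewrite orbF addn0.
by rewrite E0 addn1 ltnS [in RHS]leq_eqVlt orbC.
Qed.

Lemma cnt_next F o1 o2 t i : enumr F (o1 ++ (t, i) :: o2) -> cnt o1 t = i.
Proof.
move=> E; have E' := E; rewrite -cat_rcons in E'.
have h1 := cntP t i E'; rewrite mem_rcons inE eqxx /= -cats1 cnt_cat /cnt /= eqxx addn1 ltnS -/(cnt o1 t) in h1.
have u := en_uniq E; rewrite cat_uniq /= in u.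
have ni : (t, i) \notin o1 by apply/negP => h; case/and3P: u => _ /norP[/negP[]].
by rewrite (cntP _ _ E) -leqNgt in ni; apply/eqP; rewrite eqn_leq ni -h1.
Qed.

Lemma cnt_full F o t : enumr F o -> cnt o t = size (F t).
Proof.
move=> E; have E' : enumr F (o ++ [::]) by rewrite cats0.
have h j : (j < cnt o t) = (j < size (F t)) by rewrite -(cntP t j E') (en_mem E).
by apply/eqP; rewrite eqn_leq leqNgt h ltnn /= leqNgt -h ltnn.
Qed.

Definition dflt : instr D Reg := Instr 0 (CAssume (EConst Reg d0)) 0.
Definition fetches F o : seq (event D Reg) := [seq EvFetch y.1 (nth dflt (F y.1) y.2) | y <- o].

Definition fst_state F o : gstate D Reg := full (fun t => take (cnt o t) (F t)).

Lemma fetches_run F o1 o2 : wfF P F -> enumr F (o1 ++ o2) ->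
  run d0 P (init_state D Reg) (fetches F o1) (fst_state F o1).
Proof.
move=> w; elim/last_ind: o1 o2 => [|o1 [t i] IH] o2 E.
  have -> : fst_state F [::] = init_state D Reg by apply: gstate_ext => //= t; rewrite take0.
  exact: run_nil.
rewrite cat_rcons in E; rewrite /fetches -cats1 map_cat; apply/run_cat.
exists (fst_state F o1); first exact: IH E.
apply: run1 => /=; have ei := cnt_next E.
have lt : i < size (F t) by rewrite -(en_mem E) mem_cat inE eqxx orbT.
have eF : F t = take i (F t) ++ nth dflt (F t) i :: drop i.+1 (F t).
  by rewrite -drop_nth // cat_take_drop.
have [w1 w2 w3] := w _ _ _ _ eF.
have -> : fst_state F (o1 ++ [:: (t, i)]) = upd_rt (fst_state F o1) t
   {| rF := rcons (rF (rt (fst_state F o1) t)) (nth dflt (F t) i);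
      rC := rC (rt (fst_state F o1) t); rL := rL (rt (fst_state F o1) t) |}.
  apply: gstate_ext => //= [t1|t1 j|t1 j]; try by case: eqP.
  rewrite cnt_cat /cnt /= addn0 -/(cnt o1 t1) (eq_sym t).
  case: eqP => [->|_] /=; last by rewrite addn0.
  by rewrite -!/(cnt o1 t) addn1 ei (take_nth dflt).
by apply: st_fetch => //=; rewrite ei.
Qed.

Lemma fetches_full F o : enumr F o -> fst_state F o = full F.
Proof. by move=> E; apply: gstate_ext => //= t; rewrite (cnt_full _ E) take_size. Qed.

Lemma count_fetches F o t : count (is_fetch_of t) (fetches F o) = cnt o t.
Proof. by rewrite /fetches count_map /cnt; apply: eq_count. Qed.

Lemma ev_at_cat (p q : seq (event D Reg)) n :
  ev_at (p ++ q) n = if n < size p then ev_at p n else ev_at q (n - size p).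
Proof. by rewrite /ev_at map_cat nth_cat size_map. Qed.

Lemma ev_at_lt (p : seq (event D Reg)) n e : ev_at p n = Some e -> n < size p.
Proof. by rewrite /ev_at; case: ltnP => // le; rewrite nth_default // size_map. Qed.

Lemma csp_cat (p q : seq (event D Reg)) :
  commit_store_then_prop p -> commit_store_then_prop q -> commit_store_then_prop (p ++ q).
Proof.
move=> hp hq n t i k a; rewrite !ev_at_cat; case: ltnP => [lt|le] h.
  by have h' := hp _ _ _ _ _ h; rewrite (ev_at_lt h').
have -> : (n.+1 < size p) = false by rewrite ltnNge (leq_trans le).
by rewrite subSn //; apply: hq h.
Qed.

Lemma csp_xp (ms : seq (mev D)) : commit_store_then_prop (flatten (map (expand Reg) ms)).
Proof.
elim: ms => [|e ms IH] /=; first by move=> n t i k a; rewrite /ev_at nth_nil.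
apply: csp_cat => //; case: e => [t i a|t i|t i k a|t t' i a] n t1 i1 k1 a1;
  case: n => [|[|n]]; rewrite /ev_at /= ?nth_nil //.
by move=> [-> -> _ ->].
Qed.

Lemma csp_fetches F o : commit_store_then_prop (fetches F o).
Proof.
elim: o => [|y o IH] /=; first by move=> n t i k a; rewrite /ev_at nth_nil.
by case=> // n; exact: IH.
Qed.

Lemma en_range S (e : mev D) l : enabled d0 P S e l -> (inst e).2 < size (rF (rt S (inst e).1)).
Proof.
case: e => [t i a|t i|t i k a|t t' i a] /=.
- by move=> [_ /load_atE[r [e h]] _ _ _]; apply: cmd_at_lt h.
- by move=> [_ _ [h _] _].
- by move=> [_ _ [h _] _].
- by move=> [_ _ [/store_atE[e1 [e2 h]] _] _ _]; apply: cmd_at_lt h.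
Qed.

Lemma mrun_range S ms S' e : mrun d0 P S ms S' -> e \in ms ->
  (inst e).2 < size (rF (rt S (inst e).1)).
Proof.
elim=> // {}S e' l {}ms {}S' h _ IH; rewrite inE => /orP[/eqP->|/IH//].
exact: en_range h.
Qed.

(** The index of a fetch is a dummy; the function is evaluated on fetch-free lists only. *)
Definition evinst (e : event D Reg) : nat * nat :=
  match e with
  | EvFetch t _ => (t, 0)
  | EvLoad t i _ => (t, i)
  | EvCommit t i => (t, i)
  | EvCommitSt t i _ _ => (t, i)
  | EvProp _ t i _ => (t, i)
  end.

Lemma ev_at_flatten (taus : seq (seq (event D Reg))) s j : j < size (nth [::] taus s) ->
  ev_at (flatten taus) (sumn (map size (take s taus)) + j) = ev_at (nth [::] taus s) j.
Proof.
move=> lt; have lts : s < size taus.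
  by rewrite ltnNge; apply/negP => le; rewrite nth_default in lt.
have -> : flatten taus = flatten (take s taus) ++ nth [::] taus s ++ flatten (drop s.+1 taus).
  by rewrite -[LHS](congr1 flatten (cat_take_drop s taus)) (drop_nth [::]) // flatten_cat.
rewrite ev_at_cat.
have <- : size (flatten (take s taus)) = sumn (map size (take s taus)) by rewrite size_flatten.
by rewrite ltnNge leq_addr /= addKn ev_at_cat lt.
Qed.

Lemma xp_sorted (f : nat * nat -> nat) (ms : seq (mev D)) :
  sorted leq (map (f \o @inst D) ms) -> sorted leq (map (f \o evinst) (flatten (map (expand Reg) ms))).
Proof.
case: ms => // e ms; rewrite /=.
have H (e0 : mev D) ms0 : path leq (f (inst e0)) (map (f \o @inst D) ms0) ->
    path leq (f (inst e0)) (map (f \o evinst) (flatten (map (expand Reg) ms0))).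
  elim: ms0 e0 => //= e1 ms0 IH e0 /andP[le h0].
  have h := IH e1 h0; rewrite map_cat.
  by case: e1 le h {h0} => [t i a|t i|t i k a|t t' i a] /= -> //=; rewrite leqnn.
by move=> /H; case: e => [t i a|t i|t i k a|t t' i a] //=; rewrite leqnn.
Qed.

Lemma xp_nofetch (ms : seq (mev D)) j e : ev_at (flatten (map (expand Reg) ms)) j = Some e -> ~~ is_fetch e.
Proof.
elim: ms j => [|e1 ms IH] j /=; first by rewrite /ev_at nth_nil.
rewrite ev_at_cat; case: ltnP => _; last exact: IH.
by rewrite /ev_at; case: e1 => [t i a|t i|t i k a|t t' i a]; case: j => [|[|j]] //=; rewrite ?nth_nil // => -[<-].
Qed.

Lemma xp_range F (ms : seq (mev D)) j e :
  (forall m, m \in ms -> (inst m).2 < size (F (inst m).1)) ->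
  ev_at (flatten (map (expand Reg) ms)) j = Some e -> (evinst e).2 < size (F (evinst e).1).
Proof.
elim: ms j => [|e1 ms IH] j h /=; first by rewrite /ev_at nth_nil.
rewrite ev_at_cat; case: ltnP => _; last by apply: IH => m hm; apply: h; rewrite inE hm orbT.
have := h e1 (mem_head _ _).
by rewrite /ev_at; case: e1 {h} => [t i a|t i|t i k a|t t' i a] hr; case: j => [|[|j]] //=; rewrite ?nth_nil // => -[<-].
Qed.

(** A single order [o] governs every piece, the fetches included. Events of different instructions
    in one piece are thus ordered as their instructions are in [o], which does not depend on the
    piece; this is condition (B). *)
Lemma comp_normal_form s nf o (pieces : seq (seq (mev D))) : computation d0 P s nf ->
  enumr (fun t => rF (rt s t)) o -> nf = flatten pieces ->
  (forall p, p \in pieces -> sorted leq (map (fun e => index (inst e) o) p)) ->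
  exists evs, power_run d0 P evs s /\ normal_form (size pieces).+1 evs.
Proof.
set F := fun t => rF (rt s t) => -[w hr fin] E Enf hs.
set taus := fetches F o :: map (fun p => flatten (map (expand Reg) p)) pieces.
have Ef : flatten taus = fetches F o ++ flatten (map (expand Reg) nf).
  rewrite /taus /= Enf; congr (_ ++ _); elim: (pieces) => //= p ps ->.
  by rewrite map_cat flatten_cat.
exists (flatten taus); split.
  split=> //.
    rewrite Ef; apply/run_cat; exists (full F); last exact: (mrun_run hr (inv_full _ _ _)).
    have E' : enumr F (o ++ [::]) by rewrite cats0.
    by have := fetches_run w E'; rewrite (fetches_full E).
  by rewrite Ef; apply: csp_cat; [apply: csp_fetches|apply: csp_xp].
have nthS s1 : nth [::] taus s1.+1 = flatten (map (expand Reg) (nth [::] pieces s1)).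
  rewrite /taus /=; elim: (pieces) s1 => [|p ps IH] [|s1] //=.
have rng m : m \in nf -> (inst m).2 < size (F (inst m).1) by apply: mrun_range hr.
(* In the first piece the event at position [j] fetches the [j]-th instruction of [o], so the list
   of indices there is [iota]. *)
have key s1 j t i : j < size (nth [::] taus s1) ->
    related (flatten taus) (sumn (map size (take s1 taus)) + j) t i ->
    i < size (F t) /\ index (t, i) o = 
      nth 0 (if s1 is s2.+1 then map ((fun y => index y o) \o evinst) (nth [::] taus s1) else iota 0 (size o)) j.
  move=> lt; rewrite /related ev_at_flatten //; case: s1 lt => [|s1].
    rewrite /= /fetches size_map => lt.
    have -> : ev_at [seq EvFetch y.1 (nth dflt (F y.1) y.2) | y <- o] j =
       Some (EvFetch (nth (0, 0) o j).1 (nth dflt (F (nth (0,0) o j).1) (nth (0,0) o j).2)).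
      by rewrite /ev_at -map_comp (nth_map (0, 0)).
    case Ej : (nth (0, 0) o j) => [t1 i1] /= -[<- ->].
    rewrite add0n take_cat size_map lt -map_take -/(fetches F _) count_fetches.
    have Eo : o = take j o ++ (t1, i1) :: drop j.+1 o by rewrite -Ej -drop_nth // cat_take_drop.
    have E' := E; rewrite Eo in E'; rewrite (cnt_next E') -(en_mem E) nth_iota //.
    by rewrite -Ej mem_nth // index_uniq // (en_uniq E).
  rewrite nthS; set l := flatten _ => lt.
  case Ee : (ev_at l j) => [e|//].
  have hr2 : (evinst e).2 < size (F (evinst e).1).
    apply: (xp_range _ Ee) => m hm; apply: rng; rewrite Enf.
    have lts : s1 < size pieces.
      by rewrite ltnNge; apply/negP => le; rewrite nth_default in hm.
    by apply/flattenP; exists (nth [::] pieces s1) => //; apply: mem_nth.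
  have en0 : nth 0 (map ((fun y => index y o) \o evinst) l) j = index (evinst e) o.
    by move: Ee; rewrite /ev_at (nth_map e) // (nth_map e) // => -[->].
  rewrite en0; have nfe := xp_nofetch Ee.
  by case: e {Ee en0} hr2 nfe => //= [t1 i1 a|t1 i1|t1 i1 k a|t1 t2 i1 a] hr2 _ [<- <-].
have mono s1 j1 j2 t1 i1 t2 i2 : j1 <= j2 -> j1 < size (nth [::] taus s1) -> j2 < size (nth [::] taus s1) ->
    related (flatten taus) (sumn (map size (take s1 taus)) + j1) t1 i1 ->
    related (flatten taus) (sumn (map size (take s1 taus)) + j2) t2 i2 ->
    index (t1, i1) o <= index (t2, i2) o.
  move=> le l1 l2 /(key _ _ _ _ l1)[_ ->] /(key _ _ _ _ l2)[_ ->].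
  case: s1 l1 l2 => [|s1] l1 l2.
    by rewrite /= size_map in l1 l2; rewrite !nth_iota.
  apply: (sorted_leq_nth leq_trans leqnn); rewrite ?inE ?size_map //.
  rewrite nthS; apply: xp_sorted.
  have [lts|les] := ltnP s1 (size pieces); last by rewrite (nth_default _ les).
  exact: hs (mem_nth _ lts).
have strict s1 j1 j2 t1 i1 t2 i2 : (t1, i1) <> (t2, i2) ->
    j1 < size (nth [::] taus s1) -> j2 < size (nth [::] taus s1) ->
    related (flatten taus) (sumn (map size (take s1 taus)) + j1) t1 i1 ->
    related (flatten taus) (sumn (map size (take s1 taus)) + j2) t2 i2 ->
    j1 < j2 <-> index (t1, i1) o < index (t2, i2) o.
  move=> ne l1 l2 r1 r2; split=> [lt|]; last first.
    by rewrite !ltnNge; apply: contra => le; apply: mono r2 r1.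
  have [m1 _] := key _ _ _ _ l1 r1; have [m2 _] := key _ _ _ _ l2 r2.
  rewrite ltn_neqAle (mono _ _ _ _ _ _ _ (ltnW lt) l1 l2 r1 r2) andbT.
  apply/eqP => /(congr1 (nth (0, 0) o)); rewrite !nth_index ?(en_mem E) //.
exists taus; split=> //.
- by rewrite /taus /= size_map.
- by move=> [//|s1] j e _; rewrite nthS; apply: xp_nofetch.
- move=> s1 s2 j1 j2 j1' j2' t1 i1 t2 i2 ne l1 l2 l1' l2' r1 r2 r1' r2'.
  have E1 := strict _ _ _ _ _ _ _ ne l1 l2 r1 r2.
  have E2 := strict _ _ _ _ _ _ _ ne l1' l2' r1' r2'.
  exact: iff_trans E1 (iff_sym E2).
Qed.

End NormalForm.

(** * Reading the state off the list of events *)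

Section History.
Variables (D Reg : finType) (d0 : D) (P : program D Reg).
Implicit Types (S T : gstate D Reg) (t i j : nat) (e f : mev D).
Implicit Types (F : nat -> seq (instr D Reg)).

Lemma upd_rC S e l t i : rC (rt (upd S e l) t) i = rC (rt S t) i || iscom e t i.
Proof. by []. Qed.

Lemma iscomP e t i : iscom e t i -> inst e = (t, i).
Proof. by case: e => //= [? ?|? ? ? ?] /andP[/eqP-> /eqP->]. Qed.

Lemma isldP e t i : isld e t i -> inst e = (t, i).
Proof. by case: e => //= ? ? ? /andP[/eqP-> /eqP->]. Qed.

Lemma mrun_F S ms T : mrun d0 P S ms T -> forall t, rF (rt T t) = rF (rt S t).
Proof. by elim=> // {}S e l {}ms {}T _ _ IH t; rewrite IH. Qed.

Lemma hist_rC F p S t i : mrun d0 P (full F) p S -> rC (rt S t) i = has (fun e => iscom e t i) p.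
Proof.
elim/last_ind: p S => [|p e IH] S; first by move=> h; inversion h.
by move=> /mrun_rcons[T [l [h _ ->]]]; rewrite has_rcons /= (IH _ h) orbC.
Qed.

Lemma hist_rL F p S t i : mrun d0 P (full F) p S ->
  (rL (rt S t) i : bool) = has (fun e => isld e t i) p.
Proof.
elim/last_ind: p S => [|p e IH] S; first by move=> h; inversion h.
by move=> /mrun_rcons[T [l [h _ ->]]]; rewrite has_rcons /= -(IH _ h); case: ifP.
Qed.

Lemma cokeyP e t i k : cokey e t i = Some k -> exists a, e = MCommitSt t i k a.
Proof.
case: e => //= t1 i1 k1 a; case: eqP => //= ->; case: eqP => //= -> [->]; by exists a.
Qed.

Lemma hist_gco F p S t i k : mrun d0 P (full F) p S -> gco S t i = Some k ->
  exists a, MCommitSt t i k a \in p.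
Proof.
elim/last_ind: p S => [|p e IH] S; first by move=> h; inversion h.
move=> /mrun_rcons[T [l [h _ ->]]] /=; case E: (cokey e t i) => [k'|].
  move=> [?]; subst k'; have [a ->] := cokeyP E.
  by exists a; rewrite mem_rcons mem_head.
by move=> /(IH _ h)[a ha]; exists a; rewrite mem_rcons inE ha orbT.
Qed.

Lemma run_gco S p T t i k a : mrun d0 P S p T -> invar d0 P S -> MCommitSt t i k a \in p ->
  gco T t i = Some k /\ addr_val d0 T t i a.
Proof.
elim=> // {}S e l ms {}T h h2 IH I; have I' := inv_en I h.
rewrite inE => /orP[/eqP ?|]; last exact: IH.
subst e; have X := mrun_ext h2 I'.
split; first by apply: (x_co X); rewrite /= !eqxx.
by apply: (ext_addr X); apply: (ext_addr (en_ext I h)); case: h => _ _ _ [].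
Qed.

Lemma hist_gprop F p S t a t' i' : mrun d0 P (full F) p S -> gprop S t a = SStore D t' i' ->
  exists e, [/\ e \in p, propto e t a & inst e = (t', i')].
Proof.
elim/last_ind: p S => [|p e IH] S; first by move=> h; inversion h.
move=> /mrun_rcons[T [l [h _ ->]]] /=; case: ifP => E.
  move=> [<- <-]; exists e; rewrite mem_rcons mem_head; split=> //; by case: inst.
by move=> /(IH _ h)[e' [h1 h2 h3]]; exists e'; split=> //; rewrite mem_rcons inE h1 orbT.
Qed.

Lemma run_prop S p T e t a : mrun d0 P S p T -> invar d0 P S -> e \in p -> propto e t a ->
  exists k k0, [/\ gco T (inst e).1 (inst e).2 = Some k, keyof T (gprop T t a) = Some k0,
    (k <= k0)%R & addr_val d0 T (inst e).1 (inst e).2 a].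
Proof.
elim=> // {}S e' l ms {}T h h2 IH I; have I' := inv_en I h.
rewrite inE => /orP[/eqP ?|]; last exact: IH.
subst e' => pr; have X := mrun_ext h2 I'; have X0 := en_ext I h.
have [k [k0 [e1 e0 lk av]]] := en_propto I h pr.
have e2 : keyof (upd S e l) (gprop (upd S e l) t a) = Some k by rewrite [gprop _ _ _]/= pr.
have [k1 e3 l3] := x_gp X e2.
exists k, k1; split=> //; first exact: (x_co X).
by apply: (ext_addr X); apply: (ext_addr X0).
Qed.

Lemma reach_inv F p T : mrun d0 P (full F) p T -> invar d0 P T.
Proof. by move=> h; apply: mrun_inv h (inv_full d0 P F). Qed.

Lemma hist_commit F p T t i k a : mrun d0 P (full F) p T -> MCommitSt t i k a \in p ->
  gco T t i = Some k /\ addr_val d0 T t i a.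
Proof. by move=> h; apply: run_gco h (inv_full d0 P F). Qed.

Lemma hist_prop F p T e t a : mrun d0 P (full F) p T -> e \in p -> propto e t a ->
  exists k k0, [/\ gco T (inst e).1 (inst e).2 = Some k, keyof T (gprop T t a) = Some k0,
    (k <= k0)%R & addr_val d0 T (inst e).1 (inst e).2 a].
Proof. by move=> h; apply: run_prop h (inv_full d0 P F). Qed.

Lemma prop_after S p T f t a k : mrun d0 P S p T -> invar d0 P S -> f \in p -> propto f t a ->
  keyof S (gprop S t a) = Some k ->
  exists2 kf, gco T (inst f).1 (inst f).2 = Some kf & (k < kf)%R.
Proof.
move=> h; elim: h k => // {}S e l ms {}T h h2 IH k I; have I' := inv_en I h.
have X0 := en_ext I h; have X := mrun_ext h2 I'.
rewrite inE => /orP[/eqP ?|]; last first.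
  move=> hf pr ek; have [k' ek' le] := x_gp X0 ek.
  by have [kf h3 h4] := IH _ I' hf pr ek'; exists kf => //; apply: le_lt_trans h4.
subst e => pr ek; have [k1 [k0 [e1 e0 lk av]]] := en_propto I h pr.
move: e0; rewrite ek => -[?]; subst k0; exists k1 => //; exact: (x_co X).
Qed.

(** The key a thread sees at an address only grows, and at the time of the commit it still had to be
    below the new key. *)
Lemma pending_key S p T t i k a : mrun d0 P S p T -> invar d0 P S -> ~~ rC (rt S t) i ->
  gco T t i = Some k -> addr_val d0 T t i a ->
  exists2 k0, keyof S (gprop S t a) = Some k0 & (k0 < k)%R.
Proof.
elim=> [{}S I nC ek av|{}S e l ms {}T h h2 IH I nC ek av].
  by have [_ hC _ _ _] := i_co I ek; rewrite hC in nC.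
have I' := inv_en I h; have X0 := en_ext I h; have X := mrun_ext h2 I'.
case hC : (rC (rt (upd S e l) t) i); last first.
  have [k0 e0 l0] := IH I' (negbT hC) ek av.
  have [k1 e1 _] := gp_key t a I; have [k2 e2 le] := x_gp X0 e1.
  exists k1 => //; move: e2; rewrite e0 => -[?]; subst k2; exact: le_lt_trans l0.
move: hC; rewrite upd_rC (negPf nC) /= => ic.
case: e h ic h2 I' X0 X IH => //= [t1 i1|t1 i1 k1 a1] h /andP[/eqP ? /eqP ?] h2 I' X0 X IH; subst.
  have [_ _ hs _ _] := i_co (mrun_inv h2 I') ek; move: h => [_ _ _ /negP []].
  by rewrite -(ext_store t i X0) -(ext_store t i X).
move: h => [_ _ _ [_ av1] [_ [k0 e0 l0]]].
have ? := addr_det av (ext_addr X (ext_addr X0 av1)); subst a1.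
have : gco T t i = Some k1 by apply: (x_co X); rewrite /= !eqxx.
by rewrite ek => -[?]; subst k1; exists k0.
Qed.

(** Names an event by its instruction and its kind: 0 for the load, 1 for the commit, and a number
    from 2 on for the target thread of a propagation. No name occurs twice in a run, so events can
    be identified by it. *)
Definition code e : (nat * nat) * nat :=
  (inst e, match e with MLoad _ _ _ => 0 | MProp t _ _ _ => t.+2 | _ => 1 end).

Lemma iscom_code e t i : iscom e t i -> code e = ((t, i), 1).
Proof. by case: e => //= [? ?|? ? ? ?] /andP[/eqP-> /eqP->]. Qed.

Lemma isld_code e t i : isld e t i -> code e = ((t, i), 0).
Proof. by case: e => //= ? ? ? /andP[/eqP-> /eqP->]. Qed.

Lemma code_uniq F p S : mrun d0 P (full F) p S -> uniq (map code p).
Proof.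
elim/last_ind: p S => [|p e IH] S // /mrun_rcons[T [l [h enabled _]]].
rewrite map_rcons rcons_uniq (IH _ h) andbT; apply/negP => /mapP[e' he'].
have I := reach_inv h.
have hC := hist_rC _ _ h; have hL := hist_rL _ _ h.
have hp := fun t a => hist_prop (t := t) (a := a) h he'.
case: e enabled => [t i a|t i|t i k a|t t' i a] enabled; rewrite /code;
  case: e' he' hp => [t1 i1 a1|t1 i1|t1 i1 k1 a1|t1 t1' i1 a1] //= he' hp [].
- move=> ? ?; subst; move: enabled => /= -[_ _ nL _ _].
  by move: (hL t1 i1); rewrite nL => /esym/negP; case; apply/hasP; exists (MLoad t1 i1 a1) => //=; rewrite !eqxx.
- move=> ? ?; subst; move: enabled => /= -[_ nC _ _]; case/negP: nC; rewrite hC.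
  by apply/hasP; exists (MCommit D t1 i1) => //=; rewrite !eqxx.
- move=> ? ?; subst; move: enabled => /= -[_ nC _ _]; case/negP: nC; rewrite hC.
  by apply/hasP; exists (MCommitSt t1 i1 k1 a1) => //=; rewrite !eqxx.
- move=> ? ?; subst; move: enabled => /= -[_ nC _ _ _]; case/negP: nC; rewrite hC.
  by apply/hasP; exists (MCommit D t1 i1) => //=; rewrite !eqxx.
- move=> ? ?; subst; move: enabled => /= -[_ nC _ _ _]; case/negP: nC; rewrite hC.
  by apply/hasP; exists (MCommitSt t1 i1 k1 a1) => //=; rewrite !eqxx.
- move=> ? ? ?; subst; move: enabled => /= -[_ _ _ av [k [k0 [e1 e0 lk]]]].
  have [|k1 [k2 [e2 e3 le av1]]] := hp t1 a1; first by rewrite !eqxx.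
  have ? := addr_det av av1; subst a1.
  move: e2; rewrite e1 => -[?]; subst k1; move: e3; rewrite e0 => -[?]; subst k2.
  by move: (lt_le_trans lk le); rewrite ltxx.
Qed.

Lemma code_inj F p S e f : mrun d0 P (full F) p S -> e \in p -> f \in p -> code e = code f -> e = f.
Proof.
move=> /code_uniq u he hf E.
have := congr1 (nth e p) (uniqP (code e) u (index e p) (index f p) _ _ _).
rewrite !nth_index //; apply; rewrite ?inE ?size_map ?index_mem //.
by rewrite !(nth_map e) ?index_mem // !nth_index.
Qed.

Lemma mrun_uniq F p S : mrun d0 P (full F) p S -> uniq p.
Proof. by move=> /code_uniq; apply: map_uniq. Qed.

End History.

(** * The exchange principle *)

Section Reorder.
Variables (D Reg : finType) (d0 : D) (P : program D Reg).
Implicit Types (S T : gstate D Reg) (t i j : nat) (e f : mev D).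
Implicit Types (F : nat -> seq (instr D Reg)).

(* Taking [x = (size P, 0)], which is no instruction, excludes nothing. *)
Record ranked T (x : nat * nat) (rk : nat * nat -> nat) : Prop := Ranked {
  r_po : forall t i j, i < j -> j < size (rF (rt T t)) -> (t, i) <> x -> (t, j) <> x ->
    rk (t, i) < rk (t, j);
  r_src : forall t j t' i', rL (rt T t) j = Some (SStore D t' i') -> (t, j) <> x -> (t', i') <> x ->
    rk (t', i') < rk (t, j);
  r_co : forall t i t' i' a k k', gco T t i = Some k -> gco T t' i' = Some k' ->
    addr_val d0 T t i a -> addr_val d0 T t' i' a -> (k < k')%R ->
    (t, i) <> x -> (t', i') <> x -> rk (t, i) < rk (t', i');
  r_cf : forall t j t' i' a l k k', rL (rt T t) j = Some l -> addr_val d0 T t j a ->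
    keyof T l = Some k -> gco T t' i' = Some k' -> addr_val d0 T t' i' a -> (k < k')%R ->
    (t, j) <> x -> (t', i') <> x -> rk (t, j) < rk (t', i') }.

Record compat T (x : nat * nat) (le : rel (nat * nat)) : Prop := Compat {
  c_refl : reflexive le;
  c_trans : transitive le;
  c_po : forall t i j, i < j -> j < size (rF (rt T t)) -> (t, i) <> x -> (t, j) <> x ->
    le (t, i) (t, j);
  c_src : forall t j t' i', rL (rt T t) j = Some (SStore D t' i') -> (t, j) <> x -> (t', i') <> x ->
    le (t', i') (t, j);
  c_co : forall t i t' i' a k k', gco T t i = Some k -> gco T t' i' = Some k' ->
    addr_val d0 T t i a -> addr_val d0 T t' i' a -> (k < k')%R ->
    (t, i) <> x -> (t', i') <> x -> le (t, i) (t', i');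
  c_cf : forall t j t' i' a l k k', rL (rt T t) j = Some l -> addr_val d0 T t j a ->
    keyof T l = Some k -> gco T t' i' = Some k' -> addr_val d0 T t' i' a -> (k < k')%R ->
    (t, j) <> x -> (t', i') <> x -> le (t, j) (t', i') }.

Lemma ranked_compat T x rk : ranked T x rk -> compat T x (fun y z => rk y <= rk z).
Proof.
case=> h1 h2 h3 h4; split.
- by move=> y; apply: leqnn.
- by move=> y z u; apply: leq_trans.
- by move=> *; apply/ltnW/h1.
- by move=> *; apply/ltnW/h2.
- by move=> t i t' i' a k k' e1 e2 a1 a2 lk n1 n2; apply/ltnW/(h3 _ _ _ _ _ _ _ e1 e2 a1 a2).
- by move=> t j t' i' a l k k' El av ek ek' av' lk n1 n2; apply/ltnW/(h4 _ _ _ _ _ _ _ _ El av ek ek').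
Qed.

Lemma compatT T x : compat T x (fun _ _ => true).
Proof. by []. Qed.

Lemma prefix_mem (A : eqType) (p r : seq A) (e f : A) : uniq (p ++ e :: r) -> f \in p ++ e :: r ->
  (f \in p) = (index f (p ++ e :: r) < index e (p ++ e :: r)).
Proof.
rewrite cat_uniq /= => /and3P[_ /norP[ne _] _] _.
have -> : index e (p ++ e :: r) = size p by rewrite index_cat (negPf ne) /= eqxx addn0.
rewrite index_cat; case: ifP => h; first by rewrite index_mem h.
by rewrite ltnNge leq_addr.
Qed.

(** Covers both uses: permuting all events ([keep] true) and dropping those of [x] ([keep] false).
    An event may overtake another only if neither belongs to [x] and the instruction of the
    overtaken one is not below that of the overtaking one. Every load still reads the same store,
    though an early read may become a read from memory. *)
Lemma reorder F F' ms T ms' x (keep : bool) le :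
  mrun d0 P (full F) ms T -> uniq ms' ->
  (forall e, (e \in ms') = (e \in ms) && (keep || (inst e != x))) ->
  (forall t i, keep || ((t, i) != x) -> cmd_at (full F') t i = cmd_at (full F) t i) ->
  (forall e f, e \in ms' -> f \in ms' -> index f ms < index e ms ->
     [|| inst f == x, inst e == x | le (inst f) (inst e)] -> index f ms' < index e ms') ->
  compat T x le ->
  (forall t i, rL (rt T t) i <> Some (SStore D x.1 x.2)) ->
  (forall i, x.2 < i -> size (F x.1) <= i) ->
  exists2 T', mrun d0 P (full F') ms' T' &
    forall t i l, rL (rt T' t) i = Some l -> rL (rt T t) i = Some l.
Proof.
move=> hm um' mem' cmds ord R unr last.
have IT := reach_inv hm.
have um := mrun_uniq hm.
suff H p r : ms' = p ++ r -> exists2 T', mrun d0 P (full F') p T' &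
    forall t i l, rL (rt T' t) i = Some l -> rL (rt T t) i = Some l.
  by apply: (H ms' [::]); rewrite cats0.
elim/last_ind: p r => [|p e IH] r Ep.
  by exists (full F') => //; apply: mrun_nil.
rewrite cat_rcons in Ep; have [S' hS' LS'] := IH _ Ep.
have e_in' : e \in ms' by rewrite Ep mem_cat mem_head orbT.
have := e_in'; rewrite mem' => /andP[e_in kx].
have [E [E2 Em]] : exists E E2, ms = E ++ e :: E2.
  by case/splitPr: e_in => E E2; exists E, E2.
have : mrun d0 P (full F) (E ++ e :: E2) T by rewrite -Em.
(* [S] is the state in which the original run performs [e], [S'] the one reached by the new run. It
   remains to enable [e] in [S'] with the same [l]. *)
move=> /mrun_cat[S hS hS2]; inversion hS2 as [|S0 e0 l ms0 T0 hen hE2]; subst S0 e0 ms0 T0.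
have I := reach_inv hS.
have I' := reach_inv hS'.
have X1 := en_ext I hen; have I1 := inv_en I hen; have X2 := mrun_ext hE2 I1.
have XT := ext_trans X1 X2.
have memE f : f \in ms -> (f \in E) = (index f ms < index e ms).
  by rewrite Em => hf; apply: prefix_mem hf; rewrite -Em.
have memp f : f \in ms' -> (f \in p) = (index f ms' < index e ms').
  by rewrite Ep => hf; apply: prefix_mem hf; rewrite -Ep.
have p' f : f \in p -> f \in ms' by rewrite Ep mem_cat => ->.
have pm f : f \in p -> f \in ms by move=> /p'; rewrite mem' => /andP[].
have e_p : e \notin p by rewrite memp // ltnn.
have Esub f : f \in E -> f \in ms by rewrite Em mem_cat => ->.
have Ep' f : f \in E -> keep || (inst f != x) ->
    [|| inst f == x, inst e == x | le (inst f) (inst e)] -> f \in p.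
  move=> hE hk hc; have hf : f \in ms' by rewrite mem' (Esub _ hE) hk.
  by rewrite memp //; apply: ord => //; rewrite -memE // Esub.
(* The events that overtake [e]. The last conclusion turns every happens-before edge from [inst e]
   to [inst f] into a contradiction. *)
have pE f : f \in p -> f \notin E ->
    [/\ f \in E2, inst e <> x, inst f <> x & ~~ le (inst e) (inst f)].
  move=> hp nE; have fE2 : f \in E2.
    have := pm _ hp; rewrite Em mem_cat (negPf nE) inE /= => /orP[/eqP ?|//].
    by subst f; rewrite hp in e_p.
  have lt : index e ms < index f ms.
    rewrite ltn_neqAle leqNgt -memE ?pm // nE andbT; apply/eqP => h.
    have : nth e ms (index e ms) = nth e ms (index f ms) by rewrite h.
    by rewrite (nth_index e e_in) (nth_index e (pm _ hp)) => ?; subst f; rewrite hp in e_p.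
  have : ~~ [|| inst e == x, inst f == x | le (inst e) (inst f)].
    apply/negP => hc; have := ord f e (p' _ hp) e_in' lt hc.
    by move: (hp); rewrite memp ?p' // => h1 h2; move: (ltn_trans h1 h2); rewrite ltnn.
  by rewrite !negb_or => /and3P[/eqP ? /eqP ? ?].
(* The instructions below [inst e], whose events preceding [e] in the original run also precede it
   in the new one. If [e] belongs to [x], all instructions qualify, since nothing may overtake or be
   overtaken by [e]. *)
set dom := fun t j => (keep || ((t, j) != x)) /\
   (inst e = x \/ [/\ (t, j) <> x, le (t, j) (inst e) & j < size (F t)]).
have FS t : rF (rt S t) = F t by rewrite (mrun_F hS).
have FT t : rF (rt T t) = F t by rewrite (mrun_F hm).
have FS' t : rF (rt S' t) = F' t by rewrite (mrun_F hS').
have keepx : inst e = x -> keep by move=> h; move: kx; rewrite h eqxx orbF.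
have dome : dom (inst e).1 (inst e).2.
  split; first by rewrite -surjective_pairing.
  case: (inst e =P x) => [|ne]; [by left|right]; rewrite -surjective_pairing; split=> //; first exact: (c_refl R).
  by have := en_range hen; rewrite FS.
have dom_po t i j : dom t i -> j < i -> dom t j.
  move=> [h1 [h2|[h2 h3 h4]]] lt; first by split; [rewrite keepx|left].
  have nj : (t, j) <> x.
    by move=> ?; subst x; have := last i lt; rewrite leqNgt h4.
  split; first by move/eqP: nj => ->; rewrite orbT.
  right; split=> //; last exact: ltn_trans h4.
  by apply: (c_trans R) h3; apply: (c_po R) => //; rewrite FT.
have dom_ev t i f : dom t i -> f \in E -> inst f = (t, i) -> f \in p.
  move=> [h1 h2] hE ei; apply: Ep' => //; first by rewrite ei.
  rewrite ei; case: h2 => [->|[_ -> _]]; by rewrite ?eqxx ?orbT.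
have X : xf S S' dom.
  apply: xfI => //.
  - move=> t i [hk _]; have e1 : cmd_at S' t i = cmd_at (full F') t i by apply: cmd_at_eqF; rewrite FS'.
    have e2 : cmd_at S t i = cmd_at (full F) t i by apply: cmd_at_eqF; rewrite FS.
    by rewrite e1 e2; apply: cmds.
  - move=> t i l0 hd El; have /hasP[f hf fl] : has (fun f => isld f t i) E by rewrite -(hist_rL t i hS) El.
    have hp := dom_ev _ _ _ hd hf (isldP fl).
    have : rL (rt S' t) i : bool by rewrite (hist_rL t i hS'); apply/hasP; exists f.
    case El': (rL (rt S' t) i) => [l1|//] _.
    by have := LS' _ _ _ El'; rewrite (ext_L XT El) => -[->].
  - move=> t i hd; rewrite (hist_rC t i hS) (hist_rC t i hS') => /hasP[f hf fl].
    by apply/hasP; exists f => //; apply: dom_ev hd hf (iscomP fl).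
  - move=> t i t' i' [h1 h2] El; have ElT := ext_L XT El.
    have nx : (t', i') <> x by move=> ?; subst x; apply: unr ElT.
    split; first by move/eqP: nx => ->; rewrite orbT.
    case: h2 => [|[h2 h3 h4]]; [by left|right]; split=> //.
      by apply: (c_trans R) h3; apply: (c_src R) ElT _ _.
    have [_ _ [a [_ [/store_atE[e1 [e2 h]] _ _] _]]] := i_rL I El.
    by rewrite -FS; apply: cmd_at_lt h.
have coT t i k : gco S' t i = Some k -> gco T t i = Some k.
  move=> /(hist_gco hS')[a /pm ha]; exact: (hist_commit hm ha).1.
have coS t i k : dom t i -> gco S t i = Some k -> gco S' t i = Some k.
  move=> hd /(hist_gco hS)[a ha]; have hp : MCommitSt t i k a \in p by apply: dom_ev hd ha _.
  exact: (hist_commit hS' hp).1.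
have fresh f : f \in p -> code f <> code e.
  by move=> hf hc; have ? := code_inj hm (pm _ hf) e_in hc; subst f; rewrite hf in e_p.
have freshC t i : code e = ((t, i), 1) -> ~~ rC (rt S' t) i.
  move=> ic; rewrite (hist_rC _ _ hS'); apply/negP => /hasP[f hf /iscom_code fc].
  by apply: (fresh f) => //; rewrite fc ic.
have freshL t i : code e = ((t, i), 0) -> rL (rt S' t) i = None.
  move=> ic; case El: (rL _ _) => [l0|//].
  have : rL (rt S' t) i : bool by rewrite El.
  rewrite (hist_rL _ _ hS') => /hasP[f hf /isld_code fc].
  by case: (fresh f) => //; rewrite fc ic.
(* For commits and propagations. If the store visible in [S'] was propagated before [e] originally,
   its key is bounded by what [S] shows. If its propagation overtook [e], it came after [e]
   originally and has a larger key, which is a [co] edge in the wrong direction. *)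
have upper t a k : propto e t a -> gco T (inst e).1 (inst e).2 = Some k ->
    exists2 k0, keyof S' (gprop S' t a) = Some k0 & (k0 < k)%R.
  move=> pr ek; have [k0 e0 _] := gp_key t a I'; exists k0 => //.
  have [k1 [k2 [e1 e2 lk av]]] := en_propto I hen pr.
  have ? : k1 = k by move: (ext_key X2 e1); rewrite /= ek => -[].
  subst k1; have avT := ext_addr XT av.
  case Eg: (gprop S' t a) => [b|t' i'] in e0 *.
    by move: e0 => -[<-]; have [_ _ _] := i_co IT ek.
  have [f [hf pf fi]] := hist_gprop hS' Eg.
  have kT : gco T t' i' = Some k0 by apply: coT.
  have avf : addr_val d0 T t' i' a.
    by have [? [? [_ _ _]]] := hist_prop hm (pm _ hf) pf; rewrite fi.
  have [hE|nE] := boolP (f \in E).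
    have [k3 [k4 [e3 e4 l4 _]]] := hist_prop hS hE pf.
    move: e4; rewrite e2 => -[?]; subst k4; apply: le_lt_trans lk.
    have := ext_key XT (l := SStore D (inst f).1 (inst f).2) e3; rewrite /= fi kT => -[->].
    by move: l4.
  have [f2 nex nfx ltr] := pE _ hf nE.
  have eg : keyof (upd S e l) (gprop (upd S e l) t a) = Some k by rewrite [gprop _ _ _]/= pr.
  have [kf ekf lkf] := prop_after hE2 I1 f2 pf eg.
  move: ekf; rewrite fi kT => -[?]; subst kf.
  have := c_co R ek kT avT avf lkf; rewrite -surjective_pairing -fi => /(_ nex nfx).
  by rewrite (negPf ltr).
have en' : enabled d0 P S' e l.
  move: (hen); case Ee : e => [t i a|t i|t i k a|t t' i a] /=.
  - move=> [lt ld nL av hl]; have dt : dom t i by move: dome; rewrite Ee.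
    have elT : rL (rt T t) i = Some l.
      by apply: (x_L (x_xf X2)) => //=; rewrite Ee /= !eqxx.
    have avT := ext_addr XT av.
    (* A propagation that overtakes the load with a key above that of the store read would be a [cf]
       edge in the wrong direction. *)
    have cf f z k kz : f \in p -> propto f t a -> inst f = z -> keyof T l = Some k ->
        gco T z.1 z.2 = Some kz -> (k < kz)%R -> f \notin E -> False.
      move=> hf pf fz ekl ekz lk nE; have [_ nex nfx ltr] := pE _ hf nE.
      have [_ [_ [_ _ _ avf]]] := hist_prop hm (pm _ hf) pf.
      rewrite fz in avf nfx ltr; case: z avf nfx ltr ekz {fz} => t1 i1 avf nfx ltr ekz.
      rewrite Ee /= in nex ltr.
      by move: (c_cf R elT avT ekl ekz avf lk nex nfx); rewrite (negPf ltr).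
    split=> //; [by rewrite (xf_load X)|by apply: freshL; rewrite Ee|exact: (xf_addr X)|].
    case: hl => [El|[i' El [m1 [m2 m2'] [v m3] m4 m5]]].
      left; have [kl ekl kl0] := gp_key t a I; rewrite -El in ekl.
      have eklT : keyof T l = Some kl := ext_key XT ekl.
      have up f kf : f \in p -> propto f t a -> gco T (inst f).1 (inst f).2 = Some kf -> (kf <= kl)%R.
        move=> hf pf ekf; case: (boolP (f \in E)) => [hE|nE]; last first.
          by rewrite leNgt; apply/negP => lk; apply: (cf f _ _ _ hf pf erefl eklT ekf lk nE).
        have [k3 [k4 [e3 e4 l4 _]]] := hist_prop hS hE pf.
        move: e4; rewrite -El ekl => -[?]; subst k4.
        by move: (x_co XT e3); rewrite ekf => -[->].
      (* The propagation that made [l] visible stays before the load because of the [src] edge. With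
         [up], this makes [l] the largest propagated store in [S']. *)
      have lowp t1 i1 : l = SStore D t1 i1 -> exists2 f, f \in p /\ propto f t a & inst f = (t1, i1).
        move=> Ez; rewrite Ez in El elT; have [f [hf pf fz]] := hist_gprop hS (esym El).
        exists f => //; split=> //; have nx : (t1, i1) <> x.
          by move=> Ex; apply: (unr t i); rewrite -Ex.
        apply: Ep' => //; first by rewrite fz; move/eqP: nx => ->; rewrite orbT.
        rewrite Ee /= fz; have [->|ne] := (t, i) =P x; first by rewrite orbT.
        by apply/or3P/Or33/(c_src R elT).
      case Eg: (gprop S' t a) => [b|t' i'].
        have ? := i_gp I' Eg; subst b; case El2: l => [b|t1 i1].
          by rewrite El2 in El; rewrite (i_gp I (esym El)).
        have [f [hf pf] fz] := lowp _ _ El2.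
        have [k1 [k2 [e1 e2 l2 _]]] := hist_prop hS' hf pf.
        move: e2; rewrite Eg => -[?]; subst k2.
        have [_ _ _ l3 _] := i_co I' e1.
        by move: (lt_le_trans l3 l2); rewrite ltxx.
      have [f [hf pf fi]] := hist_gprop hS' Eg.
      have [k1 [k2 [e1 e2 l2 _]]] := hist_prop hS' hf pf.
      have e1T := coT _ _ _ e1; have le1 := up _ _ hf pf e1T.
      case El2: l => [b|t1 i1].
        have [_ _ _ l3 _] := i_co I' e1; rewrite El2 in eklT; move: eklT le1 => -[<-] le1.
        by move: (lt_le_trans l3 le1); rewrite ltxx.
      have [f' [hf' pf'] fz'] := lowp _ _ El2.
      have [k3 [k4 [e3 e4 l4 _]]] := hist_prop hS' hf' pf'.
      move: e4; rewrite Eg /= => e4; rewrite fi /= e4 in e1; move: e1 => -[?]; subst k4.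
      have e3T := coT _ _ _ e3; rewrite fz' /= in e3T.
      rewrite El2 /= e3T in eklT; move: eklT => -[?]; subst k3.
      have ? : kl = k1 by apply: le_anti; rewrite l4 le1.
      subst k1; rewrite fi /= in e1T.
      by have [-> ->] := i_inj IT e3T e1T.
    have di : dom t i' by apply: dom_po dt m1.
    (* If the store is still uncommitted in [S'], the early read remains one. If its commit has
       overtaken the load, memory must show exactly this store: a larger one either overtook the
       load too, against [cf], or was visible in [S] already, where [pending_key] bounds everything
       visible below the key of the store. *)
    case hC : (rC (rt S' t) i'); last first.
      right; exists i' => //; split=> //.
      + by split; [rewrite (xf_store X)|apply: (xf_addr X)].
      + by exists v; apply: (xf_val X).
      + by rewrite hC.
      + move=> j l1 l2; have dj : dom t j by apply: dom_po dt l2.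
        rewrite (xf_store X) // => st; have [b hb nb] := m5 _ l1 l2 st.
        by exists b => //; apply: (xf_addr X).
    left; have st' : store_at S' t i' by rewrite (xf_store X).
    have [kz ekz] := i_Cco I' hC st'; have ekzT := coT _ _ _ ekz.
    have [k0 ek0 le0] := i_own I' ekz (xf_addr X di m2').
    have [_ _ _ kz0 _] := i_co I' ekz.
    case Eg: (gprop S' t a) => [b|t1 i1].
      by move: ek0; rewrite Eg => -[?]; subst k0; move: (lt_le_trans kz0 le0); rewrite ltxx.
    have [f [hf pf fi]] := hist_gprop hS' Eg.
    rewrite Eg /= in ek0; have ek0T := coT _ _ _ ek0.
    move: le0; rewrite le_eqVlt => /orP[/eqP ?|ltk].
      by subst k0; rewrite El; have [-> ->] := i_inj IT ekzT ek0T.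
    exfalso; have [hE|nE] := boolP (f \in E); last first.
      by apply: (cf f _ _ _ hf pf fi _ ek0T ltk nE); rewrite El.
    have [k3 [k4 [e3 e4 l4 _]]] := hist_prop hS hE pf.
    have := x_co XT e3; rewrite fi /= ek0T => -[?]; subst k3.
    have [k5 e5 l5] := pending_key (mrun_cons hen hE2) I m4 ekzT (ext_addr XT m2').
    move: e5; rewrite e4 => -[?]; subst k5.
    by move: (lt_trans (le_lt_trans l4 l5) ltk); rewrite ltxx.
  - move=> [lt nC ck nst]; have dt : dom t i by move: dome; rewrite Ee.
    split=> //; [by apply: freshC; rewrite Ee|exact: (xf_cok X)|by rewrite (xf_store X)].
  - move=> [lt nC ck [st av] [[kn0 un] _]]; have dt : dom t i by move: dome; rewrite Ee.
    have eT : gco T t i = Some k by apply: (x_co X2); rewrite Ee /= !eqxx.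
    have fC : ~~ rC (rt S' t) i by apply: freshC; rewrite Ee.
    split=> //; [exact: (xf_cok X)|by rewrite (xf_store X) //; split=> //; apply: (xf_addr X)|].
    split; last by apply: upper; rewrite Ee //= !eqxx.
    split=> // t1 i1 e1; have [? ?] := i_inj IT (coT _ _ _ e1) eT; subst t1 i1.
    by have [_ hC _ _ _] := i_co I' e1; rewrite hC in fC.
  - move=> [[ne lt] lt' [st hC] av [k [k0 [ek _ _]]]]; have dt : dom t' i by move: dome; rewrite Ee.
    have eT := x_co XT ek.
    split=> //; [by rewrite (xf_store X) //; split=> //; apply: (x_C X)|exact: (xf_addr X)|].
    have [||k1 e1 l1] := upper t a k; rewrite ?Ee //= ?eqxx //.
    by exists k, k1; split=> //; apply: coS.
have hS'2 : mrun d0 P (full F') (rcons p e) (upd S' e l) by apply/mrun_rcons; exists S', l.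
exists (upd S' e l) => // t i l0 /=; case: ifP => [ic [<-]|_]; last exact: LS'.
by apply: (x_L (x_xf X2)) => //=; rewrite ic.
Qed.

End Reorder.

(** * Acyclic happens-before as the existence of a ranking *)

Section Acyclic.
Variables (D Reg : finType) (d0 : D) (P : program D Reg).
Implicit Types (S T : gstate D Reg) (t i j : nat).
Implicit Types (F : nat -> seq (instr D Reg)).

Lemma wf_size F t i : wfF P F -> i < size (F t) -> t < size P.
Proof.
by move=> w; case E: (F t) => [//|x q] _; have [] := w t [::] x q E.
Qed.

Lemma trF S t : t < size P -> nth [::] (tr_F (trace_of d0 P S)) t = rF (rt S t).
Proof. by move=> lt; rewrite /= (nth_map 0) ?size_iota // nth_iota. Qed.

Lemma ranked_acyclic S rk : invar d0 P S -> wfF P (fun t => rF (rt S t)) ->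
  ranked d0 S (size P, 0) rk -> ~ hb_cyclic (trace_of d0 P S).
Proof.
move=> I w R.
(* Instructions of the program differ from the dummy, so [ranked] covers all edges. *)
have nx t i : t < size P -> (t, i) <> (size P, 0) by move=> lt [h]; rewrite h ltnn in lt.
(* The shift by one leaves rank 0 to the initial stores, which have no predecessors. *)
pose nrk (x : node D) := if x is NIns t i then (rk (t, i)).+1 else 0.
have Hco x y : tr_co (trace_of d0 P S) x y -> nrk x < nrk y.
  case=> [[a [t [i [k [-> [-> _]]]]]] //|[a [t [i [k [t' [i' [k' [-> [-> [h [h' lk]]]]]]]]]]]].
  by case: h h' => [h1 h2 h3 h4 h5] [h1' h2' h3' h4' h5']; apply: (r_co R) h5 h5' h4 h4' lk _ _; apply: nx.
have H x y : tr_hb (trace_of d0 P S) x y -> nrk x < nrk y.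
  move=> [|[|[]]].
  - move=> [t [i [-> [-> lt]]]] /=; rewrite ltnS.
    have lt' : t < size P.
      by rewrite ltnNge; apply/negP => le; rewrite nth_default ?size_map ?size_iota in lt.
    by rewrite trF // in lt; apply: (r_po R) => //; apply: nx.
  - exact: Hco.
  - move=> /= [t [i [l [-> [lt [_ [_ [El ->]]]]]]]].
    case: l El => //= t' i' El; rewrite ltnS; apply: (r_src R El); first exact: nx.
    have [_ _ [a [_ [/store_atE[e1 [e2 h]] _ _] _]]] := i_rL I El.
    by apply: nx; apply: (wf_size w (i := i')); apply: cmd_at_lt h.
  - move=> [z [/= [t [i [l [-> [lt [_ [ld [El ->]]]]]]]] co]].
    have [_ _ [a [av hm _]]] := i_rL I El.
    case: l El hm co => [b|t1 i1] El hm.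
      case=> [[a' [t' [i' [k [[?] [-> [h1 h2 h3 h4 h5]]]]]]]|[a' [t' [i' [k [? [? [? [//]]]]]]]]]; subst b a'.
      have [_ _ _ kp _] := i_co I h5.
      by rewrite /= ltnS; apply: (r_cf R El av (k := 0%R) _ h5 h4) => //; apply: nx.
    case=> [[a' [t' [i' [k [//]]]]]|[a' [t' [i' [k [t2 [i2 [k2 [[? ?] [-> [h [h' lk]]]]]]]]]]]].
    subst t' i'; case: h h' => [g1 g2 g3 g4 g5] [h1 h2 h3 h4 h5].
    have [_ av1 _] := hm; have ? := addr_det av1 g4; subst a'.
    by rewrite /= ltnS; apply: (r_cf R El av g5 h5 h4 lk); apply: nx.
have Hp x y : clos_trans (node D) (@tr_hb D Reg (trace_of d0 P S)) x y -> nrk x < nrk y.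
  by elim=> [{}x {}y /H//|{}x {}y z _ h1 _ h2]; apply: ltn_trans h2.
by move=> [x /Hp]; rewrite ltnn.
Qed.

Definition nodes S : seq (nat * nat) :=
  [seq (t, i) | t <- iota 0 (size P), i <- iota 0 (size (rF (rt S t)))].

Lemma mem_nodes S t i : wfF P (fun t => rF (rt S t)) -> ((t, i) \in nodes S) = (i < size (rF (rt S t))).
Proof.
move=> w; apply/idP/idP.
  by move=> /allpairsPdep[t1 [i1 [_ h [-> ->]]]]; rewrite mem_iota in h.
move=> lt; apply/allpairsPdep; exists t, i; rewrite !mem_iota; split=> //.
exact: (wf_size w lt).
Qed.

Lemma nodes_uniq S : uniq (nodes S).
Proof.
apply: allpairs_uniq_dep; first exact: iota_uniq.
  by move=> t _; apply: iota_uniq.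
by move=> [t1 i1] [t2 i2] _ _ /= [-> ->].
Qed.

Lemma acyclic_ranked S x : invar d0 P S -> wfF P (fun t => rF (rt S t)) ->
  ~ hb_cyclic (trace_of d0 P S) ->
  exists o, enumr (fun t => rF (rt S t)) o /\ ranked d0 S x (fun y => index y o).
Proof.
move=> I w ac.
pose N (y : nat * nat) := NIns D y.1 y.2.
pose lt y z := clos_trans (node D) (@tr_hb D Reg (trace_of d0 P S)) (N y) (N z).
(* The number of predecessors in happens-before strictly increases along edges, so sorting by it is
   a topological sort. *)
pose ht y := count (fun z => `[< lt z y >]) (nodes S).
have ht_lt y z : y \in nodes S -> lt y z -> ht y < ht z.
  move=> hy yz; rewrite /ht.
  have sub : subpred (fun u => `[< lt u y >]) (fun u => `[< lt u z >]).
    by move=> u /asboolP h; apply/asboolP; apply: t_trans h yz.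
  have -> : count (fun u => `[< lt u z >]) (nodes S) =
      count (fun u => `[< lt u y >]) (nodes S) + count (fun u => `[< lt u z >] && ~~ `[< lt u y >]) (nodes S).
    elim: (nodes S) => //= u us ->; rewrite addnACA; congr (_ + _).
    by case h: (`[< lt u y >]) => /=; [rewrite (sub u h)|rewrite andbT].
  rewrite -[X in X < _]addn0 ltn_add2l -has_count; apply/hasP; exists y => //.
  apply/andP; split; first exact/asboolP.
  by apply/asboolPn => yy; apply: ac; exists (N y).
pose o := sort (fun y z => ht y <= ht z) (nodes S).
have mo y : (y \in o) = (y \in nodes S) by rewrite mem_sort.
have so : sorted (fun y z => ht y <= ht z) o by apply: sort_sorted => y z; apply: leq_total.
have idx y z : y \in nodes S -> z \in nodes S -> lt y z -> index y o < index z o.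
  move=> hy hz /(ht_lt _ _ hy) h; rewrite ltnNge; apply/negP => le.
  have := sorted_leq_index (leT := fun y z => ht y <= ht z) _ _ so.
  move=> /(_ _ _ z y); rewrite !mo => /(_ _ _ hz hy le); rewrite leqNgt h => h'.
  suff: false by []. apply: h'; [by move=> ? ? ?; apply: leq_trans|by move=> ?; apply: leqnn].
have mn t i : i < size (rF (rt S t)) -> (t, i) \in nodes S by rewrite mem_nodes.
have po t i j : i < j -> j < size (rF (rt S t)) -> lt (t, i) (t, j).
  elim: j => // j IH; rewrite ltnS leq_eqVlt => /orP[/eqP ?|lij] ltj.
    subst j; apply: t_step; left; exists t, i; split=> //; split=> //.
    by rewrite trF //; apply: (wf_size w ltj).
  apply: (@t_trans _ _ _ (N (t, j))); first by apply: IH lij (ltnW ltj).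
  apply: t_step; left; exists t, j; split=> //; split=> //.
  by rewrite trF //; apply: (wf_size w ltj).
have cs t i a k : gco S t i = Some k -> addr_val d0 S t i a -> committed_store d0 P S t i a k.
  move=> ek av; have [h1 _ h2 _ _] := i_co I ek; split=> //.
  by have [c [e [h _]]] := av; apply: cmd_at_lt h.
have src t j l : rL (rt S t) j = Some l -> tr_src (trace_of d0 P S) (node_of l) (NIns D t j).
  move=> El; have [h1 h2 [a [[c [e [h _]]] _ _]]] := i_rL I El.
  exists t, j, l; split=> //; split=> //; split; first exact: cmd_at_lt h.
  by [].
have rng t i a : addr_val d0 S t i a -> (t, i) \in nodes S.
  by move=> [c [e [h _]]]; apply: mn; apply: cmd_at_lt h.
exists o; split.
  split; first by rewrite sort_uniq nodes_uniq.
  - by move=> t i; rewrite mo mem_nodes.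
  - by move=> t i j lij ltj; apply: idx; [apply: mn (ltn_trans lij ltj)|apply: mn|apply: po].
split.
- by move=> t i j lij ltj _ _; apply: idx; [apply: mn (ltn_trans lij ltj)|apply: mn|apply: po].
- move=> t j t' i' El _ _; have [_ _ [a [av [_ av' _] _]]] := i_rL I El.
  apply: idx; [exact: rng av'|exact: rng av|apply: t_step; right; right; left; exact: src El].
- move=> t i t' i' a k k' ek ek' av av' lk _ _.
  apply: idx; [exact: rng av|exact: rng av'|apply: t_step; right; left; right].
  by exists a, t, i, k, t', i', k'; split=> //; split=> //; split; [exact: cs|split=> //; exact: cs].
- move=> t j t' i' a l k k' El av ek ek' av' lk _ _.
  apply: idx; [exact: rng av|exact: rng av'|apply: t_step; right; right; right].
  exists (node_of l); split; first exact: src El.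
  have [_ _ [b [avb hm _]]] := i_rL I El; have ? := addr_det av avb; subst b.
  case: l ek hm {El} => [b|t1 i1] /= ek hm.
    by left; exists a, t', i', k'; rewrite hm; split=> //; split=> //; exact: cs.
  have [_ av1 _] := hm.
  by right; exists a, t1, i1, k, t', i', k'; split=> //; split=> //; split; [exact: cs|split=> //; exact: cs].
Qed.

End Acyclic.

(** * States with the same trace *)

Section Same.
Variables (D Reg : finType) (d0 : D) (P : program D Reg).
Implicit Types (S T : gstate D Reg) (t i j : nat).

(** Propagations are left out: neither the trace nor finality depends on [gprop], and SC execution
    or completion ends with other ones. *)
Record same S S' : Prop := Same {
  sm_F : forall t, rF (rt S' t) = rF (rt S t);
  sm_C : forall t i, rC (rt S' t) i = rC (rt S t) i;
  sm_L : forall t i, rL (rt S' t) i = rL (rt S t) i;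
  sm_co : forall t i, gco S' t i = gco S t i }.

Lemma same_sym S S' : same S S' -> same S' S.
Proof. by case=> h1 h2 h3 h4; split=> *; rewrite ?h1 ?h2 ?h3 ?h4. Qed.

Lemma same_cmd S S' t i : same S S' -> cmd_at S' t i = cmd_at S t i.
Proof. by move=> M; apply: cmd_at_eqF; rewrite (sm_F M). Qed.

Lemma same_addr S S' t i a : same S S' -> addr_val d0 S t i a -> addr_val d0 S' t i a.
Proof.
move=> M; have X : xe S S' (fun _ _ => True); last exact: (xf_addr X).
split=> //; first by move=> *; apply: same_cmd.
by move=> t1 i1 l _; rewrite (sm_L M).
Qed.

Lemma same_key S S' l : same S S' -> keyof S' l = keyof S l.
Proof. by move=> M; case: l => //= t i; rewrite (sm_co M). Qed.

Lemma same_load S S' t i : same S S' -> load_at S' t i = load_at S t i.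
Proof. by move=> M; rewrite /load_at (same_cmd _ _ M). Qed.
Lemma same_store S S' t i : same S S' -> store_at S' t i = store_at S t i.
Proof. by move=> M; rewrite /store_at (same_cmd _ _ M). Qed.

Lemma same_final S S' : same S S' -> final d0 P S -> final d0 P S'.
Proof.
move=> M [h1 h2 h3]; have N := same_sym M; split.
- by move=> t i lt; rewrite (sm_F M) (sm_C M); apply: h1.
- move=> t i' i a lt li; rewrite !(same_load _ _ M) => l1 l2 /(same_addr N) a1 /(same_addr N) a2.
  have [l' [l [k1 [k2 [e1 e2 e3 e4 e5]]]]] := h2 _ _ _ _ lt li l1 l2 a1 a2.
  by exists l', l, k1, k2; rewrite !(sm_L M) !(same_key _ M).
- move=> t i' i a lt li; rewrite (same_load _ _ M) (same_store _ _ M).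
  move=> l1 l2 /(same_addr N) a1 /(same_addr N) a2.
  have [l [k1 [k2 [e1 e2 e3 e4]]]] := h3 _ _ _ _ lt li l1 l2 a1 a2.
  by exists l, k1, k2; rewrite !(sm_L M) !(same_key _ M) !(sm_co M).
Qed.

Lemma same_trace S S' : same S S' -> trace_eq (trace_of d0 P S) (trace_of d0 P S').
Proof.
have cs A B t i a k : same A B -> committed_store d0 P A t i a k -> committed_store d0 P B t i a k.
  move=> M [h1 h2 h3 h4 h5]; split=> //; rewrite ?(sm_F M) ?(same_store _ _ M) ?(sm_co M) //.
  exact: same_addr h4.
have co A B x y : same A B -> tr_co (trace_of d0 P A) x y -> tr_co (trace_of d0 P B) x y.
  move=> M; case=> [[a [t [i [k [-> [-> h]]]]]]|[a [t [i [k [t' [i' [k' [-> [-> [h [h' lk]]]]]]]]]]]].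
    by left; exists a, t, i, k; do 2!split=> //; apply: (cs _ _ _ _ _ _ M).
  right; exists a, t, i, k, t', i', k'; split=> //; split=> //; split; first exact: (cs _ _ _ _ _ _ M).
  by split=> //; apply: (cs _ _ _ _ _ _ M).
have sr A B x y : same A B -> tr_src (trace_of d0 P A) x y -> tr_src (trace_of d0 P B) x y.
  move=> M [t [i [l [-> [h1 [h2 [h3 [h4 ->]]]]]]]]; exists t, i, l.
  by rewrite (sm_F M) (same_load _ _ M) (sm_L M).
move=> M; have N := same_sym M; split.
- by rewrite /=; apply: eq_map => t; rewrite (sm_F M).
- by move=> x y; split; apply: co.
- by move=> x y; split; apply: sr.
Qed.

End Same.

(** * Executing an acyclic computation under SC *)

Section SC.
Variables (D Reg : finType) (d0 : D) (P : program D Reg).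
Variables (s : gstate D Reg) (o : seq (nat * nat)).
Implicit Types (S T : gstate D Reg) (t i j : nat).
Let F := fun t => rF (rt s t).
Hypothesis I : invar d0 P s.
Hypothesis w : wfF P F.
Hypothesis fin : final d0 P s.
Hypothesis E : enumr F o.
Hypothesis R : ranked d0 s (size P, 0) (fun y => index y o).

(** Reads and keys are copied from [s], so that the SC computation ends with its trace. [q_max]
    expresses the single memory of SC: every thread of the program sees the store to [a] that is
    newest in coherence order. *)
Record executed (o1 : seq (nat * nat)) S : Prop := Executed {
  q_F : forall t, rF (rt S t) = take (cnt o1 t) (F t);
  q_C : forall t i, rC (rt S t) i = ((t, i) \in o1);
  q_L : forall t i, rL (rt S t) i = if (t, i) \in o1 then rL (rt s t) i else None;
  q_co : forall t i, gco S t i = if (t, i) \in o1 then gco s t i else None;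
  q_gp : forall t a b, t < size P -> gprop S t a = SInit b -> b = a;
  q_gp2 : forall t a t' i', t < size P -> gprop S t a = SStore D t' i' ->
     (t', i') \in o1 /\ addr_val d0 s t' i' a;
  q_max : forall t a, t < size P -> exists2 k0, keyof s (gprop S t a) = Some k0 &
     forall t' i' k', (t', i') \in o1 -> gco s t' i' = Some k' -> addr_val d0 s t' i' a -> (k' <= k0)%R }.

Lemma executed0 : executed [::] (init_state D Reg).
Proof.
split=> //= [t|t a b _ [->] //|t a _]; first by rewrite take0.
by exists 0%R.
Qed.

Lemma mem_pre (A : eqType) (p q : seq A) f : (f \in p) = (index f (p ++ q) < size p).
Proof. by rewrite index_cat; case: ifP => h; rewrite ?index_mem // ltnNge leq_addr. Qed.

Lemma committed t i : (t, i) \in o -> rC (rt s t) i.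
Proof.
rewrite (en_mem E) => lt; case: fin => h _ _; apply: h => //; exact: (wf_size w lt).
Qed.

Lemma committed_key t i : (t, i) \in o -> store_at s t i -> exists k, gco s t i = Some k.
Proof. by move=> h; apply: (i_Cco I); apply: committed. Qed.

Lemma nx t i : (t, i) \in o -> (t, i) <> (size P, 0).
Proof. by rewrite (en_mem E) => /(wf_size w) h [h']; rewrite h' ltnn in h. Qed.

Lemma nthF t i : i < size (F t) -> cmd_at s t i = Some (i_cmd (nth (dflt Reg d0) (F t) i)).
Proof. by move=> lt; rewrite /cmd_at /ins_at (nth_map (dflt Reg d0)). Qed.

(** The inequality leaves room for an instruction that is fetched but not yet counted as executed.
    That [p] is closed under reading comes from the [src] edges. *)
Lemma pre_xe p q B : o = p ++ q ->
  (forall t, exists2 n, cnt p t <= n & rF (rt B t) = take n (F t)) ->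
  (forall t i, (t, i) \in p -> rL (rt B t) i = rL (rt s t) i) ->
  xe s B (fun t j => (t, j) \in p).
Proof.
move=> Eo hF hL; have E' := E; rewrite Eo in E'.
split.
- by move=> t i j; rewrite !(cntP _ _ E') => h lt; apply: ltn_trans h.
- move=> t i hp; have h := hp; rewrite (cntP _ _ E') in h.
  have [n le hn] := hF t.
  apply: esym; apply: (cmd_at_prefix (q := drop n (F t))).
    by rewrite hn cat_take_drop.
  rewrite hn size_take; case: (ltnP n) => _; first exact: leq_trans le.
  by have := en_mem E t i; rewrite Eo mem_cat hp => <-.
- by move=> t i l h; rewrite hL.
- move=> t i t' i' h El; have [_ _ [a [_ [st _ _] _]]] := i_rL I El.
  have ho : (t, i) \in o by rewrite Eo mem_cat h.
  have ho' : (t', i') \in o.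
    by have [e1 [e2 hc]] := store_atE st; rewrite (en_mem E); apply: cmd_at_lt hc.
  have := r_src R El (nx ho) (nx ho'); rewrite (mem_pre p q) in h.
  by rewrite (mem_pre p q) -Eo => lt; rewrite -Eo in h; apply: ltn_trans h.
Qed.

Lemma props_run S ts t i a k : uniq ts -> all (fun t' => t' < size P) ts -> t < size P ->
  store_at S t i -> rC (rt S t) i -> gco S t i = Some k -> addr_val d0 S t i a ->
  (forall t', t' \in ts -> exists2 k0, keyof S (gprop S t' a) = Some k0 & (k0 < k)%R) ->
  exists S', [/\ run d0 P S [seq EvProp Reg t' t i a | t' <- ts] S', rt S' = rt S, gco S' = gco S &
    forall t' a', gprop S' t' a' = if (t' \in ts) && (a' == a) then SStore D t i else gprop S t' a'].
Proof.
elim: ts S => [|t1 ts IH] S; first by move=> *; exists S; split=> //; apply: run_nil.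
move=> /= /andP[n1 u] /andP[lt1 al] lt st hC ek av hk.
set S1 := {| rt := rt S; gco := gco S;
         gprop := fun t'' a' => if (t'' == t1) && (a' == a) then SStore D t i else gprop S t'' a' |}.
have [k0 e0 l0] := hk t1 (mem_head _ _).
have st1 : step d0 P S (EvProp Reg t1 t i a) S1 by apply: st_prop ek av e0 l0.
have M : same S S1 by [].
have [|t' ht'|S' [h1 h2 h3 h4]] := IH S1 u al lt _ hC ek (same_addr M av).
- by rewrite (same_store _ _ M).
- have [k1 e1 l1] := hk t' (mem_behead (s := t1 :: ts) ht').
  exists k1 => //=; case: eqP => [?|_] //=; by subst t'; rewrite ht' in n1.
exists S'; split=> //; first exact: run_cons st1 h1.
move=> t' a'; rewrite h4 inE /=.
by case: (t' \in ts); case: (t' == t1); case: (a' == a).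
Qed.

(** The [co] edges make the key of a store the largest so far at its address, so it can be
    propagated to all threads at once. For a load, the [src] edge puts the store it read into [o1]
    and the [cf] edges keep larger ones out, so this store is what memory shows. *)
Lemma executed_step o1 t i o2 S : o = o1 ++ (t, i) :: o2 -> executed o1 S ->
  exists blk S', [/\ sc_block P t i blk, run d0 P S blk S', executed (rcons o1 (t, i)) S',
    commit_store_then_prop blk & forall t', count (is_fetch_of t') blk = (t == t')].
Proof.
move=> Eo HQ; have E1 := E; rewrite Eo in E1.
have Eo' : o = rcons o1 (t, i) ++ o2 by rewrite cat_rcons.
have E2 := E; rewrite Eo' in E2.
have ci := cnt_next E1.
have ho : (t, i) \in o by rewrite Eo mem_cat mem_head orbT.
have no1 : (t, i) \notin o1 by rewrite (cntP _ _ E1) ci ltnn.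
have io1 : index (t, i) o = size o1 by rewrite Eo index_cat (negPf no1) /= eqxx addn0.
have lti : i < size (F t) by rewrite -(en_mem E).
have ltt := wf_size w lti.
have hCs := committed ho; have [_ ck] := i_C I hCs.
set ins := nth (dflt Reg d0) (F t) i.
have cm : cmd_at s t i = Some (i_cmd ins) := nthF lti.
set A := upd_rt S t {| rF := rcons (rF (rt S t)) ins; rC := rC (rt S t); rL := rL (rt S t) |}.
have rFA t' : rF (rt A t') = take (cnt (rcons o1 (t, i)) t') (F t').
  rewrite -cats1 cnt_cat /cnt /= addn0 (eq_sym t) -/(cnt o1 t').
  case: (t' =P t) => [->|_]; last by rewrite addn0 (q_F HQ).
  by rewrite /= (q_F HQ) addn1 ci (take_nth (dflt Reg d0)).
have rCA t' j : rC (rt A t') j = ((t', j) \in o1) by rewrite /=; case: eqP => [->|_]; rewrite /= (q_C HQ).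
have rLA t' j : rL (rt A t') j = if (t', j) \in o1 then rL (rt s t') j else None.
  by rewrite /=; case: eqP => [->|_]; rewrite /= (q_L HQ).
have stA : step d0 P S (EvFetch t ins) A.
  have eF : F t = take i (F t) ++ ins :: drop i.+1 (F t) by rewrite -drop_nth // cat_take_drop.
  have [w1 w2 w3] := w eF.
  by apply: st_fetch => //; rewrite (q_F HQ) ci.
have key_lt t' i' k k' a : (t', i') \in o1 -> gco s t' i' = Some k' -> gco s t i = Some k ->
    addr_val d0 s t' i' a -> addr_val d0 s t i a -> (k' < k)%R.
  move=> h1 ek' ek av' av; have ho' : (t', i') \in o by rewrite Eo mem_cat h1.
  rewrite ltNge le_eqVlt; apply/negP => /orP[/eqP ?|lk].
    by subst k'; move: no1; rewrite (i_inj I ek ek') h1.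
  have := r_co R ek ek' av av' lk (nx ho) (nx ho').
  by rewrite io1 => h; move: h1; rewrite (mem_pre o1 ((t, i) :: o2)) -Eo => h1; move: (ltn_trans h h1); rewrite ltnn.
have in2 y : (y \in rcons o1 (t, i)) = (y == (t, i)) || (y \in o1) by rewrite mem_rcons inE.
have Bok B : (forall t', rF (rt B t') = rF (rt A t')) -> (forall t' j, rC (rt B t') j = rC (rt A t') j) ->
    (forall t' j, rL (rt B t') j = if (t', j) \in rcons o1 (t, i) then rL (rt s t') j else None) ->
    [/\ commit_ok d0 B t i, store_at B t i = store_at s t i &
        xe s B (fun t' j => (t', j) \in rcons o1 (t, i))].
  move=> hF hC hL.
  have X : xe s B (fun t' j => (t', j) \in rcons o1 (t, i)).
    apply: (pre_xe Eo') => [t'|t' j h].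
      by exists (cnt (rcons o1 (t, i)) t'); rewrite // hF rFA.
    by rewrite hL h.
  have d : (t, i) \in rcons o1 (t, i) by rewrite in2 eqxx.
  have sB := xf_store X d; split=> //.
  apply/commit_okE; split; first by rewrite hC rCA.
  apply: (xe_cok X) d ck => j lj _; rewrite hC rCA.
  by rewrite (cntP _ _ E1) ci.
have nonload : ~~ load_at s t i -> forall t' j,
    rL (rt A t') j = if (t', j) \in rcons o1 (t, i) then rL (rt s t') j else None.
  move=> nl t' j; rewrite rLA in2; case: eqP => [[-> ->]|_] //=; rewrite (negPf no1).
  by case El: (rL _ _) => [l|//]; have [_ h _] := i_rL I El; rewrite h in nl.
(* The common end of all blocks but those of stores: the commit, from a state in which the read of a
   load has been performed. *)
have Qns B1 : ~~ store_at s t i -> (forall t', rF (rt B1 t') = rF (rt A t')) ->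
    (forall t' j, rC (rt B1 t') j = rC (rt A t') j) ->
    (forall t' j, rL (rt B1 t') j = if (t', j) \in rcons o1 (t, i) then rL (rt s t') j else None) ->
    gco B1 = gco S -> gprop B1 = gprop S ->
    run d0 P B1 [:: EvCommit D Reg t i] (upd_rt B1 t (Defs.setC (rt B1 t) i)) /\
    executed (rcons o1 (t, i)) (upd_rt B1 t (Defs.setC (rt B1 t) i)).
  move=> ns hF hC hL hco hgp; have [cB stB _] := Bok B1 hF hC hL.
  split; first by apply: run1; apply: st_commit => //; rewrite stB.
  have nk : gco s t i = None.
    by case ek: (gco s t i) => [k|//]; have [_ _ h _ _] := i_co I ek; rewrite h in ns.
  split.
  - by move=> t' /=; rewrite -rFA -hF; case: eqP => [->|].
  - move=> t' j; rewrite in2 xpair_eqE; transitivity ((t' == t) && (j == i) || rC (rt B1 t') j).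
      by rewrite /=; case: eqP => [->|].
    by rewrite hC rCA.
  - by move=> t' j; rewrite -hL /=; case: eqP => [->|].
  - move=> t' j; rewrite /= hco (q_co HQ) in2; case: eqP => [[-> ->]|] //=.
    by rewrite (negPf no1) nk.
  - by move=> t' a b /=; rewrite hgp; apply: (q_gp HQ).
  - move=> t' a t1 i1 h /=; rewrite hgp => /(q_gp2 HQ h)[h1 h2]; by rewrite in2 h1 orbT.
  - move=> t' a h; have [k0 e0 m0] := q_max HQ a h; exists k0; first by rewrite /= hgp.
    move=> t1 i1 k1; rewrite in2 => /orP[/eqP[-> ->]|]; [by rewrite nk|exact: m0].
have nstc (c : cmd D Reg) : i_cmd ins = c -> store_at s t i = is_store c /\ load_at s t i = is_load c.
  by move=> Ec; rewrite /store_at /load_at cm Ec.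
have addr_ex : has_addr s t i -> exists a, addr_val d0 s t i a := cok_addr ck.
have addrB B a : xe s B (fun t j => (t, j) \in o1) -> cmd_at B t i = cmd_at s t i ->
    addr_val d0 s t i a -> addr_val d0 B t i a.
  move=> X eB [c [e [h1 [h2 h3]]]]; exists c, e; split; first by rewrite eB.
  split=> //; apply: (xf_eval X) h3 => j lj; by rewrite (cntP _ _ E1) ci.
have cmA : cmd_at A t i = cmd_at s t i.
  apply: esym; apply: (cmd_at_prefix (q := drop (cnt (rcons o1 (t, i)) t) (F t))).
    by rewrite rFA cat_take_drop.
  by rewrite /= eqxx /= size_rcons (q_F HQ) ci size_take lti.
have XA : xe s A (fun t' j => (t', j) \in o1).
  apply: (pre_xe Eo) => [t'|t' j h]; last by rewrite rLA h.
  exists (cnt (rcons o1 (t, i)) t'); last exact: rFA.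
  by rewrite -cats1 cnt_cat leq_addr.
have nonmem : ~~ store_at s t i -> ~~ load_at s t i -> sc_block P t i [:: EvFetch t ins; EvCommit D Reg t i] ->
    exists blk S', [/\ sc_block P t i blk, run d0 P S blk S', executed (rcons o1 (t, i)) S',
      commit_store_then_prop blk & forall t', count (is_fetch_of t') blk = (t == t')].
  move=> ns nl hb; have [hr HQ'] := Qns A ns (fun _ => erefl) (fun _ _ => erefl) (nonload nl) erefl erefl.
  exists [:: EvFetch t ins; EvCommit D Reg t i]; eexists; split; last 1 first.
  - by move=> t' /=; rewrite ?addn0.
  - exact: hb.
  - exact: run_cons stA hr.
  - exact: HQ'.
  - by move=> [|[|n]] t1 i1 k1 a1; rewrite /ev_at //= nth_nil.
case Ei: (i_cmd ins) => [r e|e1 e2|r e|e]; have [st0 ld0] := nstc _ Ei.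
- have cmL := cm; rewrite Ei in cmL.
  have [a av] := addr_ex (load_has_addr ld0).
  have [l El] : exists l, rL (rt s t) i = Some l.
    by have := cok_load ck ld0; case: (rL _ _) => [l|//]; exists l.
  have eg : gprop A t a = l.
    have [_ _ [b [avb hm _]]] := i_rL I El; have ? := addr_det av avb; subst b.
    have [k0 e0 m0] := q_max HQ a ltt.
    have cf t' i' k' kl : (t', i') \in o1 -> gco s t' i' = Some k' -> addr_val d0 s t' i' a ->
        keyof s l = Some kl -> (kl < k')%R -> False.
      move=> h1 ek' av' ekl lk; have ho' : (t', i') \in o by rewrite Eo mem_cat h1.
      have := r_cf R El av ekl ek' av' lk (nx ho) (nx ho').
      rewrite io1 => h; move: h1; rewrite (mem_pre o1 ((t, i) :: o2)) -Eo => h1.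
      by move: (ltn_trans h h1); rewrite ltnn.
    rewrite /=; case Eg: (gprop S t a) => [b|t1 i1].
      have ? := q_gp HQ ltt Eg; subst b; case: l El hm cf => [b|t2 i2] El hm cf; first by rewrite hm.
      have [st2 av2 _] := hm.
      have ho2 : (t2, i2) \in o.
        by have [c1 [c2 hc]] := store_atE st2; rewrite (en_mem E); apply: cmd_at_lt hc.
      have [k2 ek2] := committed_key ho2 st2.
      have h2 : (t2, i2) \in o1.
        have := r_src R El (nx ho) (nx ho2); by rewrite io1 (mem_pre o1 ((t, i) :: o2)) -Eo.
      have := m0 _ _ _ h2 ek2 av2; move: e0; rewrite Eg => -[<-] le.
      have [_ _ _ kp _] := i_co I ek2; by move: (lt_le_trans kp le); rewrite ltxx.
    have [h1 av1] := q_gp2 HQ ltt Eg; move: e0; rewrite Eg /= => e0.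
    case: l El hm cf => [b|t2 i2] El hm cf.
      have [_ _ _ kp _] := i_co I e0; by case: (cf _ _ _ 0%R h1 e0 av1).
    have [st2 av2 _] := hm.
    have ho2 : (t2, i2) \in o.
      by have [c1 [c2 hc]] := store_atE st2; rewrite (en_mem E); apply: cmd_at_lt hc.
    have [k2 ek2] := committed_key ho2 st2.
    have h2 : (t2, i2) \in o1.
      have := r_src R El (nx ho) (nx ho2); by rewrite io1 (mem_pre o1 ((t, i) :: o2)) -Eo.
    have := m0 _ _ _ h2 ek2 av2; rewrite le_eqVlt => /orP[/eqP ?|lk].
      by subst k2; have [-> ->] := i_inj I ek2 e0.
    by case: (cf _ _ _ _ h1 e0 av1 ek2 lk).
  set B := upd_rt A t (setL (rt A t) i (Some l)).
  have stB : step d0 P A (EvLoad Reg t i a) B.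
    rewrite /B -eg; apply: (st_load_mem (r := r) (e := e)) => //.
    + by rewrite cmA cmL.
    + by rewrite rLA (negPf no1).
    + exact: addrB.
  have rLB t' j : rL (rt B t') j = if (t', j) \in rcons o1 (t, i) then rL (rt s t') j else None.
    rewrite in2 xpair_eqE.
    transitivity (if (t' == t) && (j == i) then Some l else rL (rt A t') j).
      by rewrite [in LHS]/=; case: (t' =P t) => [->|/eqP/negPf h] /=; rewrite ?eqxx ?h.
    by rewrite rLA; case: eqP => [->|_] //=; case: eqP => [->|_] //=; rewrite El.
  have [|||hr HQ'] := Qns B _ _ _ rLB erefl erefl; first by rewrite st0.
  - by move=> t'; rewrite [in LHS]/=; case: (t' =P t) => [->|/eqP/negPf h] /=; rewrite ?eqxx ?h.
    by move=> t' j; rewrite [in LHS]/=; case: (t' =P t) => [->|/eqP/negPf h] /=; rewrite ?eqxx ?h.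
  exists [:: EvFetch t ins; EvLoad Reg t i a; EvCommit D Reg t i].
  exists (upd_rt B t (Defs.setC (rt B t) i)); split=> //.
  + by exists ins; rewrite Ei; exists a.
  + exact: run_cons stA (run_cons stB hr).
  + by move=> [|[|[|n]]] t1 i1 k1 a1; rewrite /ev_at //= nth_nil.
  + by move=> t' /=; rewrite ?addn0.
- have [a av] := addr_ex (store_has_addr st0).
  have [k ek] := committed_key ho st0.
  have [_ _ _ kp _] := i_co I ek.
  have [cA stA' _] := Bok A (fun _ => erefl) (fun _ _ => erefl) (nonload (negbT ld0)).
  set B := {| rt := fun t' => if t' == t then Defs.setC (rt A t) i else rt A t';
         gco := fun t' i' => if (t' == t) && (i' == i) then Some k else gco A t' i';
         gprop := gprop A |}.
  have avA : addr_val d0 A t i a by apply: addrB.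
  have stB : step d0 P A (EvCommitSt Reg t i k a) B.
    apply: st_commit_store => //; first by rewrite stA' st0.
      by move=> ?; subst k; rewrite ltxx in kp.
    move=> t1 i1 /=; rewrite (q_co HQ); case: ifP => // h1 ek1.
    by have h := i_inj I ek1 ek; rewrite h in h1; rewrite h1 in no1.
  have rCB t' j : rC (rt B t') j = ((t', j) \in rcons o1 (t, i)).
    rewrite in2 xpair_eqE; transitivity ((t' == t) && (j == i) || rC (rt A t') j).
      by rewrite [in LHS]/=; case: (t' =P t) => [->|/eqP/negPf h] /=; rewrite ?eqxx ?h.
    by rewrite rCA.
  have rFB t' : rF (rt B t') = rF (rt A t') by rewrite [in LHS]/=; case: (t' =P t) => [->|/eqP/negPf h] /=; rewrite ?eqxx ?h.
  have rLB t' j : rL (rt B t') j = rL (rt A t') j by rewrite [in LHS]/=; case: (t' =P t) => [->|/eqP/negPf h] /=; rewrite ?eqxx ?h.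
  have XB : xe A B (fun _ _ => True).
    split=> //; first by move=> t1 i1 _; apply: cmd_at_eqF; rewrite rFB.
    by move=> t1 i1 l _; rewrite rLB.
  set ts := t :: [seq t' <- iota 0 (size P) | t' != t].
  have pts : perm_eq ts (iota 0 (size P)).
    apply: uniq_perm; first by rewrite /= mem_filter eqxx /= filter_uniq // iota_uniq.
      exact: iota_uniq.
    move=> t'; rewrite inE mem_filter mem_iota /= add0n; case: (t' =P t) => [->|_] //=.
  have mts t' : (t' \in ts) = (t' < size P) by rewrite (perm_mem pts) mem_iota add0n.
  have kgp t' : t' < size P -> exists2 k0, keyof s (gprop S t' a) = Some k0 & (k0 < k)%R.
    move=> lt'; have [k0 e0 _] := q_max HQ a lt'; exists k0 => //.
    case Eg: (gprop S t' a) => [b|t1 i1] in e0; first by move: e0 => [<-].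
    have [h1 av1] := q_gp2 HQ lt' Eg; exact: key_lt h1 e0 ek av1 av.
  have [|||||||t' ht'|S' [hr1 hr2 hr3 hr4]] := @props_run B ts t i a k.
  + by rewrite (perm_uniq pts) iota_uniq.
  + by apply/allP => t'; rewrite mts.
  + exact: ltt.
  + by rewrite (xf_store XB) // stA' st0.
  + by rewrite rCB in2 eqxx.
  + by rewrite /= !eqxx.
  + exact: (xf_addr XB).
  + rewrite mts in ht'; have [k0 e0 l0] := kgp t' ht'; exists k0 => //.
    rewrite [gprop _ _ _]/=; case Eg: (gprop S t' a) => [b|t1 i1] in e0 *; first by [].
    have [h1 _] := q_gp2 HQ ht' Eg.
    rewrite /= (q_co HQ) h1; case: ifP => [/andP[/eqP ? /eqP ?]|//]; subst.
    by rewrite h1 in no1.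
  exists (EvFetch t ins :: EvCommitSt Reg t i k a :: [seq EvProp Reg t'' t i a | t'' <- ts]).
  exists S'; split.
  + by exists ins; rewrite Ei; exists k, a, ts.
  + exact: run_cons stA (run_cons stB hr1).
  + split.
    * by move=> t'; rewrite hr2 rFB rFA.
    * by move=> t' j; rewrite hr2 rCB.
    * by move=> t' j; rewrite hr2 rLB nonload // ld0.
    * move=> t' j; rewrite hr3 /= in2 xpair_eqE (q_co HQ).
      by case: eqP => [->|_] //=; case: eqP => [->|_] //=; rewrite ek.
    * move=> t' a' b lt'; rewrite hr4; case: ifP => // _; exact: (q_gp HQ).
    * move=> t' a' t1 i1 lt'; rewrite hr4 in2; case: ifP => [/andP[_ /eqP ->] [<- <-]|_ /(q_gp2 HQ lt')[h1 h2]].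
        by rewrite eqxx.
      by rewrite h1 orbT.
    * move=> t' a' lt'; rewrite hr4 mts lt' /=; case: (a' =P a) => [->|ne].
        exists k => // t1 i1 k1; rewrite in2 => /orP[/eqP[-> ->]|h1] ek1 av1.
          by move: ek1; rewrite ek => -[->].
        exact: ltW (key_lt _ _ _ _ _ h1 ek1 ek av1 av).
      have [k0 e0 m0] := q_max HQ a' lt'; exists k0 => // t1 i1 k1.
      rewrite in2 => /orP[/eqP[-> ->]|h1]; last exact: m0.
      by move=> _ av1; case: ne; apply: addr_det av1 av.
  + have cspP ts' : commit_store_then_prop [seq EvProp Reg t'' t i a | t'' <- ts'].
      by elim: ts' => [|x xs IHx] [|n] t1 i1 k1 a1 //; apply: IHx.
    apply: (@csp_cat _ _ [:: EvFetch t ins; EvCommitSt Reg t i k a; EvProp Reg t t i a]); last exact: cspP.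
    by move=> [|[|[|n]]] t1 i1 k1 a1; rewrite /ev_at //= ?nth_nil // => -[-> -> _ ->].
  + move=> t' /=; rewrite ?add0n; have -> ts' : count (is_fetch_of t') [seq EvProp Reg t'' t i a | t'' <- ts'] = 0.
      by elim: ts'.
    by rewrite !addn0.
- by apply: nonmem; rewrite ?st0 ?ld0 //; exists ins; rewrite Ei.
- by apply: nonmem; rewrite ?st0 ?ld0 //; exists ins; rewrite Ei.
Qed.

Lemma sc_exists : exists evs s', sc_run d0 P evs s' /\ trace_eq (trace_of d0 P s) (trace_of d0 P s').
Proof.
have H p q : o = p ++ q -> exists bs S, [/\ run d0 P (init_state D Reg) (flatten bs) S, executed p S,
    commit_store_then_prop (flatten bs), forall t, count (is_fetch_of t) (flatten bs) = cnt p t &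
    forall n, n < size bs -> exists t,
      sc_block P t (count (is_fetch_of t) (flatten (take n bs))) (nth [::] bs n)].
  elim/last_ind: p q => [|p [t i] IH] q Eo.
    exists [::], (init_state D Reg); split=> //; [exact: run_nil|exact: executed0|].
    by move=> n t i k a; rewrite /ev_at nth_nil.
  rewrite cat_rcons in Eo; have [bs [S [h1 h2 h3 h4 h5]]] := IH _ Eo.
  have [blk [S' [b1 b2 b3 b4 b5]]] := executed_step Eo h2.
  have E1 := E; rewrite Eo in E1.
  exists (rcons bs blk), S'; split=> //.
  - by rewrite flatten_rcons; apply/run_cat; exists S.
  - by rewrite flatten_rcons; apply: csp_cat.
  - by move=> t'; rewrite flatten_rcons count_cat h4 b5 -cats1 cnt_cat /cnt /= addn0.
  - move=> n; rewrite size_rcons ltnS leq_eqVlt => /orP[/eqP ->|lt].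
      exists t; rewrite nth_rcons ltnn eqxx -cats1 take_size_cat // h4.
      by rewrite (cnt_next E1).
    have [t' ht'] := h5 _ lt; exists t'; by rewrite nth_rcons lt -cats1 takel_cat // ltnW.
have [bs [S [h1 h2 h3 h4 h5]]] := H o [::] (esym (cats0 o)).
have M : same s S.
  split.
  - by move=> t; rewrite (q_F h2) (cnt_full _ E) take_size.
  - move=> t i; rewrite (q_C h2) (en_mem E); apply/idP/idP.
      by rewrite -(en_mem E); apply: committed.
    by move=> /(i_C I)[_ []].
  - move=> t i; rewrite (q_L h2) (en_mem E); case: ifP => // h.
    case El: (rL _ _) => [l|//]; have [_ /load_atE[r [e hc]] _] := i_rL I El.
    by have := cmd_at_lt hc; rewrite h.
  - move=> t i; rewrite (q_co h2) (en_mem E); case: ifP => // h.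
    case ek: (gco _ _) => [k|//]; have [_ _ /store_atE[e1 [e2 hc]] _ _] := i_co I ek.
    by have := cmd_at_lt hc; rewrite h.
exists (flatten bs), S; split; last exact: same_trace M.
split; last by exists bs.
by split=> //; apply: same_final fin.
Qed.

End SC.

(** * SC computations have acyclic happens-before *)

Section SCAcyclic.
Variables (D Reg : finType) (d0 : D) (P : program D Reg).
Implicit Types (S T : gstate D Reg) (t i j : nat) (o : seq (nat * nat)).
Local Notation macros := (pmap (@macro D Reg)).

Lemma run_size S evs s t : run d0 P S evs s ->
  size (rF (rt s t)) = size (rF (rt S t)) + count (is_fetch_of t) evs.
Proof.
elim=> [{}S|{}S e S1 {}evs s2 st _ ->] /=; first by rewrite addn0.
rewrite addnA; congr (_ + _); inversion st; subst => /=; rewrite ?addn0 ?(eq_sym t) //;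
  case: eqP => [->|] //=; rewrite ?size_rcons ?addn1 ?addn0 //.
Qed.

Definition propagates_all (ms : seq (mev D)) t i k a : Prop :=
  MCommitSt t i k a \in ms -> forall t', t' < size P ->
  exists f, [/\ f \in ms, propto f t' a & inst f = (t, i)].

Lemma block_macros t i blk : sc_block P t i blk ->
  [/\ forall m, m \in macros blk -> inst m = (t, i),
      forall t', count (is_fetch_of t') blk = (t == t') &
      forall t1 i1 k a, propagates_all (macros blk) t1 i1 k a].
Proof.
move=> [ins]; case: (i_cmd ins) => [r e|e1 e2|r e|e].
- move=> [a ->]; split=> [m|t'|t1 i1 k a1] /=; rewrite ?addn0 //.
  by rewrite !inE => /orP[] /eqP ->.
- move=> [k [a [ts [pts _ ->]]]].
  have mts t' : (t' \in ts) = (t' < size P) by rewrite (perm_mem pts) mem_iota add0n.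
  have mem : macros [seq EvProp Reg t'' t i a | t'' <- ts] = [seq MProp t' t i a | t' <- ts & t' != t].
    by elim: ts {pts mts} => //= t' ts ->; case: eqP.
  split=> [m|t'|t1 i1 k1 a1].
  + by rewrite /= mem inE => /orP[/eqP->//|/mapP[t' _ ->]].
  + rewrite /=; have -> ts' : count (is_fetch_of t') [seq EvProp Reg t'' t i a | t'' <- ts'] = 0 by elim: ts'.
    by rewrite !addn0.
  + rewrite /propagates_all /= mem inE => /orP[/eqP[-> -> _ ->]|/mapP[] //] t' lt'.
    case: (eqVneq t' t) => [->|ne].
      by exists (MCommitSt t i k a); rewrite /= inE !eqxx.
    exists (MProp t' t i a); rewrite /= inE !eqxx; split=> //.
    by apply: map_f; rewrite mem_filter ne mts.
all: move=> ->; split=> [m|t'|t1 i1 k a1] /=; rewrite ?addn0 //.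
all: by rewrite inE => /eqP ->.
Qed.

(** Extracts the order of the blocks. The lists of dummy instructions serve only for their lengths,
    all that [enumr] depends on; the true instructions enter later. *)
Lemma sc_order (bs : seq (seq (event D Reg))) :
  (forall n, n < size bs -> exists t,
     sc_block P t (count (is_fetch_of t) (flatten (take n bs))) (nth [::] bs n)) ->
  exists o, [/\ enumr (fun t => nseq (cnt o t) (dflt Reg d0)) o,
    forall t, cnt o t = count (is_fetch_of t) (flatten bs),
    forall m, m \in macros (flatten bs) -> inst m \in o,
    sorted leq [seq index (inst m) o | m <- macros (flatten bs)] &
    forall t i k a, propagates_all (macros (flatten bs)) t i k a].
Proof.
elim/last_ind: bs => [|bs blk IH] hb.
  by exists [::]; split=> //; split=> // t i; rewrite size_nseq.
have [|o [Eo hc hm hs hp]] := IH.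
  move=> n lt; have [|t] := hb n; first by rewrite size_rcons ltnW.
  by rewrite nth_rcons lt -cats1 takel_cat 1?ltnW //; exists t.
have [|t] := hb (size bs); first by rewrite size_rcons.
rewrite nth_rcons ltnn eqxx -cats1 take_size_cat // -hc.
set i := cnt o t => /block_macros[b1 b2 b3].
have mo t' j : ((t', j) \in o) = (j < cnt o t') by rewrite (en_mem Eo) size_nseq.
have ny : (t, i) \notin o by rewrite mo ltnn.
have idx y : y \in o -> index y (rcons o (t, i)) = index y o by move=> h; rewrite -cats1 index_cat h.
have idy : index (t, i) (rcons o (t, i)) = size o.
  by rewrite -cats1 index_cat (negPf ny) /= eqxx addn0.
have hc' t' : cnt (rcons o (t, i)) t' = cnt o t' + (t == t').
  by rewrite -cats1 cnt_cat /cnt /= addn0.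
have mem' t' j : ((t', j) \in rcons o (t, i)) = (j < cnt (rcons o (t, i)) t').
  rewrite mem_rcons inE mo hc' xpair_eqE (eq_sym t'); case: eqP => [<-|] /=; last by rewrite addn0.
  by rewrite addn1 ltnS [in RHS]leq_eqVlt.
exists (rcons o (t, i)); rewrite flatten_cat /= cats0 pmap_cat; split.
- split; first by rewrite rcons_uniq ny (en_uniq Eo).
    by move=> t' j; rewrite size_nseq.
  move=> t' j j' lt; rewrite size_nseq -mem' mem_rcons inE => /orP[/eqP[? ?]|h].
    by subst t' j'; rewrite idy idx ?mo // index_mem mo.
  have h' := h; rewrite mo in h'.
  by rewrite !idx ?mo ?(ltn_trans lt) //; apply: (en_po Eo) => //; rewrite size_nseq.
- by move=> t'; rewrite hc' hc count_cat b2.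
- by move=> m; rewrite mem_cat mem_rcons inE => /orP[/hm ->|/b1 ->]; rewrite ?eqxx ?orbT.
- rewrite map_cat (sorted_pairwise leq_trans) pairwise_cat -!(sorted_pairwise leq_trans).
  have l1 z : z \in [seq index (inst m) (rcons o (t, i)) | m <- macros (flatten bs)] -> z <= size o.
    by move=> /mapP[m /hm h ->]; rewrite idx // ltnW // index_mem.
  have l2 z : z \in [seq index (inst m) (rcons o (t, i)) | m <- macros blk] -> z = size o.
    by move=> /mapP[m /b1 h ->]; rewrite h idy.
  apply/and3P; split.
  + by apply/allrelP => a b /l1 ha /l2 ->.
  + have /eq_in_map -> // : {in macros (flatten bs), (fun m => index (inst m) (rcons o (t, i))) =1 (fun m => index (inst m) o)}.
    by move=> m /hm /idx.
  + rewrite (sorted_pairwise leq_trans); apply/(pairwiseP 0) => a b ha hb' _.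
    by rewrite (l2 _ (mem_nth 0 ha)) (l2 _ (mem_nth 0 hb')).
- move=> t1 i1 k a; rewrite /propagates_all mem_cat => /orP[/hp|/b3] h t' /h[f [h1 h2 h3]];
    by exists f; rewrite mem_cat h1 ?orbT.
Qed.

(** The block order is a ranking. Were a [co] or [cf] edge directed against it, the newer store
    would already have been propagated to every thread when the older one commits or when the load
    reads, and the keys would contradict this. *)
Lemma sc_acyclic evs s : sc_run d0 P evs s -> ~ hb_cyclic (trace_of d0 P s).
Proof.
move=> [pr [bs [Eb hb]]]; have [w hm fin] := power_comp pr; have [hr _ _] := pr.
have [o [Eo hc hin hs hp]] := sc_order hb; rewrite Eb in hc hin hs hp.
set F := fun t => rF (rt s t) in w hm; set nf := macros evs in hm hin hs hp.
have I := reach_inv hm.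
have sizeF t : size (F t) = cnt o t by rewrite hc /F (run_size _ hr).
have mo t i : ((t, i) \in o) = (i < size (F t)) by rewrite (en_mem Eo) size_nseq sizeF.
pose rk y := index y o.
have before E e E2 f : nf = E ++ e :: E2 -> f \in nf -> rk (inst f) < rk (inst e) -> f \in E.
  move=> En; rewrite En mem_cat => /orP[//|hf] lt; move: hs; rewrite En map_cat => /cat_sorted2[_] /=.
  move=> /(order_path_min leq_trans)/allP h; move: hf; rewrite inE => /orP[/eqP Ef|hf].
    by rewrite Ef ltnn in lt.
  by have := h _ (map_f (fun m => index (inst m) o) hf); rewrite leqNgt lt.
have after E e E2 f : nf = E ++ e :: E2 -> f \in E -> rk (inst f) <= rk (inst e).
  move=> En hf; move: hs; rewrite En map_cat (sorted_pairwise leq_trans) pairwise_cat => /and3P[/allrelP h _ _].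
  by apply: h; [exact: (map_f (fun m => index (inst m) o) hf)|rewrite /= mem_head].
have inj t i t' i' : i < size (F t) -> rk (t, i) = rk (t', i') -> (t, i) = (t', i').
  rewrite -mo => h E; have h' : (t', i') \in o by rewrite -index_mem -/(rk _) -E index_mem.
  by rewrite -(nth_index (t, i) h) -(nth_index (t, i) h') -/(rk _) E.
have store_prop t i k a t' : gco s t i = Some k -> addr_val d0 s t i a -> t' < size P ->
    exists f, [/\ f \in nf, propto f t' a & inst f = (t, i)].
  move=> ek av lt'; have [b hbm] := hist_gco hm ek; have [_ avb] := hist_commit hm hbm.
  by rewrite -(addr_det av avb) in hbm; apply: hp hbm _ lt'.
have st_in t i : store_at s t i -> i < size (F t) by move=> /store_atE[e1 [e2 h]]; apply: cmd_at_lt h.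
have ld_st t i : load_at s t i -> ~~ store_at s t i by rewrite /load_at /store_at; case: cmd_at => // -[].
have split_nf e : e \in nf -> exists E E2 S l, [/\ nf = E ++ e :: E2, mrun d0 P (full F) E S,
    enabled d0 P S e l, ext S (upd S e l) & ext (upd S e l) s].
  move=> he; have [E [E2 En]] : exists E E2, nf = E ++ e :: E2 by case/splitPr: he => E E2; exists E, E2.
  have := hm; rewrite En => /mrun_cat[S h1 h2]; inversion h2 as [|? ? l ? ? hen h3]; subst.
  exists E, E2, S, l; split=> //; first exact: en_ext (reach_inv h1) hen.
  exact: mrun_ext h3 (inv_en (reach_inv h1) hen).
have load_read t j l : rL (rt s t) j = Some l -> exists E e E2 S a,
    [/\ nf = E ++ e :: E2 /\ inst e = (t, j), mrun d0 P (full F) E S, ext S s, addr_val d0 S t j a & l = gprop S t a].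
  move=> El; have /hasP[e he ie] : has (fun e => isld e t j) nf by rewrite -(hist_rL _ _ hm) El.
  have [E [E2 [S [l1 [En hE hen X1 X2]]]]] := split_nf e he.
  have : rL (rt (upd S e l1) t) j = Some l1 by rewrite /= ie.
  move=> /(ext_L X2); rewrite El => -[?]; subst l1.
  have ei := isldP ie; have X := ext_trans X1 X2.
  case: e ie hen he ei En X1 {X2} => //= t1 i1 a _ [lt ld _ av hl] he [? ?] En X1; subst t1 i1.
  exists E, (MLoad t j a), E2, S, a; split=> //.
  (* No early reads under SC: the block of an earlier store of the thread is finished, so this store
     is committed. *)
  case: hl => // -[i' Ei [m1 [m2 m2'] _ /negP[]]].
  have st := m2; rewrite -(ext_store _ _ X) in st; have lti := st_in _ _ st.
  have [k ek] : exists k, gco s t i' = Some k.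
    by apply: (i_Cco I) st; case: fin => h _ _; apply: h.
  have [b hb'] := hist_gco hm ek.
  have hE' : MCommitSt t i' k b \in E.
    apply: before En hb' _; apply: (en_po Eo) => //; rewrite size_nseq -sizeF.
    by have [r [ex hcm]] := load_atE ld; have := cmd_at_lt hcm; rewrite (mrun_F hE).
  by rewrite (hist_rC _ _ hE); apply/hasP; exists (MCommitSt t i' k b) => //=; rewrite !eqxx.
apply: (ranked_acyclic I w (rk := rk)); split.
- by move=> t i j lij ltj _ _; apply: (en_po Eo) => //; rewrite size_nseq -sizeF.
- move=> t j t' i' El _ _; have [E [e [E2 [S [a [[En ei] hE X _ Eg]]]]]] := load_read _ _ _ El.
  have [f [hf _ fi]] := hist_gprop hE (esym Eg).
  have le := after _ _ _ _ En hf; rewrite fi ei in le.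
  rewrite ltn_neqAle le andbT; apply/eqP => Er.
  have [_ ld [b [_ [st _ _] _]]] := i_rL I El.
  by have [? ?] := inj _ _ _ _ (st_in _ _ st) Er; subst t' i'; move: (ld_st _ _ ld); rewrite st.
- move=> t i t' i' a k k' ek ek' av av' lk _ _; rewrite ltnNge; apply/negP => le.
  have [_ _ st _ _] := i_co I ek; have [_ _ st' _ _] := i_co I ek'.
  have lt : rk (t', i') < rk (t, i).
    rewrite ltn_neqAle le andbT; apply/eqP => Er.
    have [? ?] := inj _ _ _ _ (st_in _ _ st') Er; subst t' i'.
    by move: ek'; rewrite ek => -[?]; subst k'; rewrite ltxx in lk.
  have [b hbm] := hist_gco hm ek; have [_ avb] := hist_commit hm hbm.
  have ? := addr_det av avb; subst b.
  have [E [E2 [S [l [En hE [ltt _ _ _ [_ [k0 e0 l0]]] X1 X2]]]]] := split_nf _ hbm.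
  have [f [hf pf fi]] := store_prop _ _ _ _ t ek' av' ltt.
  have hfE : f \in E by apply: before En hf _; rewrite fi.
  have [k1 [k2 [e1 e2 l2 _]]] := hist_prop hE hfE pf.
  rewrite fi /= in e1; move: (x_co (ext_trans X1 X2) e1); rewrite ek' => -[?]; subst k1.
  move: e2; rewrite e0 => -[?]; subst k2.
  by move: (lt_trans (le_lt_trans l2 l0) lk); rewrite ltxx.
- move=> t j t' i' a l k k' El av ekl ek' av' lk _ _; rewrite ltnNge; apply/negP => le.
  have [E [e [E2 [S [b [[En ei] hE X avb Eg]]]]]] := load_read _ _ _ El.
  have ? := addr_det av (ext_addr X avb); subst b.
  have [ltt ld _] := i_rL I El; have [_ _ st' _ _] := i_co I ek'.
  have lt : rk (t', i') < rk (t, j).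
    rewrite ltn_neqAle le andbT; apply/eqP => Er.
    by have [? ?] := inj _ _ _ _ (st_in _ _ st') Er; subst t' i'; move: (ld_st _ _ ld); rewrite st'.
  have [f [hf pf fi]] := store_prop _ _ _ _ t ek' av' ltt.
  have hfE : f \in E by apply: before En hf _; rewrite fi ei.
  have [k1 [k2 [e1 e2 l2 _]]] := hist_prop hE hfE pf.
  rewrite fi /= in e1; move: (x_co X e1); rewrite ek' => -[?]; subst k1.
  move: (ext_key X e2); rewrite -Eg ekl => -[?]; subst k2.
  by move: (lt_le_trans lk l2); rewrite ltxx.
Qed.

End SCAcyclic.

(** * Sorting lists and cutting them into classes *)

Lemma index_filter_lt (A : eqType) (p : pred A) (s : seq A) f e :
  p f -> p e -> index f s < index e s -> index f (filter p s) < index e (filter p s).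
Proof.
move=> pf pe; elim: s => //= a s IH.
case: (eqVneq a f) => [->|nf]; first by rewrite pf /= eqxx; case: eqP.
case: (eqVneq a e) => [//|ne]; rewrite ltnS => /IH h.
by case: ifP => //= _; rewrite (negPf nf) (negPf ne).
Qed.

(** Packs a lexicographic comparison into one of numbers, so that [sort] needs a single key. *)
Lemma lex2 M x x' y y' : x < x' -> y < M -> x * M + y < x' * M + y'.
Proof.
move=> lx ly; apply: (@leq_trans (x.+1 * M)); first by rewrite mulSn addnC ltn_add2r.
by apply: (leq_trans (leq_mul lx (leqnn M))); apply: leq_addr.
Qed.

Lemma flatten_classes (A : Type) (q : A -> nat) (s : seq A) m n :
  sorted leq (map q s) -> all (fun e => (m <= q e) && (q e < m + n)) s ->
  flatten [seq [seq e <- s | q e == p] | p <- iota m n] = s.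
Proof.
elim: n m s => [|n IH] m s so al.
  by case: s al {so} => //= e s; rewrite addn0 ltnNge; case: (m <= q e).
have split_s : s = [seq e <- s | q e == m] ++ [seq e <- s | q e != m].
  elim: s so al {IH} => //= e s IH so /andP[/andP[le lt] al].
  case: eqVneq => [eq|ne] /=; first by rewrite -IH //; apply: path_sorted so.
  have h : all (fun f => q f != m) s.
    have : all (fun z => q e <= z) (map q s) by apply: order_path_min so => ? ? ?; apply: leq_trans.
    rewrite all_map; apply: sub_all => f /= lef; rewrite gtn_eqF //.
    by apply: leq_trans lef; rewrite ltn_neqAle eq_sym ne.
  have -> : [seq e <- s | q e != m] = s by apply/all_filterP.
  have -> // : [seq e <- s | q e == m] = [::].
  by apply/size0nil/eqP; rewrite size_filter -leqn0 leqNgt -has_count -all_predC.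
rewrite /= [RHS]split_s; congr (_ ++ _); rewrite -[RHS](IH m.+1).
- congr flatten; apply/eq_in_map => p; rewrite mem_iota => /andP[ltp _].
  rewrite -filter_predI; apply: eq_filter => e /=.
  by case: eqVneq => //= ->; rewrite gtn_eqF.
- rewrite sorted_map; apply: sorted_filter; last by rewrite -sorted_map.
  by move=> ? ? ?; apply: leq_trans.
- rewrite all_filter; apply: sub_all al => e /= /andP[le lt]; apply/implyP => ne.
  by rewrite ltn_neqAle eq_sym ne le addSnnS.
Qed.

Lemma sort_index_lt (A : eqType) (K : A -> nat) (s : seq A) f e : f \in s -> e \in s ->
  K f < K e -> index f (sort (fun a b => K a <= K b) s) < index e (sort (fun a b => K a <= K b) s).
Proof.
move=> hf he lt; set s' := sort _ s.
have so : sorted (fun a b => K a <= K b) s' by apply: sort_sorted => a b; apply: leq_total.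
rewrite ltnNge; apply/negP => le.
have tr : transitive (fun a b => K a <= K b) by move=> a b c; apply: leq_trans.
have rf : reflexive (fun a b => K a <= K b) by move=> a; apply: leqnn.
have := sorted_leq_index tr rf so; move=> /(_ e f); rewrite !mem_sort => /(_ he hf le).
by rewrite leqNgt lt.
Qed.

(** * Deleting the last instruction of a thread *)

Section Deletion.
Variables (D Reg : finType) (d0 : D) (P : program D Reg).
Implicit Types (S T s : gstate D Reg) (t i j : nat) (e f : mev D) (x : nat * nat).
Implicit Types (F : nat -> seq (instr D Reg)).

Lemma trace_eq_cyclic (T1 T2 : trace D Reg) : trace_eq T1 T2 -> hb_cyclic T1 -> hb_cyclic T2.
Proof.
move=> [h1 h2 h3].
have H y z : tr_hb T1 y z -> tr_hb T2 y z.
  move=> [[t [i [? [? h]]]]|[/h2 h|[/h3 h|[u [/h3 hu /h2 hv]]]]].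
  - by left; exists t, i; rewrite -h1.
  - by right; left.
  - by right; right; left.
  - by right; right; right; exists u.
have Hp y z : clos_trans (node D) (@tr_hb D Reg T1) y z -> clos_trans (node D) (@tr_hb D Reg T2) y z.
  elim=> [a b /H h|a b c _ h _ h']; first by apply: t_step.
  by apply: t_trans h h'.
by move=> [y /Hp hy]; exists y.
Qed.

Lemma run_prop_ne S ms T t t' i a : mrun d0 P S ms T -> MProp t t' i a \in ms -> t <> t' /\ t < size P.
Proof.
elim=> // {}S e l {}ms {}T h _ IH; rewrite inE => /orP[/eqP ?|//]; subst e.
by case: h.
Qed.

(** The visible store is always the propagated one with the largest key and the other components are
    unions over the events, so the order of events matters only through what loads read. *)
Lemma perm_state F ms T ms' T' : mrun d0 P (full F) ms T -> mrun d0 P (full F) ms' T' ->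
  ms' =i ms -> (forall t i l, rL (rt T' t) i = Some l -> rL (rt T t) i = Some l) -> T' = T.
Proof.
move=> h h' E HL; have I := reach_inv h; have I' := reach_inv h'.
have hco t i k : gco T' t i = Some k <-> gco T t i = Some k.
  split.
    by move=> /(hist_gco h')[a]; rewrite E => ha; have [] := hist_commit h ha.
  by move=> /(hist_gco h)[a]; rewrite -E => ha; have [] := hist_commit h' ha.
apply: gstate_ext.
- by move=> t; rewrite (mrun_F h) (mrun_F h').
- by move=> t i; rewrite (hist_rC _ _ h) (hist_rC _ _ h'); apply: eq_has_r.
- move=> t i; have : (rL (rt T' t) i : bool) = rL (rt T t) i.
    by rewrite (hist_rL _ _ h) (hist_rL _ _ h'); apply: eq_has_r.
  case El : (rL (rt T' t) i) => [l|]; first by rewrite (HL _ _ _ El).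
  by case: (rL (rt T t) i).
- move=> t i; case ek: (gco T' t i) => [k|]; first by rewrite ((hco _ _ _).1 ek).
  by case ek': (gco T t i) => [k|//]; rewrite ((hco _ _ _).2 ek') in ek.
move=> t a; case Eg: (gprop T t a) => [b|t1 i1]; case Eg': (gprop T' t a) => [b'|t1' i1'].
- by rewrite (i_gp I Eg) (i_gp I' Eg').
- have [f [hf pf fi]] := hist_gprop h' Eg'; rewrite E in hf.
  have [k [k0 [e1 e0 le _]]] := hist_prop h hf pf.
  move: e0; rewrite Eg => -[?]; subst k0; have [_ _ _ kp _] := i_co I e1.
  by move: (lt_le_trans kp le); rewrite ltxx.
- have [f [hf pf fi]] := hist_gprop h Eg; rewrite -E in hf.
  have [k [k0 [e1 e0 le _]]] := hist_prop h' hf pf.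
  move: e0; rewrite Eg' => -[?]; subst k0; have [_ _ _ kp _] := i_co I' e1.
  by move: (lt_le_trans kp le); rewrite ltxx.
- have [f [hf pf fi]] := hist_gprop h Eg; rewrite -E in hf.
  have [k [k0 [e1 e0 le _]]] := hist_prop h' hf pf.
  have [f' [hf' pf' fi']] := hist_gprop h' Eg'; rewrite E in hf'.
  have [k' [k0' [e1' e0' le' _]]] := hist_prop h hf' pf'.
  rewrite Eg /= in e0'; rewrite Eg' /= in e0; rewrite fi /= in e1; rewrite fi' /= in e1'.
  move/hco: e1; rewrite e0' => -[?]; move/hco: e0; rewrite e1' => -[?]; subst k0 k0'.
  have ? : k = k' by apply: le_anti; rewrite le le'.
  by subst k'; have [-> ->] := i_inj I e1' e0'.
Qed.

Definition delF F x t := if t == x.1 then take x.2 (F t) else F t.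

Lemma size_delF F x t i : size (F x.1) = x.2.+1 ->
  (i < size (delF F x t)) = (i < size (F t)) && ((t, i) != x).
Proof.
move=> sx; rewrite /delF; case: (eqVneq t x.1) => [->|ne]; last first.
  case: eqP => [h|_]; last by rewrite andbT.
  by rewrite -h eqxx in ne.
rewrite size_takel ?sx // ltnS [in RHS]leq_eqVlt.
have -> : ((x.1, i) == x) = (i == x.2) by rewrite [x in _ == x]surjective_pairing xpair_eqE eqxx.
by case: (ltngtP i x.2).
Qed.

(** No later instruction of the thread and no load depends on [x]. The remaining events keep their
    order, so [reorder] applies with the preorder that is always true. *)
Lemma delete_last s nf x : computation d0 P s nf -> size (rF (rt s x.1)) = x.2.+1 ->
  (forall t i, rL (rt s t) i <> Some (SStore D x.1 x.2)) ->
  exists s', [/\ computation d0 P s' [seq e <- nf | inst e != x],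
    forall t, rF (rt s' t) = delF (fun t => rF (rt s t)) x t,
    forall t i, (t, i) <> x -> rL (rt s' t) i = rL (rt s t) i,
    forall t i, (t, i) <> x -> gco s' t i = gco s t i &
    forall t i a, (t, i) <> x -> addr_val d0 s t i a -> addr_val d0 s' t i a].
Proof.
set F := fun t => rF (rt s t); move=> [w hm fin] sx unr; rewrite -/F in w hm.
have I := reach_inv hm.
set ms' := [seq e <- nf | inst e != x]; set F' := delF F x.
have in' t i : (i < size (F' t)) = (i < size (F t)) && ((t, i) != x) by apply: size_delF.
have cmdsF t i : (t, i) != x -> cmd_at (full F') t i = cmd_at (full F) t i.
  move=> ne; have [lt|ge] := ltnP i (size (F' t)).
    symmetry; apply: (@cmd_at_prefix _ _ (full F') (full F) t i (if t == x.1 then drop x.2 (F t) else [::])) => //=.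
    by rewrite /F' /delF; case: eqP; rewrite ?cat_take_drop ?cats0.
  rewrite /cmd_at /ins_at /= !nth_default ?size_map //.
  by move: (in' t i); rewrite ltnNge ge ne andbT /= ltnNge => /esym/negbFE.
have [|||||||s' hs' HL] := @reorder _ _ d0 P F F' nf s ms' x false (fun _ _ => true) hm.
- by apply: filter_uniq; apply: mrun_uniq hm.
- by move=> e; rewrite mem_filter andbC.
- by move=> t i; apply: cmdsF.
- move=> e f; rewrite !mem_filter => /andP[he _] /andP[hf _] lt _; exact: index_filter_lt.
- exact: compatT.
- exact: unr.
- by move=> i lt; rewrite -/(F x.1) in sx; rewrite /F sx.
have I' := reach_inv hs'.
have FS' t : rF (rt s' t) = F' t by rewrite (mrun_F hs').
have memx e : inst e <> x -> (e \in ms') = (e \in nf) by move=> /eqP ne; rewrite mem_filter ne.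
have HC t i : (t, i) <> x -> rC (rt s' t) i = rC (rt s t) i.
  move=> ne; rewrite (hist_rC _ _ hm) (hist_rC _ _ hs'); apply/hasP/hasP => -[e he ie]; exists e => //.
    by rewrite mem_filter in he; case/andP: he.
  by rewrite memx ?(iscomP ie).
have HL2 t i : (t, i) <> x -> rL (rt s' t) i = rL (rt s t) i.
  move=> ne; have : (rL (rt s' t) i : bool) = rL (rt s t) i.
    rewrite (hist_rL _ _ hm) (hist_rL _ _ hs'); apply/hasP/hasP => -[e he ie]; exists e => //.
      by rewrite mem_filter in he; case/andP: he.
    by rewrite memx ?(isldP ie).
  case El : (rL (rt s' t) i) => [l|]; first by rewrite (HL _ _ _ El).
  by case: (rL (rt s t) i).
have Hco t i : (t, i) <> x -> gco s' t i = gco s t i.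
  move=> ne; case ek: (gco s' t i) => [k|]; symmetry.
    have [a ha] := hist_gco hs' ek; rewrite memx // in ha.
    by have [] := hist_commit hm ha.
  case ek': (gco s t i) => [k|//].
  have [a ha] := hist_gco hm ek'; rewrite -memx // in ha.
  by have [] := hist_commit hs' ha; rewrite ek.
have rng S t i : store_at S t i -> i < size (rF (rt S t)).
  by move=> /store_atE[e1 [e2 h]]; apply: cmd_at_lt h.
have X : xe s' s (fun t i => i < size (F' t)).
  split.
  - by move=> t i j h lt; apply: ltn_trans h.
  - move=> t i; rewrite in' => /andP[_ ne].
    transitivity (cmd_at (full F) t i); first exact: cmd_at_eqF.
    by rewrite -cmdsF //; apply: cmd_at_eqF; rewrite FS'.
  - by move=> t i l _ /HL.
  - move=> t i t' i' _ El; have [_ _ [a [_ [st _ _] _]]] := i_rL I' El.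
    by rewrite -FS'; apply: rng.
have Cs' t i : i < size (F' t) -> rC (rt s' t) i.
  rewrite in' => /andP[lt /eqP ne]; rewrite HC //; case: fin => h _ _; apply: h => //.
  exact: wf_size w lt.
have av_in S t i a : addr_val d0 S t i a -> i < size (rF (rt S t)).
  by move=> [c [e [h _]]]; apply: cmd_at_lt h.
have A1 t i a : addr_val d0 s' t i a -> addr_val d0 s t i a.
  by move=> h; apply: (xf_addr X) => //; rewrite -FS'; apply: av_in h.
(* From the larger state back to the smaller one [xe] gives nothing. But the instruction is
   committed in [s'], hence has an address there, and by [A1] it is the same one. *)
have A2 t i a : (t, i) <> x -> addr_val d0 s t i a -> addr_val d0 s' t i a.
  move=> ne h; have lt : i < size (F' t) by rewrite in' (av_in _ _ _ _ h); apply/eqP.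
  have [_ ck] := i_C I' (Cs' _ _ lt).
  have [|b hb] := cok_addr ck.
    by have [c [e [h1 [h2 _]]]] := h; exists c, e; rewrite -(x_cmd X).
  by rewrite (addr_det h (A1 _ _ _ hb)).
have nxr t i : i < size (F' t) -> (t, i) <> x by rewrite in' => /andP[_ /eqP].
have loads t i a : load_at s' t i -> addr_val d0 s' t i a ->
    [/\ load_at s t i, addr_val d0 s t i a & rL (rt s' t) i = rL (rt s t) i].
  move=> l1 a1; have lt := av_in _ _ _ _ a1; rewrite FS' in lt; split; last exact/HL2/nxr.
    by rewrite (xf_load X).
  exact: A1.
have keys l k : l <> SStore D x.1 x.2 -> keyof s l = Some k -> keyof s' l = Some k.
  case: l => //= t i ne; rewrite Hco // => h; apply: ne; by rewrite -h.
exists s'; split=> //; split.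
- have -> : (fun t => rF (rt s' t)) = F' by apply: funext.
  move=> t p ins q; rewrite /F' /delF; case: eqP => [->|_]; last exact: w.
  by move=> h; apply: (w _ p ins (q ++ drop x.2 (F x.1))); rewrite -[LHS](cat_take_drop x.2) h -catA.
- by have -> : (fun t => rF (rt s' t)) = F' by apply: funext.
- case: fin => _ f2 f3; split.
  + by move=> t i _; rewrite FS'; apply: Cs'.
  + move=> t i' i a lt li l1 l2 a1 a2.
    have [b1 b2 b3] := loads _ _ _ l1 a1; have [c1 c2 c3] := loads _ _ _ l2 a2.
    have [l' [l [k1 [k2 [g1 g2 g3 g4 g5]]]]] := f2 _ _ _ _ lt li b1 c1 b2 c2.
    exists l', l, k1, k2; rewrite b3 c3; split=> //; apply: keys => // ?; subst.
      exact: unr g1.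
    exact: unr g2.
  + move=> t i' i a lt li l1 l2 a1 a2.
    have [c1 c2 c3] := loads _ _ _ l2 a2.
    have lt1 := av_in _ _ _ _ a1; rewrite FS' in lt1.
    have st1 : store_at s t i' by rewrite (xf_store X).
    have [l [k1 [k2 [g1 g2 g3 g4]]]] := f3 _ _ _ _ lt li st1 c1 (A1 _ _ _ a1) c2.
    exists l, k1, k2; rewrite c3 Hco; last exact: nxr.
    by split=> //; apply: keys => // ?; subst; apply: unr g2.
Qed.

End Deletion.

(** * Normal form when some last instruction is unread *)

Section DeletionCase.
Variables (D Reg : finType) (d0 : D) (P : program D Reg).
Implicit Types (S T s : gstate D Reg) (t i j : nat) (e f : mev D) (x : nat * nat).
Implicit Types (F : nat -> seq (instr D Reg)).

Definition nf_violation : Prop :=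
  exists (evs : seq (event D Reg)) (s : gstate D Reg),
    [/\ power_run d0 P evs s, normal_form (size P + 3) evs & hb_cyclic (trace_of d0 P s)].

Lemma same_computation s s' nf ms : computation d0 P s nf -> same s s' ->
  mrun d0 P (full (fun t => rF (rt s t))) ms s' -> computation d0 P s' ms.
Proof.
move=> [w _ fin] M h; have E : (fun t => rF (rt s' t)) = (fun t => rF (rt s t)).
  by apply: funext => t; rewrite (sm_F M).
by split; rewrite ?E //; apply: same_final fin.
Qed.

Lemma count_inst F s nf x : mrun d0 P (full F) nf s -> x.1 < size P ->
  count (fun e => inst e == x) nf <= (size P).+1.
Proof.
move=> hm lx; rewrite -size_filter; set xs := filter _ _.
(* An injection into 0..|P|: commits get |P|, propagations their target, and a load its own thread,
   which is never the target of a propagation. *)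
pose c e := match e with MLoad t _ _ => t | MProp t _ _ _ => t | _ => size P end.
have hx e : e \in xs -> inst e = x /\ e \in nf by rewrite mem_filter => /andP[/eqP].
have u : uniq [seq c e | e <- xs].
  rewrite map_inj_in_uniq; first by apply: filter_uniq; apply: mrun_uniq hm.
  move=> e f /hx[ex he] /hx[fx hf] ec; apply: (code_inj hm he hf).
  rewrite /code ex fx; congr (_, _).
  case: e f ex fx he hf ec => [t i a|t i|t i k a|t t' i a] [t1 i1 a1|t1 i1|t1 i1 k1 a1|t1 t1' i1 a1] //=.
  - by move=> ex _ _ _ E; move: lx; rewrite -ex /= E ltnn.
  - by move=> ex _ _ _ E; move: lx; rewrite -ex /= E ltnn.
  - by move=> <- [E1 _] _ /(run_prop_ne hm)[ne _] E; case: ne; rewrite E1.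
  - by move=> _ fx _ _ E; move: lx; rewrite -fx /= -E ltnn.
  - by move=> _ _ _ /(run_prop_ne hm)[_ lt] E; rewrite -E ltnn in lt.
  - by move=> _ fx _ _ E; move: lx; rewrite -fx /= -E ltnn.
  - by move=> _ _ _ /(run_prop_ne hm)[_ lt] E; rewrite -E ltnn in lt.
  - by move=> <- [E1 _] /(run_prop_ne hm)[ne _] _ E; case: ne; rewrite E E1.
  - by move=> _ _ /(run_prop_ne hm)[_ lt] _ E; rewrite E ltnn in lt.
  - by move=> _ _ /(run_prop_ne hm)[_ lt] _ E; rewrite E ltnn in lt.
  - by move=> _ _ _ _ ->.
have sub : {subset [seq c e | e <- xs] <= iota 0 (size P).+1}.
  move=> _ /mapP[e /hx[ex he] ->]; rewrite mem_iota add0n /= ltnS.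
  case: e ex he => [t i a|t i|t i k a|t t' i a] //= ex he.
    by move: lx; rewrite -ex => /ltnW.
  by have [_ /ltnW] := run_prop_ne hm he.
by have := uniq_leq_size u sub; rewrite size_map size_iota.
Qed.

Lemma sort_sorted_index (A : eqType) (K g : A -> nat) (s : seq A) :
  (forall e f : A, e \in s -> f \in s -> K e <= K f -> g e <= g f) ->
  sorted leq (map g (sort (fun a b => K a <= K b) s)).
Proof.
move=> h; rewrite sorted_map.
have so : sorted (fun a b => K a <= K b) (sort (fun a b => K a <= K b) s).
  by apply: sort_sorted => a b; apply: leq_total.
apply: (sub_in_sorted (P := [pred a | a \in s])) so; last by apply/allP => a; rewrite mem_sort.
by move=> e f he hf; apply: h.
Qed.

(** Edges at [x] may close a cycle, so no order accounts for them; the events of [x] therefore act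
    as barriers, and sorting takes place only between them. *)
Lemma deletion_violation s nf x : computation d0 P s nf -> hb_cyclic (trace_of d0 P s) ->
  size (rF (rt s x.1)) = x.2.+1 -> (forall t i, rL (rt s t) i <> Some (SStore D x.1 x.2)) ->
  (forall s' nf', computation d0 P s' nf' -> size (nodes P s') < size (nodes P s) ->
     hb_cyclic (trace_of d0 P s') -> nf_violation) -> nf_violation.
Proof.
move=> C cyc sx unr IH; have [w hm fin] := C.
set F := fun t => rF (rt s t); rewrite -/F in w hm.
have I := reach_inv hm.
have lx : x.1 < size P by apply: (wf_size w (i := x.2)); rewrite /F sx.
have [s' [C' hF' hL' hco' hav']] := delete_last C sx unr.
have [w' hm' fin'] := C'.
have I' := reach_inv hm'.
have in' t i : (i < size (rF (rt s' t))) = (i < size (F t)) && ((t, i) != x).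
  by rewrite hF' size_delF.
have [cyc'|ac'] := pselect (hb_cyclic (trace_of d0 P s')).
  apply: (IH _ _ C') => //.
  have sub : {subset x :: nodes P s' <= nodes P s}.
    move=> [t i]; rewrite inE => /orP[/eqP Ex|].
      by rewrite -Ex in sx; rewrite (mem_nodes _ _ w) sx.
    by rewrite (mem_nodes _ _ w') (mem_nodes _ _ w) in' => /andP[].
  apply: (uniq_leq_size _ sub); rewrite /= nodes_uniq andbT.
  by rewrite [x]surjective_pairing (mem_nodes _ _ w') in' -surjective_pairing eqxx andbF.
have [o [Eo Ro]] := acyclic_ranked x I' w' ac'.
have nxo : x \notin o by rewrite [x]surjective_pairing (en_mem Eo) in' -surjective_pairing eqxx andbF.
(* Putting [x] after all ranked instructions makes an event of [x] the last one of its piece. *)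
set o' := rcons o x.
have mo y : y \in o -> index y o' = index y o by move=> h; rewrite /o' -cats1 index_cat h.
have mx : index x o' = size o by rewrite /o' -cats1 index_cat (negPf nxo) /= eqxx addn0.
have ino t i : ((t, i) \in o) = (i < size (F t)) && ((t, i) != x) by rewrite (en_mem Eo) in'.
have Eo' : enumr F o'.
  split.
  - by rewrite rcons_uniq nxo (en_uniq Eo).
  - move=> t i; rewrite mem_rcons inE ino; case: eqP => [Ex|] /=; last by rewrite andbT.
    by rewrite -Ex in sx; rewrite /F sx /= ltnSn.
  - move=> t i j lij ltj; have lti := ltn_trans lij ltj.
    have ni : (t, i) <> x by move=> Ex; rewrite -Ex in sx; rewrite /F sx ltnS leqNgt lij in ltj.
    have hi : (t, i) \in o by rewrite ino lti; apply/eqP.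
    case: (eqVneq (t, j) x) => [->|nj]; first by rewrite mx mo // index_mem.
    rewrite (mo _ hi) mo ?ino ?ltj //; apply: (en_po Eo) => //; by rewrite in' ltj.
pose rk y := index y o'.
have st_o t i : store_at s t i -> (t, i) <> x -> (t, i) \in o.
  by move=> /store_atE[e1 [e2 h]] /eqP n; rewrite ino n (cmd_at_lt h).
have co_o t i k : gco s t i = Some k -> (t, i) <> x -> (t, i) \in o.
  by move=> /(i_co I)[_ _ h _ _]; apply: st_o.
have L_o t i l : rL (rt s t) i = Some l -> (t, i) <> x -> (t, i) \in o.
  by move=> /(i_rL I)[_ /load_atE[r [e h]] _] /eqP n; rewrite ino n (cmd_at_lt h).
have R : ranked d0 s x rk.
  split.
  - by move=> t i j lij ltj _ _; apply: (en_po Eo').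
  - move=> t j t' i' El n1 n2; have [_ _ [a [_ [st _ _] _]]] := i_rL I El.
    rewrite /rk !mo ?(st_o _ _ st n2) ?(L_o _ _ _ El n1) //.
    by rewrite -(hL' _ _ n1) in El; apply: (r_src Ro El).
  - move=> t i t' i' a k k' ek ek' av av' lk n1 n2.
    rewrite /rk !mo ?(co_o _ _ _ ek n1) ?(co_o _ _ _ ek' n2) //.
    rewrite -(hco' _ _ n1) in ek; rewrite -(hco' _ _ n2) in ek'.
    exact: (r_co Ro ek ek' (hav' _ _ _ n1 av) (hav' _ _ _ n2 av') lk).
  - move=> t j t' i' a l k k' El av ekl ek' av' lk n1 n2.
    rewrite /rk !mo ?(L_o _ _ _ El n1) ?(co_o _ _ _ ek' n2) //.
    have ekl' : keyof s' l = Some k.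
      case: l El ekl => //= t1 i1 El; rewrite hco' // => Ex; apply: (unr t j).
      by rewrite El -Ex.
    rewrite -(hL' _ _ n1) in El; rewrite -(hco' _ _ n2) in ek'.
    exact: (r_cf Ro El (hav' _ _ _ n1 av) ekl' ek' (hav' _ _ _ n2 av') lk).
(* The piece of [e]: the number of events of [x] strictly before it. *)
pose q e := count (fun f => inst f == x) (take (index e nf) nf).
pose M := (size o').+1; pose N := (size nf).+1.
(* Lexicographic in piece, rank of the instruction and original position; the last entry keeps the
   events of one instruction in order. *)
pose K e := (q e * M + rk (inst e)) * N + index e nf.
have rkM e : rk (inst e) < M by rewrite /M ltnS index_size.
have idN e : index e nf < N by rewrite /N ltnS index_size.
have Kq e f : q e < q f -> K e < K f by move=> h; apply: lex2 => //; apply: lex2.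
have Kr e f : q e = q f -> rk (inst e) < rk (inst f) -> K e < K f.
  by move=> h1 h2; apply: lex2 => //; rewrite h1 ltn_add2l.
have q_le e f : index f nf <= index e nf -> q f <= q e.
  move=> le; rewrite /q -(cat_take_drop (index f nf) (take (index e nf) nf)) take_takel //.
  by rewrite count_cat leq_addr.
have q_lt e f : f \in nf -> index f nf < index e nf -> inst f = x -> q f < q e.
  move=> hf lt fx; have le : q f + 1 <= q e; last by rewrite addn1 in le.
  rewrite /q -(cat_take_drop (index f nf).+1 (take (index e nf) nf)) take_takel //.
  rewrite count_cat (take_nth f) ?index_mem // -cats1 count_cat nth_index //= fx eqxx.
  by rewrite addn0 leq_addr.
pose ms' := sort (fun e f => K e <= K f) nf.
have mms : ms' =i nf by move=> e; rewrite mem_sort.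
have [|||||||s2 hs2 HL2] := @reorder _ _ d0 P F F nf s ms' x true (fun y z => rk y <= rk z) hm.
- by rewrite sort_uniq; apply: mrun_uniq hm.
- by move=> e; rewrite mms andbT.
- by [].
- move=> e f; rewrite !mms => he hf lt hc; apply: sort_index_lt => //.
  have := q_le _ _ (ltnW lt); rewrite leq_eqVlt => /orP[/eqP Eq|]; last exact: Kq.
  have nfx : inst f <> x by move=> fx; have := q_lt _ _ hf lt fx; rewrite Eq ltnn.
  have : rk (inst f) <= rk (inst e).
    case/or3P: hc => [/eqP//|/eqP ->|//].
    rewrite [in rk x]/rk mx /rk mo; first exact: index_size.
    have := mrun_range hm hf; move/eqP: nfx; case: (inst f) => t i /= n h.
    by rewrite ino n andbT.
  rewrite leq_eqVlt => /orP[/eqP Er|]; last exact: Kr.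
  by rewrite /K Eq Er ltn_add2l.
- exact: ranked_compat.
- exact: unr.
- by move=> i lt; rewrite /F sx.
have Es : s2 = s := perm_state hm hs2 mms HL2.
subst s2.
have C2 : computation d0 P s ms' by apply: same_computation C _ hs2.
(* At most |P|+1 events of [x] give values of [q] from 0 to |P|+1; with the fetches this makes |P|+3
   pieces. *)
set pieces := [seq [seq e <- ms' | q e == p] | p <- iota 0 (size P).+2].
have Ep : ms' = flatten pieces.
  symmetry; apply: flatten_classes.
    apply: sort_sorted_index => e f _ _; apply: contraTT; rewrite -!ltnNge; exact: Kq.
  apply/allP => e _; rewrite add0n /= ltnS; apply: leq_trans (count_inst hm lx).
  by rewrite -[in X in _ <= X](cat_take_drop (index e nf) nf) count_cat leq_addr.
have [|evs [pr nf_evs]] := comp_normal_form C2 Eo' Ep.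
  move=> _ /mapP[p _ ->]; rewrite sorted_map.
  have so : sorted (fun e f => K e <= K f) ms' by apply: sort_sorted => a b; apply: leq_total.
  have so' : sorted (fun e f => K e <= K f) [seq e <- ms' | q e == p].
    by apply: sorted_filter so => a b c; apply: leq_trans.
  apply: (sub_in_sorted (P := [pred a | q a == p])) so'; last by rewrite all_filter; apply/allP => a _; apply/implyP.
  move=> e f /eqP qe /eqP qf; apply: contraTT; rewrite -!ltnNge => h.
  by apply: Kr => //; rewrite qe qf.
exists evs, s; split=> //.
by move: nf_evs; rewrite size_map size_iota addnS addn2.
Qed.

End DeletionCase.

(** * Completing a computation thread by thread *)

Section Completion.
Variables (D Reg : finType) (d0 : D) (P : program D Reg).
Implicit Types (T A B : gstate D Reg) (t i j : nat) (e f : mev D) (a : D).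

(** What a thread sees only grows, so the present memory bounds a later read from below. Only an
    early read escapes the bound, and its store is still uncommitted now. *)
Lemma future_load S ms T t i a l : mrun d0 P S ms T -> invar d0 P S -> rL (rt S t) i = None ->
  rL (rt T t) i = Some l -> addr_val d0 S t i a ->
  (exists k0 k, [/\ keyof S (gprop S t a) = Some k0, keyof T l = Some k & (k0 <= k)%R]) \/
  exists j, [/\ l = SStore D t j, j < i, store_at T t j, addr_val d0 T t j a & ~~ rC (rt S t) j].
Proof.
elim=> [{}S _ ->//|{}S e l0 {}ms {}T h h2 IH I nL El av].
have X := en_ext I h; have I1 := inv_en I h; have X2 := mrun_ext h2 I1.
case El1: (rL (rt (upd S e l0) t) i) => [l1|]; last first.
  case: (IH I1 El1 El (ext_addr X av)) => [[k0 [k [e0 ek le]]]|[j [h3 h4 h5 h6 h7]]]; [left|right].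
    have [k1 e1 _] := gp_key t a I; have [k2 e2 le2] := x_gp X e1.
    by exists k1, k; split=> //; move: e2; rewrite e0 => -[?]; subst k2; apply: le_trans le.
  by exists j; split=> //; apply: contra h7; apply: (x_C (x_xf X)).
have := ext_L X2 El1; rewrite El => -[?]; subst l1.
move: El1; rewrite /=; case: ifP => [il [?]|_]; last by rewrite nL.
subst l0; case: e h X I1 h2 X2 il IH => //= t1 i1 a1 [lt ld _ av1 hl] X I1 h2 X2 /andP[/eqP ? /eqP ?] _; subst t1 i1.
have ? := addr_det av av1; subst a1.
case: hl => [->|[j -> [m1 [m2 m2'] _ m4 _]]].
  left; have [k ek _] := gp_key t a I; exists k, k; split=> //.
  exact: (ext_key X2 (ext_key X ek)).
right; exists j; split=> //; first by rewrite (ext_store _ _ X2).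
exact: (ext_addr X2 (ext_addr X m2')).
Qed.

(** When everything earlier in the thread is committed, all its registers have values and every
    dependency is met; only the own address, the own read and assumes remain to be assumed. *)
Lemma cok_all B t i : invar d0 P B -> i < size (rF (rt B t)) ->
  (forall j, j < i -> rC (rt B t) j) ->
  (has_addr B t i -> exists a, addr_val d0 B t i a) ->
  (load_at B t i -> rL (rt B t) i <> None) ->
  (forall ex, cmd_at B t i <> Some (CAssume ex)) -> cok d0 B t i.
Proof.
move=> I lt hC ha hl na.
have tot : forall ex, exists v, evalx d0 B t i ex v.
  apply: eval_total => [j r ex lj cm|j r ex lj cm].
    have [_ ck] := i_C I (hC _ lj); exact: cok_val ck cm _.
  have := cok_load (i_C I (hC _ lj)).2 (load_atP cm); case El: (rL _ _) => [l|//] _; exists l => // t' i' Ell; subst l.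
  by have [_ _ [a [_ [h1 _ h2] _]]] := i_rL I El.
have dep ex j : depends_on B t i ex j -> j < i by move=> [r [_ [lj _]]].
split; first exact: lt.
split; first by move=> j [c [ex [_ [_ /dep]]]]; apply: hC.
split; first by move=> j [c [ex [_ [_ /dep]]]]; apply: hC.
split; first by move=> j [lj _]; apply: hC.
split.
  move=> [c [ex [c1 [c2 c3]]]]; have [|a [c' [ex' [c1' [c2' c3']]]]] := ha; first by exists c, ex.
  by move: c1'; rewrite c1 => -[?]; subst c'; move: c2'; rewrite c2 => -[?]; subst ex'; case: (c3 a).
split; first by move=> [c [ex [c1 [c2 c3]]]]; have [v hv] := tot ex; case: (c3 v).
split; first by move=> a _ j lj _; left; apply: hC.
split; first by move=> r ex /load_atP; apply: hl.
by move=> ex /na.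
Qed.

Variables (S s : gstate D Reg) (post : seq (mev D)).
Let F := fun t => rF (rt s t).
Hypothesis hpost : mrun d0 P S post s.
Hypothesis I : invar d0 P S.
Hypothesis w : wfF P F.
Hypothesis fin : final d0 P s.
Hypothesis last_store : forall t n, size (F t) = n.+1 -> store_at s t n.

Definition good : Prop := forall t n, size (rF (rt s t)) = n.+1 -> rC (rt S t) n.
Hypothesis G : good.

Definition pend t a j : bool := [&& store_at S t j, ~~ rC (rt S t) j & `[< addr_val d0 S t j a >]].

(* what thread [t] will find in memory at [a] when only its own pending stores with index below
   [c] still reach it *)
Fixpoint seen t a c : lsrc D :=
  if c is c'.+1 then if pend t a c' then SStore D t c' else seen t a c' else gprop S t a.

Definition load_result t i : option (lsrc D) :=
  if rL (rt S t) i is Some l then Some l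
  else if load_at S t i then omap (fun a => seen t a i) [pick a | `[< addr_val d0 S t i a >]] else None.

(** The instructions of thread [t] below [c t] are finished. New commits take their keys from [s],
    so that the coherence order will be that of [s], and reach only the own thread, so that the
    threads do not influence each other. *)
Definition complete (c : nat -> nat) : gstate D Reg :=
  {| rt := fun t => {| rF := rF (rt S t); rC := fun i => rC (rt S t) i || (i < c t);
                       rL := fun i => if i < c t then load_result t i else rL (rt S t) i |};
     gco := fun t i => if i < c t then gco s t i else gco S t i;
     gprop := fun t a => seen t a (c t) |}.

Definition completed := complete (fun t => size (F t)).

Let X : ext S s := mrun_ext hpost I.
Let Is : invar d0 P s := mrun_inv hpost I.
Let FS t : rF (rt S t) = F t.
Proof. by rewrite /F (mrun_F hpost). Qed.

Lemma rC_s t i : i < size (F t) -> rC (rt s t) i.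
Proof. by move=> lt; case: fin => h _ _; apply: h => //; apply: wf_size w lt. Qed.

Lemma store_range T t i : store_at T t i -> i < size (rF (rt T t)).
Proof. by move=> /store_atE[e1 [e2 h]]; apply: cmd_at_lt h. Qed.

(** The last store of the thread is committed, and its commit required every earlier access to be
    committed or to have a known address. *)
Lemma known t j : j < size (F t) -> has_addr S t j -> exists a, addr_val d0 S t j a.
Proof.
case En : (size (F t)) => [//|n] lj ha; have hC := G En; have [_ ck] := i_C I hC.
move: lj; rewrite ltnS leq_eqVlt => /orP[/eqP ?|lj]; first by subst j; apply: cok_addr.
have st : store_at S t n by have := last_store En; rewrite (ext_store _ _ X).
have [b hb] := cok_addr ck (store_has_addr st).
case: (cok_same ck hb lj ha) => [hj|[a' av _]]; last by exists a'.
by have [_ ckj] := i_C I hj; apply: cok_addr.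
Qed.

Lemma assume_committed t j ex : cmd_at S t j = Some (CAssume ex) -> rC (rt S t) j.
Proof.
move=> cm; have lj := cmd_at_lt cm; rewrite FS in lj.
case En : (size (F t)) lj => [//|n]; have hC := G En; have [_ ck] := i_C I hC.
rewrite ltnS leq_eqVlt => /orP[/eqP ?|lj].
  by have := last_store En; rewrite (ext_store _ _ X) /store_at; subst j; rewrite cm.
by apply: (cok_ctrl ck); split=> //; exists ex.
Qed.

Lemma seenP t a c : (seen t a c = gprop S t a /\ forall j, j < c -> ~~ pend t a j) \/
  exists j, [/\ j < c, pend t a j, seen t a c = SStore D t j & forall j', j' < c -> pend t a j' -> j' <= j].
Proof.
elim: c => [|c IH] /=; first by left.
case: ifP => hp; first by right; exists c.
case: IH => [[-> h]|[j [h1 h2 h3 h4]]]; [left|right].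
  by split=> // j; rewrite ltnS leq_eqVlt => /orP[/eqP->|/h//]; rewrite hp.
exists j; split=> //; first exact: leqW.
by move=> j'; rewrite ltnS leq_eqVlt => /orP[/eqP->|/h4//]; rewrite hp.
Qed.

Lemma pendP t a j : pend t a j -> [/\ store_at s t j, ~~ rC (rt S t) j, addr_val d0 s t j a & j < size (F t)].
Proof.
move=> /and3P[h1 h2 /asboolP h3]; rewrite (ext_store _ _ X); split=> //; first exact: (ext_addr X).
by rewrite -FS; apply: store_range.
Qed.

Lemma store_key t j : store_at s t j -> exists k, gco s t j = Some k.
Proof. by move=> st; apply: (i_Cco Is) => //; apply: rC_s; apply: store_range. Qed.

Definition lel (l1 l2 : lsrc D) : Prop :=
  exists k1 k2, [/\ keyof s l1 = Some k1, keyof s l2 = Some k2 & (k1 <= k2)%R].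

Lemma lel_trans l1 l2 l3 : lel l1 l2 -> lel l2 l3 -> lel l1 l3.
Proof.
move=> [k1 [k2 [e1 e2 le]]] [k2' [k3 [e2' e3 le']]]; exists k1, k3; split=> //.
by move: e2'; rewrite e2 => -[?]; subst k2'; apply: le_trans le'.
Qed.

Lemma seen_key_s t a : exists2 k, keyof S (gprop S t a) = Some k & keyof s (gprop S t a) = Some k.
Proof. by have [k ek _] := gp_key t a I; exists k => //; apply: (ext_key X). Qed.

Lemma gprop_pend t a j : pend t a j -> exists k0 k, [/\ keyof s (gprop S t a) = Some k0,
  gco s t j = Some k & (k0 < k)%R].
Proof.
move=> /pendP[st nC av lj]; have [k ek] := store_key st.
have [k0 e0 lk] := pending_key hpost I nC ek av.
by exists k0, k; split=> //; apply: (ext_key X).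
Qed.

(** Pending stores have keys above that of memory by [pending_key], and their keys increase in
    program order by [i_ord] in [s]. *)
Lemma seen_mono t a c c' : c <= c' -> lel (seen t a c) (seen t a c').
Proof.
move=> lec; case: (seenP t a c') => [[-> h]|[j [h1 h2 -> h4]]].
  case: (seenP t a c) => [[-> _]|[j [h1 h2 _ _]]].
    by have [k _ ek] := seen_key_s t a; exists k, k.
  by have := h _ (leq_trans h1 lec); rewrite h2.
have [k0 [k [e0 ek lk]]] := gprop_pend h2.
case: (seenP t a c) => [[-> _]|[j' [h1' h2' -> h4']]].
  by exists k0, k; split=> //; apply: ltW.
have := h4 _ (leq_trans h1' lec) h2'; rewrite leq_eqVlt => /orP[/eqP->|lt].
  by exists k, k.
have [_ [k' [_ ek' _]]] := gprop_pend h2'.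
have [_ _ av _] := pendP h2; have [_ _ av' _] := pendP h2'.
by exists k', k; split=> //; apply: ltW; apply: (i_ord Is ek' ek lt av' av).
Qed.

Lemma store_gp t a j c : store_at S t j -> addr_val d0 S t j a -> j < c -> lel (SStore D t j) (seen t a c).
Proof.
move=> st av lj; case hC: (rC (rt S t) j).
  have [k ek] := i_Cco I hC st; have [k0 e0 le] := i_own I ek av.
  apply: lel_trans (seen_mono t a (leq0n c)); exists k, k0; split=> //=.
    exact: (x_co X).
  exact: (ext_key X).
have hp : pend t a j by rewrite /pend st hC /=; apply/asboolP.
have -> : SStore D t j = seen t a j.+1 by rewrite /= hp.
exact: seen_mono.
Qed.

Lemma loaded_gp t i l a c : rL (rt S t) i = Some l -> addr_val d0 S t i a -> i <= c -> lel l (seen t a c).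
Proof.
move=> El av lc; have [_ _ [b [avb hm hk]]] := i_rL I El; have ? := addr_det av avb; subst b.
case: hk => [[j Ej lj]|[k [k0 [ek e0 le]]]].
  subst l; have [st avj _] := hm; apply: store_gp => //; exact: leq_trans lj lc.
apply: lel_trans (seen_mono t a (leq0n c)); exists k, k0; split=> //; exact: (ext_key X).
Qed.

Lemma pickE t i a : addr_val d0 S t i a -> [pick a | `[< addr_val d0 S t i a >]] = Some a.
Proof.
move=> av; case: pickP => [b /asboolP hb|h]; first by rewrite (addr_det av hb).
by have := h a; rewrite asboolT.
Qed.

(** Everything earlier in the thread is committed, so instruction [i] can be finished on the spot: a
    load without a value reads from memory, where the earlier stores of its thread have arrived, and
    a store takes its key from [s]. If [i] is committed already, the block is empty. *)
Lemma complete_step c t i ms : mrun d0 P S ms (complete c) -> i = c t -> i < size (F t) ->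
  exists2 blk, mrun d0 P (complete c) blk (complete (fun t' => c t' + (t' == t))) & forall e, e \in blk -> inst e = (t, i).
Proof.
move=> hm Ei lti; have IA := mrun_inv hm I; have XA := mrun_ext hm I.
set A := complete c in hm IA XA *; set c' := fun t' => _.
have ltt : t < size P := wf_size w lti.
have c'E t' j : (j < c' t') = (j < c t') || ((t' == t) && (j == i)).
  rewrite /c'; case: eqP => [->|_]; last by rewrite addn0 orbF.
  by rewrite addn1 ltnS leq_eqVlt -Ei orbC.
have lc : (i < c t) = false by rewrite -Ei ltnn.
have CA j : j < i -> rC (rt A t) j by move=> lj; rewrite /= -Ei lj orbT.
have [cm Ecm] : exists cm, cmd_at S t i = Some cm by apply: cmd_at_ex; rewrite FS.
have EcA : cmd_at A t i = Some cm by rewrite -Ecm; apply: cmd_at_eqF.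
have gpc a : gprop A t a = seen t a i by rewrite /= -Ei.
have gp' t' a : seen t' a (c' t') = if (t' == t) && pend t a i then SStore D t i else seen t' a (c t').
  rewrite /c'; case: eqP => [->|_] /=; last by rewrite addn0.
  by rewrite addn1 /= -Ei.
have done_ : rC (rt S t) i -> (load_at S t i -> rL (rt S t) i <> None) -> A = complete c'.
  move=> hC hl; apply: gstate_ext => //=.
  - move=> t' j; rewrite c'E; case: (boolP ((t' == t) && (j == i))) => [/andP[/eqP-> /eqP->]|_].
      by rewrite hC.
    by rewrite orbF.
  - move=> t' j; rewrite c'E; case: (boolP ((t' == t) && (j == i))) => [/andP[/eqP-> /eqP->]|_]; last by rewrite orbF.
    rewrite lc /= /load_result; case El: (rL _ _) => [//|]; case: ifP => // ld; by case: (hl ld).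
  - move=> t' j; rewrite c'E; case: (boolP ((t' == t) && (j == i))) => [/andP[/eqP-> /eqP->]|_]; last by rewrite orbF.
    rewrite lc /=; case ek: (gco S t i) => [k|]; first by rewrite (x_co X ek).
    case ek': (gco s t i) => [k|//]; have [_ _ st _ _] := i_co Is ek'.
    by rewrite (ext_store _ _ X) in st; have [k1] := i_Cco I hC st; rewrite ek.
  - move=> t' a; rewrite gp'; case: ifP => // /andP[_ /and3P[_ nC _]]; by rewrite hC in nC.
have [hC|/negPf nC] := boolP (rC (rt S t) i).
  exists [::] => //; rewrite -done_ //; first exact: mrun_nil.
  exact: cok_load (i_C I hC).2.
have fin_commit B : rF (rt B t) = rF (rt S t) -> rC (rt B t) =1 (fun j => rC (rt A t) j) ->
    invar d0 P B -> ext S B -> (load_at S t i -> rL (rt B t) i <> None) -> cok d0 B t i.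
  move=> eF eC IB XB hl; apply: cok_all => //.
  - by rewrite eF FS.
  - by move=> j lj; rewrite eC CA.
  - move=> [c1 [ex [c2 c3]]]; have [|a av] := @known t i lti; last by exists a; apply: (ext_addr XB).
    by exists c1, ex; rewrite -(x_cmd (x_xf XB)).
  - by rewrite (ext_load _ _ XB).
  - by move=> ex hcm; rewrite (x_cmd (x_xf XB)) // in hcm; rewrite (assume_committed hcm) in nC.
have notA ex : cm <> CAssume ex by move=> Ecm'; subst cm; rewrite (assume_committed Ecm) in nC.
have nCA : ~~ rC (rt A t) i by rewrite /= nC lc.
have nco : gco S t i = None.
  by case ek: (gco S t i) => [k|//]; have [_ hC _ _ _] := i_co I ek; rewrite hC in nC.
have nst_gp : ~~ store_at S t i -> forall t' a, seen t' a (c' t') = seen t' a (c t').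
  by move=> ns t' a; rewrite gp' /pend (negPf ns) andbF.
have nst_co : ~~ store_at S t i -> gco s t i = None.
  move=> ns; case ek: (gco s t i) => [k|//]; have [_ _ h _ _] := i_co Is ek.
  by rewrite (ext_store _ _ X) (negPf ns) in h.
have commit_ns B : ~~ store_at S t i -> ext A B -> invar d0 P B -> 
    (forall t' j, rL (rt B t') j = if j < c' t' then load_result t' j else rL (rt S t') j) ->
    (forall t', rF (rt B t') = rF (rt A t')) -> (forall t' j, rC (rt B t') j = rC (rt A t') j) ->
    (forall t' j, gco B t' j = gco A t' j) -> (forall t' a, gprop B t' a = gprop A t' a) ->
    (load_at S t i -> rL (rt B t) i <> None) -> mrun d0 P B [:: MCommit D t i] (complete c').
  move=> ns XB IB hL hF hC hco hgp hl.
  have -> : complete c' = upd B (MCommit D t i) (SInit d0).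
    apply: gstate_ext => /=.
    - by move=> t'; rewrite hF.
    - by move=> t' j; rewrite hC c'E /= orbA (eq_sym t) (eq_sym i).
    - by move=> t' j; rewrite hL.
    - move=> t' j; rewrite hco c'E /=; case: (boolP ((t' == t) && (j == i))) => [/andP[/eqP-> /eqP->]|_].
        by rewrite orbT lc nst_co.
      by rewrite orbF.
    - by move=> t' a; rewrite hgp nst_gp.
  apply: mrun1; split=> //; first by rewrite hC.
    by apply: fin_commit => //; exact: ext_trans XA XB.
  by rewrite (ext_store _ _ XB) (ext_store _ _ XA).
case: cm Ecm EcA notA => [r ex|e1 e2|r ex|ex] Ecm EcA notA; last by case: (notA ex).
- have ld : load_at S t i := load_atP Ecm.
  have ns : ~~ store_at S t i by rewrite /store_at Ecm.
  have [a av] := known lti (load_has_addr ld).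
  case El : (rL (rt S t) i) => [l|].
    exists [:: MCommit D t i]; last by move=> e; rewrite inE => /eqP->.
    apply: commit_ns => //; [exact: ext_refl| |by move=> _; rewrite /= lc El].
    move=> t' j; rewrite c'E /=; case: (boolP ((t' == t) && (j == i))) => [/andP[/eqP-> /eqP->]|_].
      by rewrite lc /= /load_result El.
    by rewrite orbF.
  have hen : enabled d0 P A (MLoad t i a) (seen t a i).
    split; [exact: ltt|by rewrite (ext_load _ _ XA)|by rewrite [LHS]/= lc|exact: (ext_addr XA)|].
    by left; rewrite gpc.
  exists [:: MLoad t i a; MCommit D t i]; last by move=> e; rewrite !inE => /orP[] /eqP->.
  apply: (mrun_cons hen); apply: commit_ns => //.
  + exact: en_ext IA hen.
  + exact: inv_en IA hen.
  + move=> t' j; rewrite c'E /= (eq_sym t) (eq_sym i).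
    case: (boolP ((t' == t) && (j == i))) => [/andP[/eqP-> /eqP->]|_]; last by rewrite orbF.
    by rewrite orbT /load_result El ld (pickE av).
  + by move=> t' j; rewrite /= orbF.
  + by move=> _; rewrite /= !eqxx.
- have st : store_at S t i by rewrite /store_at Ecm.
  have [a av] := known lti (store_has_addr st).
  have [k ek] : exists k, gco s t i = Some k by apply: store_key; rewrite (ext_store _ _ X).
  have hp : pend t a i by rewrite /pend st nC /=; apply/asboolP.
  have [_ _ _ kp _] := i_co Is ek.
  have coAs t' j k1 : gco A t' j = Some k1 -> gco s t' j = Some k1.
    by rewrite /=; case: ifP => // _; apply: (x_co X).
  have hen : enabled d0 P A (MCommitSt t i k a) (SInit d0).
    split=> //.
    + apply: fin_commit => // /load_atE[r [ex h]]; by rewrite h in Ecm.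
    + by rewrite (ext_store _ _ XA); split=> //; apply: (ext_addr XA).
    + split; first split.
      * by move=> ?; subst k; rewrite ltxx in kp.
      * move=> t' j h; have [? ?] := i_inj Is (coAs _ _ _ h) ek; subst t' j.
        by move: h; rewrite /= lc nco.
      * have [k0 e0 _] := gp_key t a IA; exists k0 => //; rewrite gpc in e0.
        have e0s : keyof s (seen t a i) = Some k0 by case: (seen t a i) e0 => // t' j; apply: coAs.
        case: (seenP t a i) => [[Eg _]|[j [h1 h2 Eg _]]]; rewrite Eg in e0s.
          have [k0' [k' [f1 f2 lk]]] := gprop_pend hp.
          by move: f1; rewrite e0s => -[?]; move: f2; rewrite ek => -[?]; subst.
        have [_ _ avj _] := pendP h2.
        exact: (i_ord Is e0s ek h1 avj (ext_addr X av)).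
  exists [:: MCommitSt t i k a]; last by move=> e; rewrite inE => /eqP->.
  have -> : complete c' = upd A (MCommitSt t i k a) (SInit d0).
    apply: gstate_ext => /=.
    - by [].
    - by move=> t' j; rewrite c'E orbA (eq_sym t) (eq_sym i).
    - move=> t' j; rewrite c'E; case: (boolP ((t' == t) && (j == i))) => [/andP[/eqP-> /eqP->]|_]; last by rewrite orbF.
      rewrite lc /= /load_result; have -> : load_at S t i = false by rewrite /load_at Ecm.
      by case: (rL _ _).
    - move=> t' j; rewrite c'E (eq_sym t) (eq_sym i); case: (boolP ((t' == t) && (j == i))) => [/andP[/eqP-> /eqP->]|_].
        by rewrite orbT ek.
      by rewrite orbF.
    - move=> t' a'; rewrite gp' (eq_sym t); case: eqP => [->|] //=.
      case: (a =P a') => [<-|ne]; first by rewrite hp.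
      case: ifP => // /and3P[_ _ /asboolP av']; case: ne; exact: addr_det av av'.
  exact: mrun1.
- have ns : ~~ store_at S t i by rewrite /store_at Ecm.
  have nld : load_at S t i = false by rewrite /load_at Ecm.
  exists [:: MCommit D t i]; last by move=> e; rewrite inE => /eqP->.
  apply: commit_ns => //; [exact: ext_refl| |by rewrite nld].
  move=> t' j; rewrite c'E /=; case: (boolP ((t' == t) && (j == i))) => [/andP[/eqP-> /eqP->]|_]; last by rewrite orbF.
  by rewrite lc /= /load_result nld; case: (rL _ _).
Qed.

Lemma complete0 : complete (fun _ => 0) = S.
Proof. by apply: gstate_ext => //= t i; rewrite orbF. Qed.

(** The enumeration is arbitrary because threads do not interact; this later allows sorting the
    completion along an order found elsewhere. *)
Lemma complete_run o : enumr F o -> exists ms, [/\ mrun d0 P S ms completed,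
  sorted leq (map (fun e => index (inst e) o) ms) & forall e, e \in ms -> inst e \in o].
Proof.
move=> E.
have H p q : o = p ++ q -> exists ms, [/\ mrun d0 P S ms (complete (cnt p)),
    sorted leq (map (fun e => index (inst e) o) ms) & forall e, e \in ms -> inst e \in p].
  elim/last_ind: p q => [|p [t i] IH] q Eo.
    exists [::]; split=> //; have E0 : complete (cnt [::]) = S := complete0.
    by rewrite E0; apply: mrun_nil.
  rewrite cat_rcons in Eo; have [ms [h1 h2 h3]] := IH _ Eo.
  have E1 := E; rewrite Eo in E1.
  have lti : i < size (F t) by rewrite -(en_mem E) Eo mem_cat mem_head orbT.
  have [blk h4 h5] := complete_step h1 (esym (cnt_next E1)) lti.
  exists (ms ++ blk); split.
  - apply/mrun_cat; exists (complete (cnt p)) => //.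
    suff -> : complete (cnt (rcons p (t, i))) = complete (fun t' => cnt p t' + (t' == t)) by [].
    congr complete; apply: funext => t'; by rewrite -cats1 cnt_cat /cnt /= addn0 eq_sym.
  - have np : (t, i) \notin p by rewrite (cntP _ _ E1) (cnt_next E1) ltnn.
    have iy : index (t, i) o = size p by rewrite Eo index_cat (negPf np) /= eqxx addn0.
    rewrite map_cat; set l1 := map _ ms; set l2 := map _ blk.
    rewrite (sorted_pairwise leq_trans) pairwise_cat -!(sorted_pairwise leq_trans) h2 /=.
    have hl2 z : z \in l2 -> z = size p by move=> /mapP[e /h5 -> ->].
    have hl1 z : z \in l1 -> z <= size p.
      by move=> /mapP[e /h3 he ->]; rewrite Eo index_cat he ltnW // index_mem.
    apply/andP; split.
      by apply/allrelP => a b /hl1 ha /hl2 ->.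
    rewrite (sorted_pairwise leq_trans); apply/(pairwiseP 0) => a b ha hb _.
    by rewrite (hl2 _ (mem_nth 0 ha)) (hl2 _ (mem_nth 0 hb)).
  - move=> e; rewrite mem_cat mem_rcons inE => /orP[/h3 ->|/h5 ->]; by rewrite ?eqxx ?orbT.
have [ms [h1 h2 h3]] := H o [::] (esym (cats0 o)).
exists ms; split=> //; suff <- : complete (cnt o) = completed by [].
by congr complete; apply: funext => t; rewrite (cnt_full _ E).
Qed.

Lemma load_resultE t i a : load_at S t i -> addr_val d0 S t i a -> exists2 l, load_result t i = Some l &
  rL (rt S t) i = Some l \/ (rL (rt S t) i = None /\ l = seen t a i).
Proof.
move=> ld av; rewrite /load_result ld (pickE av) /=; case: (rL _ _) => [l|]; first by exists l => //; left.
by exists (seen t a i) => //; right.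
Qed.

Lemma completed_gco t i : gco completed t i = gco s t i.
Proof.
rewrite /=; case: ltnP => // le; case ek: (gco s t i) => [k|].
  have [_ _ st _ _] := i_co Is ek; have := store_range st.
  by rewrite -/(F t) ltnNge le.
by case ek': (gco S t i) => [k|//]; rewrite (x_co X ek') in ek.
Qed.

Lemma completed_key l : keyof completed l = keyof s l.
Proof. by case: l => // t i; apply: completed_gco. Qed.

(** Keys agree with those of [s], so only the reads are to be compared. Two reads of [S] stand in
    the right relation by finality of [s], and new reads follow [seen_mono]. *)
Lemma completed_final ms : mrun d0 P S ms completed -> final d0 P completed.
Proof.
move=> hm; have XT := mrun_ext hm I.
have av_in t i a : addr_val d0 completed t i a -> i < size (F t).
  by move=> [c [ex [h _]]]; have := cmd_at_lt h; rewrite /= FS.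
have av t i a : addr_val d0 completed t i a -> addr_val d0 S t i a.
  move=> h; have lt := av_in _ _ _ h.
  have [|b hb] := @known t i lt; last exact: ext_addr_inv XT hb h.
  by have [c1 [ex [c2 [c3 _]]]] := h; exists c1, ex; rewrite -(x_cmd (x_xf XT)).
have loadE t i a : load_at completed t i -> addr_val d0 completed t i a ->
    [/\ load_at S t i, addr_val d0 S t i a, rL (rt completed t) i = load_result t i & i < size (F t)].
  move=> ld h; have lt := av_in _ _ _ h; split=> //; last by rewrite /= lt.
    exact: av.
have [_ f2 f3] := fin.
split.
- by move=> t i _ /=; rewrite FS => ->; rewrite orbT.
- move=> t i' i a lt li ld' ld av1' av1.
  have [ldS' avS' -> lt'] := loadE _ _ _ ld' av1'; have [ldS avS -> lti] := loadE _ _ _ ld av1.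
  have [l1 -> h1] := load_resultE ldS' avS'; have [l2 -> h2] := load_resultE ldS avS.
  suff [k1 [k2 [e1 e2 le]]] : lel l1 l2.
    by exists l1, l2, k1, k2; rewrite !completed_key.
  have fin2 : exists l' l k1 k2, [/\ rL (rt s t) i' = Some l', rL (rt s t) i = Some l,
     keyof s l' = Some k1, keyof s l = Some k2 & (k1 <= k2)%R].
    by apply: (f2 t i' i a) => //; [rewrite (ext_load _ _ X)|rewrite (ext_load _ _ X)|exact: (ext_addr X)|exact: (ext_addr X)].
  have [m1 [m2 [k1 [k2 [g1 g2 g3 g4 g5]]]]] := fin2.
  case: h1 => [E1|[N1 E1]]; case: h2 => [E2|[N2 E2]].
  + have := ext_L X E1; rewrite g1 => -[?]; subst m1.
    have := ext_L X E2; rewrite g2 => -[?]; subst m2.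
    by exists k1, k2.
  + by subst l2; apply: loaded_gp E1 avS' (ltnW li).
  (* The delicate case: the later load has read in [S], the earlier one reads only now. If it finds
     memory, [future_load] bounds this by what it reads in [s]. If it finds a pending store of its
     thread, finality of [s] compares that store with the later load. *)
  + have := ext_L X E2; rewrite g2 => -[?]; subst m2 l1.
    case: (seenP t a i') => [[-> np]|[j [lj hp -> _]]].
      have [k0 e0 e0s] := seen_key_s t a.
      case: (future_load hpost I N1 g1 avS') => [[k0' [k1' [e0' e1' le']]]|[j [Ej lj st avj nCj]]].
        exists k0, k2; split=> //; apply: le_trans g5.
        move: e0' e1'; rewrite e0 g3 => -[?] [?]; by subst k0' k1'.
      have lj' : j < size (F t) := ltn_trans lj lt'.
      have stj : store_at S t j by rewrite -(ext_store t j X).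
      have [b hb] := known lj' (store_has_addr stj).
      have avj' : addr_val d0 S t j a := ext_addr_inv X hb avj.
      by have := np _ lj; rewrite /pend stj nCj /= asboolT.
    have [stj nCj avj ltj] := pendP hp.
    have [l [k1' [k2' [q1 q2 q3 q4]]]] : exists l k1 k2, [/\ gco s t j = Some k1, rL (rt s t) i = Some l,
        keyof s l = Some k2 & (k1 <= k2)%R].
      apply: (f3 t j i a) => //; first exact: ltn_trans lj li.
        by rewrite (ext_load _ _ X).
      exact: (ext_addr X).
    by move: q2; rewrite g2 => -[?]; subst l; exists k1', k2'.
  + by subst l1 l2; apply: seen_mono; apply: ltnW.
- move=> t i' i a lt li st' ld av1' av1.
  have lt' := av_in _ _ _ av1'; have avS' := av _ _ _ av1'.
  have [ldS avS -> lti] := loadE _ _ _ ld av1.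
  have [l -> h] := load_resultE ldS avS.
  suff [k1 [k2 [e1 e2 le]]] : lel (SStore D t i') l.
    by exists l, k1, k2; rewrite completed_key completed_gco.
  case: h => [E1|[N1 ->]]; last exact: store_gp.
  have [m [k1 [k2 [g1 g2 g3 g4]]]] : exists l k1 k2, [/\ gco s t i' = Some k1, rL (rt s t) i = Some l,
      keyof s l = Some k2 & (k1 <= k2)%R].
    apply: (f3 t i' i a) => //; [by rewrite (ext_store _ _ X); exact: st'|by rewrite (ext_load _ _ X)|exact: (ext_addr X)|exact: (ext_addr X)].
  have := ext_L X E1; rewrite g2 => -[?]; subst m.
  by exists k1, k2.
Qed.

Lemma completed_same : (forall t i, i < size (F t) -> rC (rt S t) i) ->
  (forall t i, rL (rt S t) i = rL (rt s t) i) -> same s completed.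
Proof.
move=> hC hL; split; [exact: FS| | |exact: completed_gco].
- move=> t i /=; case: (ltnP i (size (F t))) => [lt|le]; first by rewrite hC // rC_s.
  rewrite orbF; apply/idP/idP; first by apply: (x_C (x_xf X)).
  by move=> /(i_C Is)[_ []]; rewrite -/(F t) ltnNge le.
- move=> t i /=; case: ltnP => [lt|le]; last exact: hL.
  rewrite -hL /load_result; case El: (rL _ _) => [//|]; case: ifP => // ld.
  by have := cok_load (i_C I (hC _ _ lt)).2 ld; rewrite El.
Qed.

(** Visible to its own thread only, the store could be read just by loads before it. But those at
    its address had to be committed, and hence to have read, before the store was. *)
Lemma completed_unread t n : size (F t) = n.+1 ->
  (forall t' i, rL (rt S t') i <> Some (SStore D t n)) ->
  (forall t' a, gprop S t' a = SStore D t n -> t' = t) ->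
  forall t' i, rL (rt completed t') i <> Some (SStore D t n).
Proof.
move=> En nL ng t' i /=; case: ltnP => [lti|_]; last exact: nL.
rewrite /load_result; case El: (rL _ _) => [l|]; first by rewrite -El; apply: nL.
case: ifP => // ld; case: pickP => //= a /asboolP av [Eg].
have hCn := G En; case: (seenP t' a i) => [[E0 _]|[j [h1 /and3P[_ nC _] E0 _]]]; rewrite Eg in E0.
  have ? := ng _ _ (esym E0); subst t'.
  have [_ avn] := i_gp2 I (esym E0); have [_ ck] := i_C I hCn.
  move: lti; rewrite En ltnS leq_eqVlt => /orP[/eqP ?|ltin].
    subst i; have := last_store En; rewrite (ext_store _ _ X) => st.
    by move: st ld; rewrite /store_at /load_at; case: cmd_at => // -[].
  case: (cok_same ck avn ltin (load_has_addr ld)) => [hCi|[b hb]]; last by case; apply: addr_det hb av.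
  by have := cok_load (i_C I hCi).2 ld; rewrite El.
by move: E0 nC => -[<- <-]; rewrite hCn.
Qed.

End Completion.

(** * Normal form when every thread ends in a store *)

Section CompletionCase.
Variables (D Reg : finType) (d0 : D) (P : program D Reg).
Implicit Types (S T s : gstate D Reg) (t i j : nat) (e f : mev D) (x : nat * nat).

(** An earlier state knows fewer reads, keys and addresses, hence has fewer edges. *)
Lemma ranked_ext S T x rk : ext S T -> ranked d0 T x rk -> ranked d0 S x rk.
Proof.
move=> X R; split.
- by move=> t i j lij ltj; rewrite -(x_F X) in ltj; apply: (r_po R).
- by move=> t j t' i' El; apply: (r_src R); apply: (x_L (x_xf X)).
- move=> t i t' i' a k k' ek ek' av av' lk.
  exact: (r_co R (x_co X ek) (x_co X ek') (ext_addr X av) (ext_addr X av') lk).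
- move=> t j t' i' a l k k' El av ekl ek' av' lk.
  exact: (r_cf R (ext_L X El) (ext_addr X av) (ext_key X ekl) (x_co X ek') (ext_addr X av') lk).
Qed.

Lemma empty_acyclic s : invar d0 P s -> wfF P (fun t => rF (rt s t)) ->
  (forall t, rF (rt s t) = [::]) -> ~ hb_cyclic (trace_of d0 P s).
Proof.
move=> I w h; apply: (ranked_acyclic I w (rk := fun _ => 0)); split.
- by move=> t i j _; rewrite h.
- by move=> t j t' i' /(i_rL I)[_ /load_atE[r [ex /cmd_at_lt]]]; rewrite h.
- by move=> t i t' i' a k k' _ _ [c [ex [/cmd_at_lt]]]; rewrite h.
- by move=> t j t' i' a l k k' _ [c [ex [/cmd_at_lt]]]; rewrite h.
Qed.

Lemma completion_violation s nf : computation d0 P s nf -> hb_cyclic (trace_of d0 P s) ->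
  (forall t n, size (rF (rt s t)) = n.+1 -> store_at s t n) ->
  (forall s' nf', computation d0 P s' nf' -> size (nodes P s') < size (nodes P s) ->
     hb_cyclic (trace_of d0 P s') -> nf_violation d0 P) -> nf_violation d0 P.
Proof.
move=> [w hm fin] cyc last IH; set F := fun t => rF (rt s t); rewrite -/F in w hm.
have I0 := inv_full d0 P F; have Is := mrun_inv hm I0.
apply: contrapT => noNF.
(* If no normal form is a violation, completions stay acyclic along all prefixes with a good state.
   On the whole computation this contradicts [cyc], since the completion then has the same trace. *)
suff H : forall pre post S, nf = pre ++ post -> mrun d0 P (full F) pre S -> mrun d0 P S post s ->
    good S s -> ~ hb_cyclic (trace_of d0 P (completed d0 S s)).
  have hall t i : i < size (F t) -> rC (rt s t) i by apply: (rC_s w fin).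
  apply: (H nf [::] s); rewrite ?cats0 //; first exact: mrun_nil.
    by move=> t n En; apply: hall; rewrite /F En.
  apply: (trace_eq_cyclic _ cyc); apply: same_trace.
  exact: (completed_same (mrun_nil d0 P s) Is w fin hall (fun _ _ => erefl)).
have EF S pre : mrun d0 P (full F) pre S -> (fun t => rF (rt S t)) = F.
  by move=> h; apply: funext => t; rewrite (mrun_F h).
have nodesE T : (fun t => rF (rt T t)) = F -> nodes P T = nodes P s.
  move=> E; rewrite /nodes; congr flatten; apply: eq_map => t.
  by have -> : rF (rt T t) = rF (rt s t) := congr1 (fun g : nat -> seq (instr D Reg) => g t) E.
have compl S pre post : mrun d0 P (full F) pre S -> mrun d0 P S post s -> good S s ->
    forall o, enumr F o -> exists ms, [/\ computation d0 P (completed d0 S s) (pre ++ ms),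
      mrun d0 P S ms (completed d0 S s), sorted leq (map (fun e => index (inst e) o) ms) &
      (fun t => rF (rt (completed d0 S s) t)) = F].
  move=> h1 h2 G o Eo; have I := mrun_inv h1 I0.
  have [ms [h3 h4 h5]] := complete_run h2 I w fin last G Eo.
  have E : (fun t => rF (rt (completed d0 S s) t)) = F by rewrite -(EF _ _ h1).
  exists ms; split=> //; split; rewrite ?E //.
    by apply/mrun_cat; exists S.
  exact: (completed_final h2 I w fin last G h3).
(* Before anything is executed, program order gives the only edges. *)
have enumF : exists o, enumr F o.
  have ac : ~ hb_cyclic (trace_of d0 P (full F)).
    by apply: (ranked_acyclic I0 w (rk := fun y => y.2)).
  by have [o [Eo _]] := acyclic_ranked (size P, 0) I0 w ac; exists o.
elim/last_ind=> [|pre e IHpre] post S Enf hpre hpost G.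
  have nil t : F t = [::].
    case Ef: (F t) => [//|y l]; have := G t (size l); rewrite -/(F t) Ef => /(_ erefl).
    by inversion hpre.
  by case: (empty_acyclic Is w nil).
move=> cycS; apply: noNF.
have I := mrun_inv hpre I0.
have [S0 [l [hpre0 hen ES]]] := (mrun_rcons _ _ _ _ _ _).1 hpre.
have I00 := mrun_inv hpre0 I0.
have hpost0 : mrun d0 P S0 (e :: post) s by apply: (mrun_cons hen); rewrite -ES.
have [G0|nG0] := pselect (good S0 s).
  have ac0 := IHpre (e :: post) S0; rewrite cat_rcons in Enf.
  have {}ac0 := ac0 Enf hpre0 hpost0 G0.
  have [o0 Eo0] := enumF.
  have [ms0 [C0 hms0 _ EF0]] := compl _ _ _ hpre0 hpost0 G0 _ Eo0.
  have [w0 hm0 _] := C0.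
  have [o [Eo R]] := acyclic_ranked (size P, 0) (mrun_inv hms0 I00) w0 ac0.
  rewrite EF0 in Eo.
  have R0 := ranked_ext (mrun_ext hms0 I00) R.
  set rk := fun y => index y o in R0.
  pose N := (size pre).+1; pose K f := rk (inst f) * N + index f pre.
  have idN f : index f pre < N by rewrite /N ltnS index_size.
  have Kr f g : rk (inst f) < rk (inst g) -> K f < K g by move=> h; apply: lex2.
  set pre' := sort (fun f g => K f <= K g) pre.
  have mpre : pre' =i pre by move=> f; rewrite mem_sort.
  have [|||||||T hT HLT] := @reorder _ _ d0 P F F pre S0 pre' (size P, 0) true (fun y z => rk y <= rk z) hpre0.
  - by rewrite sort_uniq; apply: mrun_uniq hpre0.
  - by move=> f; rewrite mpre andbT.
  - by [].
  - move=> g f; rewrite !mpre => hg hf lt hc; apply: sort_index_lt => //.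
    have ninst h : h \in pre -> inst h <> (size P, 0).
      move=> /(mrun_range hpre0) /=; case: (inst h) => t i /= lti [Et _].
      by have := wf_size w lti; rewrite Et ltnn.
    have : rk (inst f) <= rk (inst g) by case/or3P: hc => [/eqP/(ninst _ hf)|/eqP/(ninst _ hg)|].
    rewrite leq_eqVlt => /orP[/eqP Er|]; last exact: Kr.
    by rewrite /K Er ltn_add2l.
  - exact: ranked_compat.
  - move=> t i El; have [_ _ [a [_ [/store_atE[e1 [e2 h]] _ _] _]]] := i_rL I00 El.
    have := cmd_at_lt h; rewrite (mrun_F hpre0) => /(wf_size w) /=; by rewrite ltnn.
  - move=> i _ /=; rewrite leqNgt; apply/negP => /(leq_ltn_trans (leq0n i)).
    by move=> lt; have := wf_size w (t := size P) (i := 0); rewrite ltnn => h; apply: notF; apply: h; apply: leq_ltn_trans lt.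
  have ET := perm_state hpre0 hT mpre HLT; subst T.
  have hpre1 : mrun d0 P (full F) (rcons pre' e) S by apply/mrun_rcons; exists S0, l.
  (* The cyclic completion after [e] is scheduled along the order of the acyclic completion before
     [e], so that the sorted prefix and the completion agree. *)
  have [ms [C hms so EF1]] := compl _ _ _ hpre1 hpost G _ Eo.
  have lP : 0 < size P.
    have lti := en_range hen; rewrite (mrun_F hpre0) in lti.
    exact: leq_ltn_trans (wf_size w lti).
  (* With the fetches these are four pieces; |P|-1 empty ones fill up to |P|+3. *)
  set pieces := [:: pre'; [:: e]; ms] ++ nseq (size P).-1 [::].
  have Ep : rcons pre' e ++ ms = flatten pieces.
    rewrite /pieces /=; have -> : flatten (nseq (size P).-1 [::]) = [::] :> seq (mev D).
      by elim: (_.-1).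
    by rewrite cats0 cat_rcons.
  have [||evs [pr nfe]] := comp_normal_form C (o := o) _ Ep; first by rewrite EF1.
    move=> p; rewrite mem_cat !inE mem_nseq => /orP[/or3P[]|/andP[_]] /eqP -> //.
    apply: sort_sorted_index => f g _ _; apply: contraTT; rewrite -!ltnNge; exact: Kr.
  exists evs, (completed d0 S s); split=> //.
  have E k : 0 < k -> (3 + k.-1).+1 = k + 3 by case: k => // k _; rewrite [RHS]addnC addnS.
  by rewrite -(E _ lP); move: nfe; rewrite size_cat size_nseq.
have [t [n [En nC]]] : exists t n, size (F t) = n.+1 /\ ~~ rC (rt S0 t) n.
  apply: contrapT => h; apply: nG0 => t n En; apply: contrapT => nC; apply: h.
  by exists t, n; split=> //; apply/negP.
have ic : iscom e t n by have := G t n En; rewrite ES upd_rC (negPf nC).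
have nco : gco S0 t n = None.
  by case ek: (gco S0 t n) => [k|//]; have [_ hC _ _ _] := i_co I00 ek; rewrite hC in nC.
have [o0 Eo0] := enumF.
have [ms [C hms _ EF1]] := compl _ _ _ hpre hpost G _ Eo0.
(* Here [e] is the commit of a last store. No load can have read it before, as no load follows it in
   its thread and it had no key, and so far it has reached its own thread only. *)
apply: (deletion_violation C cycS (x := (t, n))) => /=.
- by rewrite -[RHS]En; congr size; have := congr1 (fun g : nat -> seq (instr D Reg) => g t) EF1.
- apply: (completed_unread hpost I last G En).
    move=> t' i; have -> : rL (rt S t') i = rL (rt S0 t') i by rewrite ES; case: (e) ic.
    move=> El; have [_ ld [a [_ _ hk]]] := i_rL I00 El.
    case: hk => [[i' [? ?] lti]|[k [k0 [/=]]]]; last by rewrite nco.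
    subst t' i'; have [r [ex hcm]] := load_atE ld; have := cmd_at_lt hcm.
    by rewrite (mrun_F hpre0) -/(F t) En ltnS leqNgt lti.
  move=> t' a; rewrite ES /=; case: ifP => [pr _|_ Eg].
    by case: (e) ic pr => //= t1 i1 k a1 /andP[/eqP -> _] /andP[/eqP ->].
  by have [[k ek] _] := i_gp2 I00 Eg; rewrite nco in ek.
by move=> s' nf' C' lt cyc'; apply: IH C' _ cyc'; rewrite -(nodesE _ EF1).
Qed.

Lemma violation_normal_form s nf : computation d0 P s nf -> hb_cyclic (trace_of d0 P s) ->
  nf_violation d0 P.
Proof.
have [m] := ubnP (size (nodes P s)); elim: m s nf => // m IHm s nf ltm C cyc.
have IH s' nf' : computation d0 P s' nf' -> size (nodes P s') < size (nodes P s) ->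
    hb_cyclic (trace_of d0 P s') -> nf_violation d0 P.
  move=> C' lt; apply: IHm C'; exact: leq_trans lt _.
have [[t [n [En unr]]]|h] := pselect (exists t n, size (rF (rt s t)) = n.+1 /\
   forall t' i, rL (rt s t') i <> Some (SStore D t n)).
  by apply: (deletion_violation C cyc (x := (t, n))).
apply: (completion_violation C cyc) => // t n En; have [_ hm _] := C.
have Is := reach_inv hm.
apply: contrapT => nst; apply: h; exists t, n; split=> // t' i El.
by have [_ _ [a [_ [st _ _] _]]] := i_rL Is El.
Qed.

End CompletionCase.

Theorem theorem1 (D Reg : finType) (d0 : D) (P : program D Reg) :
  robust d0 P <->
  ~ (exists (evs : seq (event D Reg)) (s : gstate D Reg),
        [/\ power_run d0 P evs s, normal_form (size P + 3) evs &
            hb_cyclic (trace_of d0 P s)]).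
Proof.
split=> [rob [evs [s [pr _ cyc]]]|nov evs s pr].
  have [evs' [s' [sc te]]] := rob _ _ pr.
  exact: sc_acyclic sc (trace_eq_cyclic te cyc).
have C := power_comp pr; have [w hm fin] := C.
have I := reach_inv hm.
have ac : ~ hb_cyclic (trace_of d0 P s) by move=> cyc; apply/nov/(violation_normal_form C cyc).
have [o [Eo R]] := acyclic_ranked (size P, 0) I w ac.
exact: sc_exists I w fin Eo R.
Qed.
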